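(* Let $H$ be a real Hilbert space and suppose $\mu$ is a stable Borel probability measure on the unit sphere $\mathbb{S}$ of $H$, i.e. $\mu(\{x\})<\frac12$ for every $x\in\mathbb{S}$. Then there exists a unique conformal barycenter $w_*(\mu)$ of $\mu$. Moreover, for every starting point $w_0\in\mathbb{B}$, the iterates $(w_k)_{k\in\mathbb{N}}$ defined by either of the algorithms (A) or (B) described in the context converge quadratically to $w_*(\mu)$ in the sense that there is a $C>0$ (depending on $\mu$) with $$\limsup_{k\to\infty}\frac{d_g(w_{k+1},w_*(\mu))}{d_g(w_k,w_*(\mu))^2}\le C .$$
   Context: $H$ is a real Hilbert space (of arbitrary dimension) with inner product $\langle\cdot,\cdot\rangle$ and norm $|\cdot|$. $\mathbb{B}=\{z\in H:|z|<1\}$ carries the Poincaré metric $g|_w(X,Y)=\frac{4}{(1-|w|^2)^2}\langle X,Y\rangle$, with norm $|\cdot|_g$, geodesic distance $d_g$, Riemannian exponential map $\exp$ (in particular $\exp_0(u)=\frac{\tanh|u|}{|u|}u$, $\exp_0(0)=0$) and Levi-Civita covariant derivative $\nabla$; $X^\flat=g(X,\cdot)$. Director: for $w\in\mathbb{B}$, $x\in\mathbb{S}$, $V_x(w)\in T_w\mathbb{B}$ is the $g$-unit tangent vector with $\lim_{t\to\infty}\exp_w(tV_x(w))=x$ in $H$; explicitly $V_x(w)=\frac12\,\frac{(1-|w|^2)^2x-2(1-|w|^2)(1-\langle w,x\rangle)w}{1-2\langle w,x\rangle+|w|^2}$. For a Borel probability measure $\mu$ on $\mathbb{S}$, $F_\mu(w)=\int_{\mathbb{S}}V_x(w)\,\mathrm{d}\mu(x)$;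 a conformal barycenter of $\mu$ is a $w\in\mathbb{B}$ with $F_\mu(w)=0$. One has $\nabla F_\mu(w)=\int_{\mathbb{S}}V_x(w)\otimes V_x(w)^\flat\,\mathrm{d}\mu(x)-\mathrm{id}_{T_w\mathbb{B}}$. The potential is $\varPsi_\mu(w)=\int_{\mathbb{S}}\log\frac{|x-w|^2}{1-|w|^2}\,\mathrm{d}\mu(x)$, which satisfies $F_\mu=-\operatorname{grad}_g\varPsi_\mu$. Shift transformation: $\sigma(w,z)=\sigma_w(z)=\frac{(1-|w|^2)z-(1+|z|^2-2\langle w,z\rangle)w}{1-2\langle w,z\rangle+|w|^2|z|^2}$ for $w\in\mathbb{B}$, $z\in\mathbb{B}\cup\mathbb{S}$; $(\sigma_w)_{\#}\mu$ is the push-forward of $\mu$ under $\sigma_w|_{\mathbb{S}}$. Fix constants $\alpha\ge0$, $0<c_1\le\frac12$, $c_1<c_2<1$. Algorithm (A) (damped regularized Newton): given $w_k$, $$v_k=-\big(\nabla F_\mu(w_k)-\alpha\,|F_\mu(w_k)|_g^2\,\mathrm{id}_{T_{w_k}\mathbb{B}}\big)^{-1}F_\mu(w_k),\qquad w_{k+1}=\exp_{w_k}(\tau_kv_k),$$ with merit function $f_k(t)=\varPsi_\mu(\exp_{w_k}(t\,v_k))$. Algorithm (B) (shifted variant): given $w_k$, $$\mu_k=(\sigma_{w_k})_{\#}\mu,\qquad u_k=-\big(\nabla F_{\mu_k}(0)-\alpha\,|F_{\mu_k}(0)|_g^2\,\mathrm{id}_H\big)^{-1}F_{\mu_k}(0),\qquad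 w_{k+1}=\sigma(-w_k,\exp_0(\tau_ku_k)),$$ with merit function $f_k(t)=\varPsi_{\mu_k}(\exp_0(t\,u_k))$. In both algorithms the step size $\tau_k>0$ is chosen such that - $f_k(\tau_k)\le f_k(0)+c_1\tau_kf_k'(0)$ (Armijo condition), - $f_k'(\tau_k)\ge c_2f_k'(0)$ (weak Wolfe condition), - $\tau_k=1$ whenever $\tau_k=1$ satisfies both of these conditions. If $w_k=w_*(\mu)$ for some $k$ (so that all later iterates coincide with it), the quotient $0/0$ in the limsup is read as $0$.
   Formalization: The quadratic rate bound is stated only for c_1 < 1/2: at c_1 = 1/2 it is false, since the Armijo condition can reject the unit step at every iteration and convergence may be only linear. Existence, uniqueness and convergence cover all 0 < c_1 ≤ 1/2. *)

(* Defs.v *)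
From HB Require Import structures.
From mathcomp Require Import all_boot all_order all_algebra.
From mathcomp Require Import all_classical all_reals all_analysis.
From mathcomp Require Import ring lra.

Set Implicit Arguments.
Unset Strict Implicit.
Unset Printing Implicit Defensive.

Import Order.TTheory GRing.Theory Num.Theory.
Import numFieldNormedType.Exports.

Local Open Scope classical_set_scope.
Local Open Scope ring_scope.

HB.mixin Record isHilbert (R : realType) H & CompleteNormedModule R H := {
  inner : H -> H -> R;
  innerC : forall x y, inner x y = inner y x;
  innerDl : forall x y z, inner (x + y) z = inner x z + inner y z;
  innerZl : forall a x y, inner (a *: x) y = a * inner x y;
  inner_norm : forall x, inner x x = `|x| ^+ 2
}.

#[short(type="hilbertType")]
HB.structure Definition Hilbert (R : realType) :=
  {H of CompleteNormedModule R H & isHilbert R H}.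

Section InnerTheory.
Context {R : realType} {H : hilbertType R}.
Implicit Types (a : R) (x y z w X : H).

Lemma innerDr x y z : inner x (y + z) = inner x y + inner x z.
Proof. by rewrite innerC innerDl !(innerC x). Qed.

Lemma innerZr a x y : inner x (a *: y) = a * inner x y.
Proof. by rewrite innerC innerZl innerC. Qed.

Lemma innerNl x y : inner (- x) y = - inner x y.
Proof. by rewrite -scaleN1r innerZl mulN1r. Qed.

Lemma innerNr x y : inner x (- y) = - inner x y.
Proof. by rewrite innerC innerNl innerC. Qed.

Lemma inner_polar x y :
  inner x y = 2^-1 * (`|x + y| ^+ 2 - `|x| ^+ 2 - `|y| ^+ 2).
Proof. by rewrite -!inner_norm innerDl !innerDr (innerC y x); field. Qed.

Lemma inner_continuous w : continuous (inner w).
Proof.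
rewrite (_ : inner w =
  fun z => 2^-1 * (`|w + z| ^+ 2 - `|w| ^+ 2 - `|z| ^+ 2)); last first.
  by apply/funext => z; rewrite inner_polar.
have cn : continuous (fun z : H => `|z| ^+ 2 : R).
  move=> z; rewrite (_ : (fun z : H => _) = fun z => `|z| * `|z|).
    by apply: cvgM; exact: norm_continuous.
  by apply/funext => u; rewrite expr2.
have cn' : continuous (fun z : H => `|w + z| ^+ 2 : R).
  move=> z; apply: (@continuous_comp _ _ _ (fun z => w + z)
    (fun u : H => `|u| ^+ 2 : R)); last exact: cn.
  by apply: cvgD; [exact: cvg_cst|exact: cvg_id].
move=> z; apply: cvgM; first exact: cvg_cst.
apply: cvgB; last exact: cn.
by apply: cvgB; [exact: cn'|exact: cvg_cst].
Qed.

Lemma is_derive_sqnorm w X :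
  is_derive w X (fun u : H => `|u| ^+ 2 : R) (2 * inner w X).
Proof.
suff lim0 : (fun h : R => h^-1 *: (((fun u : H => `|u| ^+ 2 : R) \o shift w)
    (h *: X) - `|w| ^+ 2)) @ 0^' --> 2 * inner w X.
  by apply: DeriveDef; [apply/cvg_ex; eexists; exact: lim0|exact: cvg_lim lim0].
have cvgl : (fun h : R => 2 * inner w X + h * `|X| ^+ 2) @ 0^' -->
    2 * inner w X.
  rewrite -[X in _ --> X]addr0 -[X in _ + X](mul0r (`|X| ^+ 2)).
  apply: cvgD; first exact: cvg_cst.
  by apply: cvgM; [exact: nbhs_dnbhs|exact: cvg_cst].
apply: cvg_trans cvgl; apply: near_eq_cvg; near=> h.
have h0 : h != 0 by near: h; exact: nbhs_dnbhs_neq.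
rewrite /= -!inner_norm.
rewrite innerDl !innerDr !innerZl !innerZr (innerC X w) /GRing.scale/=.
by field.
Unshelve. all: by end_near. Qed.

End InnerTheory.

Section PoincareBall.
Context {R : realType} {H : hilbertType R}.
Implicit Types (w x z X Y Z u v : H) (c : R -> H).

Definition pmetric w X Y : R := 4 / (1 - `|w| ^+ 2) ^+ 2 * inner X Y.

Definition pnorm w X : R := Num.sqrt (pmetric w X X).

(* A C^1 curve on [0, 1] extends to a C^1 curve on the line; C^1 curves and
   piecewise C^1 curves give the same infimum of lengths. *)
Definition curve_between u v c :=
  [/\ forall t, derivable c t 1, continuous (derive1 c), c 0 = u, c 1 = v
    & forall t, 0 <= t <= 1 -> `|c t| < 1].

Definition plength c : R :=
  \int[lebesgue_measure]_(t in `[0, 1]) pnorm (c t) (derive1 c t).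

Definition pdist u v : R := inf [set plength c | c in curve_between u v].

(* The Christoffel operator of the Levi-Civita connection of [pmetric], in the
   chart given by the inclusion of the ball in H. *)
Definition christoffel w X Y : H :=
  2 / (1 - `|w| ^+ 2) *:
    (inner w X *: Y + inner w Y *: X - inner X Y *: w).

Lemma christoffelC w X Y : christoffel w X Y = christoffel w Y X.
Proof.
by rewrite /christoffel (innerC X Y) [inner w X *: Y + _]addrC.
Qed.

Lemma is_derive_pmetric w X Y Z : `|w| < 1 ->
  is_derive w X (fun u => pmetric u Y Z)
    (16 * inner w X / (1 - `|w| ^+ 2) ^+ 3 * inner Y Z).
Proof.
move=> w1.
have w2 : 1 - `|w| ^+ 2 != 0.
  by rewrite gt_eqF// subr_gt0 expr_lt1.
pose D (u : H) : R := (1 - `|u| ^+ 2) ^+ 2.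
have dD : is_derive w X D (- 4 * (1 - `|w| ^+ 2) * inner w X).
  pose q (u : H) : R := 1 - `|u| ^+ 2.
  have dq : is_derive w X q (- (2 * inner w X)).
    rewrite -[X in is_derive _ _ _ X]add0r.
    have -> : q = cst 1 - (fun u : H => `|u| ^+ 2) by exact/funext.
    exact: (is_deriveB (is_derive_cst _ _ _) (is_derive_sqnorm w X)).
  have := @is_deriveX _ _ q 2 w X _ dq.
  rewrite (_ : q ^+ 2 = D); last by apply/funext => u; rewrite /D/q expr2.
  by move/is_derive_eq; apply; rewrite /q /GRing.scale/=; ring.
have Dw : D w != 0 by rewrite expf_neq0.
have dV : is_derive w X (fun u => (D u)^-1)
    (- (D w) ^- 2 *: (- 4 * (1 - `|w| ^+ 2) * inner w X)).
  apply: DeriveDef; first by apply: derivableV => //; exact: ex_derive.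
  by rewrite deriveV// derive_val.
have := @is_deriveZ _ _ _ (fun u => (D u)^-1) (4 * inner Y Z) w X _ dV.
rewrite (_ : _ \*: _ = fun u => pmetric u Y Z); last first.
  by apply/funext => u; rewrite /pmetric /D /GRing.scale/= mulrAC.
by move/is_derive_eq; apply; rewrite /D /GRing.scale/=; field.
Qed.

(* The Koszul formula (for constant vector fields), which determines the
   Levi-Civita connection. *)
Lemma christoffel_koszul w X Y Z : `|w| < 1 ->
  2 * pmetric w (christoffel w X Y) Z =
    'D_X (fun u => pmetric u Y Z) w + 'D_Y (fun u => pmetric u X Z) w
    - 'D_Z (fun u => pmetric u X Y) w.
Proof.
move=> w1; have w2 : 1 - `|w| ^+ 2 != 0.
  by rewrite gt_eqF// subr_gt0 expr_lt1.
rewrite !(derive_val (is_derive := is_derive_pmetric _ _ _ w1)).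
rewrite /pmetric /christoffel innerZl !innerDl innerNl !innerZl.
by field.
Qed.

Definition nabla (F : H -> H) w X : H := 'D_X F w + christoffel w X (F w).

Definition geodesic c := forall t,
  [/\ `|c t| < 1, derivable c t 1, derivable (derive1 c) t 1
    & derive1 (derive1 c) t + christoffel (c t) (derive1 c t) (derive1 c t) = 0].

(* The Poincare metric is complete: all maximal geodesics are defined on the
   whole line. *)
Definition pexp w v : H :=
  get [set z | exists c, [/\ geodesic c, c 0 = w, derive1 c 0 = v & c 1 = z]].

Definition director w x : H :=
  2^-1 *: ((1 - 2 * inner w x + `|w| ^+ 2)^-1 *:
    ((1 - `|w| ^+ 2) ^+ 2 *: x
     - (2 * (1 - `|w| ^+ 2) * (1 - inner w x)) *: w)).

Definition sigma w z : H :=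
  (1 - 2 * inner w z + `|w| ^+ 2 * `|z| ^+ 2)^-1 *:
    ((1 - `|w| ^+ 2) *: z - (1 + `|z| ^+ 2 - 2 * inner w z) *: w).

End PoincareBall.

Definition borel {R : realType} (H : hilbertType R) :=
  g_sigma_algebraType (@open H).

Section Shift.
Context {R : realType} {H : hilbertType R}.

Definition sigma_borel (w : H) : borel H -> borel H := sigma w.

Lemma measurable_sigma_borel w : measurable_fun setT (sigma_borel w).
Proof.
pose D (z : H) : R := 1 - 2 * inner w z + `|w| ^+ 2 * `|z| ^+ 2.
have cn : continuous (fun z : H => `|z| ^+ 2 : R).
  move=> z; rewrite (_ : (fun z : H => _) = fun z => `|z| * `|z|).
    by apply: cvgM; exact: norm_continuous.
  by apply/funext => u; rewrite expr2.
have ci z : (fun z => 2 * inner w z) @ z --> 2 * inner w z.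
  by apply: cvgM; [exact: cvg_cst|exact: inner_continuous].
have cD : continuous D.
  move=> z; apply: cvgD; last by apply: cvgM; [exact: cvg_cst|exact: cn].
  by apply: cvgB; [exact: cvg_cst|exact: ci].
pose U : set H := [set z | D z != 0].
have oU : open U.
  have -> : U = D @^-1` [set r | r != 0] by [].
  apply: open_comp; first by move=> z _; exact: cD.
  exact: open_neq.
have cs z : U z -> {for z, continuous (sigma w : H -> H)}.
  move=> Uz; apply: cvgZ; first by apply: cvgV => //; exact: cD.
  apply: cvgB; first by apply: cvgZ; [exact: cvg_cst|exact: cvg_id].
  apply: cvgZ; last exact: cvg_cst.
  apply: cvgB; last exact: ci.
  by apply: cvgD; [exact: cvg_cst|exact: cn].
have mU : measurable (U : set (borel H)) by exact: sub_sigma_algebra.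
apply: (@measurability _ _ (borel H) (borel H) _ _ (@open H)) => // _ [V oV <-].
rewrite setTI.
rewrite -(setIT (_ @^-1` V)) -(setUv U) setIUr; apply: measurableU.
  apply: sub_sigma_algebra; rewrite setIC openE => z [Uz Vz] /=.
  rewrite /interior; apply: filterI; first exact: open_nbhs_nbhs.
  by apply: (cs z Uz); exact: open_nbhs_nbhs.
have s0 z : ~ U z -> sigma w z = 0.
   move=> /negP; rewrite negbK => /eqP Dz.
  by rewrite /sigma -/(D z) Dz invr0 scale0r.
have [V0|V0] := pselect (V 0).
  rewrite (_ : _ `&` _ = ~` U); first exact: measurableC.
  by apply/seteqP; split => [z [] //|z Uz]; split=> //=; rewrite /sigma_borel s0.
rewrite (_ : _ `&` _ = set0); first exact: measurable0.
by apply/seteqP; split => // z [/= + Uz]; rewrite /sigma_borel s0.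
Qed.

HB.instance Definition _ (w : H) :=
  isMeasurableFun.Build _ _ _ _ (sigma_borel w) (measurable_sigma_borel w).

(* A Borel probability measure on the sphere is represented by a Borel
   probability measure on H that is concentrated on the sphere. *)
Definition sphere : set H := [set x | `|x| = 1].

Definition pushforward_sigma (w : H) (mu : probability (borel H) R) :
  probability (borel H) R := distribution mu (sigma_borel w).

End Shift.

Section Algorithms.
Context {R : realType} {H : hilbertType R}.
Implicit Types (mu : probability (borel H) R) (w v X : H) (f : R -> R).

Definition stable mu :=
  forall x, sphere x -> (mu [set x] < (2^-1)%:E)%E.

(* The weak (Pettis) integral of the bounded continuous map
   [x |-> director w x]; it exists by the Riesz representation theorem. *)
Definition force mu w : H :=
  get [set z | forall y : H,
    inner z y = \int[mu]_(x in sphere) inner (director w x) y].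

Definition conformal_barycenter mu w := `|w| < 1 /\ force mu w = 0.

Definition potential mu w : R :=
  \int[mu]_(x in sphere) ln (`|x - w| ^+ 2 / (1 - `|w| ^+ 2)).

Definition regularized_nabla alpha mu w X : H :=
  nabla (force mu) w X - (alpha * pnorm w (force mu w) ^+ 2) *: X.

Definition newton_direction alpha mu w : H :=
  - pinv setT (regularized_nabla alpha mu w) (force mu w).

Definition merit mu w v : R -> R := fun t => potential mu (pexp w (t *: v)).

Definition wolfe c1 c2 f t :=
  f t <= f 0 + c1 * t * derive1 f 0 /\ c2 * derive1 f 0 <= derive1 f t.

Definition step_size c1 c2 f t :=
  [/\ 0 < t, wolfe c1 c2 f t & wolfe c1 c2 f 1 -> t = 1].

Definition newton_iterates alpha c1 c2 mu (w : nat -> H) := forall k,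
  let v := newton_direction alpha mu (w k) in
  exists2 t, step_size c1 c2 (merit mu (w k) v) t
           & w k.+1 = pexp (w k) (t *: v).

Definition shifted_newton_iterates alpha c1 c2 mu (w : nat -> H) := forall k,
  let muk := pushforward_sigma (w k) mu in
  let u := newton_direction alpha muk 0 in
  exists2 t, step_size c1 c2 (merit muk 0 u) t
           & w k.+1 = sigma (- w k) (pexp 0 (t *: u)).

End Algorithms.

(* Main.v *)
(* Write [m(w)] for the mean of the pushforward of [mu] under [sigma_w]. The
   force is [(1 - |w|^2)/2 * m(w)], so barycenters are the zeros of [m]. Along
   the geodesic of length [s] from [w] in the unit direction [e], the potential
   grows by the [mu]-average of [ln (cosh s - q sinh s)], [q = <sigma_w x, e>],
   whose second derivative lies between 0 and 1. Stability makes small caps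
   uniformly light, that is, of mass at most [1/2 - dl]; this renders the
   potential coercive and uniformly convex on balls of radius less than 1, and a
   minimizing sequence converges to the unique zero of [m].
   Since [exp_w] is [sigma_{-w}] composed with [exp_0] up to scaling, algorithms
   (A) and (B) perform the same step. The Armijo and Wolfe conditions decrease
   the potential by a multiple of [|m(w)|^2], hence [m(w_k)] tends to 0 and [w_k]
   converges. Near the limit the unit step is accepted, and because the Newton
   equation cancels the first-order term of [m], it makes [m] quadratically
   small. *)
Require Import Defs.
From mathcomp Require Import all_boot all_order all_algebra.
From mathcomp Require Import all_classical all_reals all_analysis.
From mathcomp Require Import measurable_realfun ring lra.

Import Order.TTheory GRing.Theory Num.Theory.
Import numFieldNormedType.Exports.

Local Open Scope classical_set_scope.
Local Open Scope ring_scope.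

(** The dimension is arbitrary, so spheres and closed balls need not be compact. Substitutes are
    found in three places: a mass bound uniform over all small caps, minimizing sequences that are
    Cauchy by convexity, and a Newton equation solved by minimizing a quadratic form. Every estimate
    on an averaged quantity starts as a scalar inequality in [q] and [s], obtained by integrating
    the Riccati equation [y' = 1 - y^2] of the derivative of [ln (cosh s - q sinh s)], and is then
    averaged. Derivatives of averages come from Taylor remainders that are uniform over the sphere.
    The distance is an infimum over curves and the exponential map a choice among geodesics. The
    former is reached through a two-sided comparison with the norm, so that the rate is proved for
    the norm first; the latter through uniqueness of geodesics. The threshold 1/2 for [c1] reflects
    that a unit Newton step lowers the quadratic model by at least half of what the initial slope
    predicts: a smaller [c1] leaves a margin that absorbs the cubic error. *)

Section InnerProduct.
Set Implicit Arguments.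
Unset Strict Implicit.
Context {R : realType} {H : hilbertType R}.
Implicit Types (a b : R) (x y z u v : H).

Lemma innerBl x y z : inner (x - y) z = inner x z - inner y z.
Proof. by rewrite innerDl innerNl. Qed.

Lemma innerBr x y z : inner x (y - z) = inner x y - inner x z.
Proof. by rewrite innerDr innerNr. Qed.

Lemma inner0l x : inner 0 x = 0.
Proof. by rewrite -(scale0r 0) innerZl mul0r. Qed.

Lemma inner0r x : inner x 0 = 0.
Proof. by rewrite innerC inner0l. Qed.

Definition innerE := (innerBl, innerBr, @innerDl R H, @innerDr R H,
  @innerNl R H, @innerNr R H, @innerZl R H, @innerZr R H, inner0l, inner0r).

Lemma inner_ext x y : (forall z, inner x z = inner y z) -> x = y.
Proof.
move=> xy; apply/eqP; rewrite -subr_eq0 -normr_eq0 -sqrf_eq0 -inner_norm.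
by rewrite innerBl xy subrr.
Qed.

Lemma cauchy_schwarz x y : `|inner x y| <= `|x| * `|y|.
Proof.
have [->|y0] := eqVneq y 0; first by rewrite inner0r !normr0 mulr0.
have ny : 0 < `|y| ^+ 2 by rewrite exprn_gt0 ?normr_gt0.
have : 0 <= `|x - (inner x y / `|y| ^+ 2) *: y| ^+ 2 by exact: sqr_ge0.
rewrite -inner_norm !innerE !inner_norm (innerC y x) => h.
rewrite -(ler_pXn2r (n := 2)) ?nnegrE ?mulr_ge0// real_normK ?num_real//.
rewrite exprMn -subr_ge0.
suff -> : `|x| ^+ 2 * `|y| ^+ 2 - inner x y ^+ 2 = (`|y| ^+ 2) *
  (`|x| ^+ 2 - inner x y / `|y| ^+ 2 * inner x y - inner x y / `|y| ^+ 2 *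
   (inner x y - inner x y / `|y| ^+ 2 * `|y| ^+ 2)).
  apply: mulr_ge0; [exact: ltW|].
  by move: h; congr (0 <= _); ring.
by field; rewrite normr_eq0.
Qed.

Lemma inner_le x y : inner x y <= `|x| * `|y|.
Proof. exact: le_trans (ler_norm _) (cauchy_schwarz _ _). Qed.

Lemma inner_ge x y : - (`|x| * `|y|) <= inner x y.
Proof. by have := cauchy_schwarz x y; rewrite ler_norml => /andP[]. Qed.

Lemma inner_unit x y : `|x| = 1 -> `|y| = 1 -> -1 <= inner x y <= 1.
Proof.
by move=> x1 y1; rewrite -ler_norml; have := cauchy_schwarz x y; rewrite x1 y1 mulr1.
Qed.

Lemma sqr_normD x y : `|x + y| ^+ 2 = `|x| ^+ 2 + 2 * inner x y + `|y| ^+ 2.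
Proof. by rewrite -!inner_norm !innerE (innerC y x); ring. Qed.

Lemma sqr_normB x y : `|x - y| ^+ 2 = `|x| ^+ 2 - 2 * inner x y + `|y| ^+ 2.
Proof. by rewrite -!inner_norm !innerE (innerC y x); ring. Qed.

(** Weak integrals are known through their inner products, so bounds on their norms pass through
    this dual form; testing with [y = x] suffices. *)
Lemma norm_le_inner x (K : R) : 0 <= K ->
  (forall y, inner x y <= K * `|y|) -> `|x| <= K.
Proof.
move=> K0 /(_ x); rewrite inner_norm expr2.
have [->|x0] := eqVneq x 0; first by rewrite normr0.
by rewrite ler_pM2r// normr_gt0.
Qed.

Lemma is_derive_innerl (c : R -> H) (c' z : H) (t : R) :
  is_derive t 1 c c' -> is_derive t 1 (fun s => inner (c s) z) (inner c' z).
Proof.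
move=> dc; have [dr cl] := dc.
have cv : (fun h => h^-1 *: (c (h *: 1 + t) - c t)) @ 0^' --> c'.
  by rewrite -cl; exact: dr.
have cv2 : (fun h => inner z (h^-1 *: (c (h *: 1 + t) - c t))) @ 0^' -->
    inner z c'.
  by apply: (cvg_comp _ _ cv); exact: inner_continuous.
rewrite innerC.
have E : (fun h : R => h^-1 *: ((fun s => inner (c s) z) (h *: (1 : R) + t) -
    inner (c t) z)) = (fun h => inner z (h^-1 *: (c (h *: 1 + t) - c t))).
  by apply/funext => h; rewrite innerZr innerBr !(innerC z).
apply: DeriveDef; last by apply: cvg_lim => //=; move: cv2; rewrite -E.
by apply/cvg_ex; exists (inner z c') => /=; move: cv2; rewrite -E.
Qed.

End InnerProduct.

(** * Minimizing sequences and symmetric coercive equations *)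

Section SymmetricLaxMilgram.
Set Implicit Arguments.
Unset Strict Implicit.
Context {R : realType} {H : hilbertType R}.

Lemma cauchy_limit (z : nat -> H) :
  (forall e : R, 0 < e -> exists N, forall n m, (N <= n)%N -> (N <= m)%N ->
     `|z n - z m| <= e) ->
  exists l : H, forall e : R, 0 < e -> exists N, forall n, (N <= n)%N ->
     `|l - z n| <= e.
Proof.
move=> hz.
have : cvg (z @ \oo).
  apply: cauchy_cvg; apply: cauchy_exP => e e0.
  have [N hN] := hz (e / 2) (divr_gt0 e0 (ltr0Sn R 1)).
  exists (z N); exists N => // n /= Nn.
  rewrite -ball_normE/=; apply: le_lt_trans (hN N n (leqnn _) Nn) _; lra.
move=> /cvg_ex[l zl]; exists l => e e0.
by move/cvgrPdist_le : zl => /(_ _ e0)[N _ h]; exists N => n Nn; exact: h.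
Qed.

Lemma eventually_invS_le (e : R) : 0 < e ->
  exists N, forall n, (N <= n)%N -> (n.+1%:R : R)^-1 <= e.
Proof.
move=> e0; exists (Num.bound e^-1) => n Nn.
rewrite -[leRHS]invrK lef_pV2 ?posrE ?ltr0n ?invr_gt0//.
have := archi_boundP (x := e^-1); rewrite invr_ge0 (ltW e0) => /(_ isT) h.
by apply/ltW/(lt_le_trans h); rewrite ler_nat ltnW.
Qed.

(** Applied to the quadratic functional below, to the potential on the ball, and, with [T] equal to
    [nat], to the potential along the iterates. *)
Lemma inf_sequence (T : Type) (P : set T) (f : T -> R) :
  P !=set0 -> (exists b, forall x, P x -> b <= f x) ->
  exists (j : R) (z : nat -> T), (forall x, P x -> j <= f x) /\
    forall n, P (z n) /\ f (z n) <= j + n.+1%:R^-1.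
Proof.
move=> [x0 Px0] [b hb].
have hi : has_inf (f @` P).
  by split; [exists (f x0); exists x0|exists b => _ [x Px <-]; exact: hb].
have H1 n : exists x, P x /\ f x <= inf (f @` P) + n.+1%:R^-1.
  have [] := @inf_adherent _ (f @` P) (n.+1%:R^-1) _ hi.
    by rewrite invr_gt0 ltr0n.
  by move=> _ [x Px <-] h; exists x; split => //; exact: ltW.
have [z hz] := choice H1.
exists (inf (f @` P)), z; split => // x Px.
by apply: ge_inf; [exact: hi.2|exists x].
Qed.

(* The solution is the minimizer of [x |-> a x x - 2 * l x]. *)
Lemma symmetric_lax_milgram (a : H -> H -> R) (l : H -> R) (c C D : R) :
  0 < c -> (forall x y, a x y = a y x) ->
  (forall x y z, a (x + y) z = a x z + a y z) ->
  (forall k x y, a (k *: x) y = k * a x y) ->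
  (forall x, c * `|x| ^+ 2 <= a x x) ->
  (forall x y, a x y <= C * (`|x| * `|y|)) ->
  (forall x y, l (x + y) = l x + l y) -> (forall k x, l (k *: x) = k * l x) ->
  (forall x, l x <= D * `|x|) ->
  exists z, forall y, a z y = l y.
Proof.
move=> c0 aC aDl aZl ac aK lD lZ lK.
have aDr x y z : a x (y + z) = a x y + a x z by rewrite aC aDl !(aC x).
have aZr k x y : a x (k *: y) = k * a x y by rewrite aC aZl aC.
pose J x := a x x - 2 * l x.
have [j [z [hj hz]]] : exists (j : R) (z : nat -> H),
    (forall x, setT x -> j <= J x) /\
    forall n, setT (z n) /\ J (z n) <= j + n.+1%:R^-1.
  apply: inf_sequence; first by exists 0.
  exists (- (D ^+ 2 / c)) => x _; rewrite /J.
  have h1 := ac x; have h2 := lK x.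
  suff : 0 <= c * `|x| ^+ 2 - 2 * (D * `|x|) + D ^+ 2 / c by lra.
  rewrite [X in 0 <= X](_ : _ = c * (`|x| - D / c) ^+ 2).
    by apply: mulr_ge0; [exact: ltW|exact: sqr_ge0].
  by field; rewrite gt_eqF.
(* The parallelogram identity for [a], with [J] at the midpoint bounded below by [j]: minimizing
   sequences are Cauchy. *)
have par x y : c * `|x - y| ^+ 2 <= 2 * (J x - j) + 2 * (J y - j).
  have := hj (2^-1 *: (x + y)) I; have := ac (x - y).
  rewrite /J lZ lD aZl aZr !aDl !aDr -scaleN1r !aZl !aZr (aC y x).
  by move: (c * _) => U; lra.
have cau : forall e : R, 0 < e -> exists N, forall n m, (N <= n)%N ->
    (N <= m)%N -> `|z n - z m| <= e.
  move=> e e0.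
  have ce : 0 < c * e ^+ 2 by rewrite mulr_gt0 ?exprn_gt0.
  have [N inv] := eventually_invS_le (divr_gt0 ce (ltr0Sn R 3)).
  exists N => n m Nn Nm.
  have := par (z n) (z m); have := (hz n).2; have := (hz m).2.
  move: (inv _ Nn) (inv _ Nm) => h1 h2 h3 h4 h5.
  rewrite -(ler_pXn2r (n := 2)) ?nnegrE ?(ltW e0)//.
  rewrite -(ler_pM2l c0); move: h1 h2 h3 h4 h5.
  by move: (n.+1%:R^-1) (m.+1%:R^-1) (c * _) (c * _) => a1 a2 a3 a4; lra.
have [x hx] := cauchy_limit cau.
exists x => y; apply/eqP; rewrite -subr_eq0; apply/eqP.
(* A nonzero [y] forces [c <= C]; for [y = 0] both sides of the equation vanish. *)
have C0 : 0 <= C \/ y = 0.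
  have [->|y0] := eqVneq y 0; [by right|left].
  have : 0 < `|y| ^+ 2 by rewrite exprn_gt0 // normr_gt0.
  have := ac y; have := aK y y; rewrite -expr2 => h1 h2 y2.
  have : c * `|y| ^+ 2 <= C * `|y| ^+ 2 by exact: le_trans h2 h1.
  by rewrite ler_pM2r//; lra.
case: C0 => [C0|->]; last first.
  have := aZr 0 x 0; have := lZ 0 0; rewrite scale0r !mul0r => -> ->.
  by rewrite subrr.
pose g := a x y - l y.
(* The variation is taken at [z n], whose value exceeds [j] by at most [1 / (n + 1)]; only
   [a (z n) y] has to pass to the limit. *)
have key t : 0 <= 2 * t * g + t ^+ 2 * a y y.
  apply/ler_addgt0Pr => e e0; rewrite -[leRHS]addrC.
  pose K := 2 * `|t| * C * `|y| + 1.
  have K0 : 0 < K by rewrite ltr_wpDl// !mulr_ge0.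
  have [N1 h1] := hx (e / 2 / K) (divr_gt0 (divr_gt0 e0 (ltr0Sn R 1)) K0).
  have [N2 h2] := eventually_invS_le (divr_gt0 e0 (ltr0Sn R 1)).
  pose n := maxn N1 N2.
  have := (hz n).2; have := hj (z n + t *: y) I.
  rewrite /J lD lZ !aDl !aDr !aZl !aZr (aC y) => h3 h4.
  have h5 := h2 n (leq_maxr _ _).
  have h6 : - (2 * t * (a x y - a (z n) y)) <= e / 2.
    have -> : a x y - a (z n) y = a (x - z n) y.
      by rewrite aDl -[- z n]scaleN1r aZl mulN1r.
    have -> : - (2 * t * a (x - z n) y) = a (x - z n) (- (2 * t) *: y).
      by rewrite aZr; ring.
    apply: le_trans (aK _ _) _.
    have h7 := h1 n (leq_maxl _ _).
    rewrite normrZ normrN normrM [`|2|]ger0_norm//.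
    have h8 : `|x - z n| * K <= e / 2 by rewrite -ler_pdivlMr.
    apply: le_trans h8; rewrite /K mulrDr mulr1 -[leLHS]addr0 lerD//.
    by rewrite [leLHS](_ : _ = `|x - z n| * (2 * `|t| * C * `|y|))//; ring.
  move: h3 h4 h5 h6; rewrite /g; move: (n.+1%:R^-1) => N'; lra.
have ay0 : 0 <= a y y.
  by apply: le_trans (ac y); rewrite mulr_ge0 ?sqr_ge0// ltW.
(* Nearly the minimizer [- g / a y y] of the quadratic in [t]; the added 1 guards against a zero
   denominator. *)
have k1 := key (- g / (a y y + 1)).
have A1 : 0 < a y y + 1 by lra.
have : g ^+ 2 <= 0.
  have h : 2 * (- g / (a y y + 1)) * g + (- g / (a y y + 1)) ^+ 2 * a y y =
     - (g ^+ 2) * ((a y y + 2) / (a y y + 1) ^+ 2).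
    by field; rewrite gt_eqF.
  move: k1; rewrite h pmulr_lge0 ?oppr_ge0//.
  by rewrite divr_gt0 ?exprn_gt0//; lra.
by rewrite real_exprn_even_le0 ?num_real// => /eqP.
Qed.

Lemma riesz_representation (l : H -> R) (D : R) :
  (forall x y, l (x + y) = l x + l y) -> (forall k x, l (k *: x) = k * l x) ->
  (forall x, l x <= D * `|x|) ->
  exists z, forall y, inner z y = l y.
Proof.
move=> lD lZ lK.
apply: (@symmetric_lax_milgram inner l 1 1 D) => //.
- exact: innerC.
- exact: innerDl.
- exact: innerZl.
- by move=> x; rewrite mul1r inner_norm.
- by move=> x y; rewrite mul1r; exact: inner_le.
Qed.

End SymmetricLaxMilgram.

(** * Derivatives of curves *)

Section DerivationRules.
Set Implicit Arguments.
Unset Strict Implicit.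
Context {R : realType}.
Implicit Types (f g : R -> R) (t a b k : R).

Lemma drv_eq (V : normedModType R) (f : R -> V) t (a b : V) :
  is_derive t 1 f a -> a = b -> is_derive t 1 f b.
Proof. by move=> h <-. Qed.

Lemma drvK (V : normedModType R) t (k : V) : is_derive t 1 (fun=> k) 0.
Proof. exact: is_derive_cst. Qed.

Lemma drvI t : is_derive t 1 (fun s : R => s) 1.
Proof. exact: is_derive_id. Qed.

Lemma drvD (V : normedModType R) (f g : R -> V) t (a b : V) :
  is_derive t 1 f a -> is_derive t 1 g b ->
  is_derive t 1 (fun s => f s + g s) (a + b).
Proof. by move=> *; exact: is_deriveD. Qed.

Lemma drvN f t a : is_derive t 1 f a -> is_derive t 1 (fun s => - f s) (- a).
Proof. by move=> *; exact: is_deriveN. Qed.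

Lemma drvM f g t a b : is_derive t 1 f a -> is_derive t 1 g b ->
  is_derive t 1 (fun s => f s * g s) (f t * b + g t * a).
Proof. by move=> *; exact: is_deriveM. Qed.

Lemma drvV f t a : f t != 0 -> is_derive t 1 f a ->
  is_derive t 1 (fun s => (f s)^-1) (- (f t) ^- 2 * a).
Proof. by move=> *; exact: is_deriveV. Qed.

Lemma drvX f t a n : is_derive t 1 f a ->
  is_derive t 1 (fun s => f s ^+ n) (n%:R * f t ^+ n.-1 * a).
Proof.
move=> h; have := is_deriveX n h.
rewrite (_ : f ^+ n = fun s => f s ^+ n)//.
by apply/funext => s; elim: n {h} => [|n IH]; rewrite ?expr0// !exprS -IH.
Qed.

Lemma drv_exp f t a : is_derive t 1 f a ->
  is_derive t 1 (fun s => expR (f s)) (expR (f t) * a).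
Proof. by move=> h; have := is_derive1_comp (is_derive_expR (f t)) h. Qed.

Lemma drv_ln f t a : 0 < f t -> is_derive t 1 f a ->
  is_derive t 1 (fun s => ln (f s)) ((f t)^-1 * a).
Proof. by move=> f0 h; have := is_derive1_comp (is_derive1_ln f0) h. Qed.

Lemma drv_scale (V : normedModType R) f (v : V) t a :
  is_derive t 1 f a -> is_derive t 1 (fun s => f s *: v) (a *: v).
Proof.
move=> [df <-].
have cv : (fun h : R => h^-1 *: (f (h *: 1 + t) *: v - f t *: v)) @ 0^' -->
    'D_1 f t *: v.
  rewrite (_ : (fun h => _) = fun h => (h^-1 *: (f (h *: 1 + t) - f t)) *: v).
    by apply: cvgZ; [exact: df|exact: cvg_cst].
  by apply/funext => h; rewrite -scalerA scalerBl.
apply: DeriveDef; last exact: cvg_lim.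
by apply/cvg_ex; eexists; exact: cv.
Qed.

Lemma drv_continuous (V : normedModType R) (f : R -> V) t (a : V) :
  is_derive t 1 f a -> {for t, continuous f}.
Proof. by move=> [/derivable1_diffP/differentiable_continuous]. Qed.

Lemma drv_mono f (f' : R -> R) b : 0 <= b ->
  (forall s : R, is_derive s 1 f (f' s)) ->
  (forall s, 0 <= s -> s <= b -> 0 <= f' s) -> f 0 <= f b.
Proof.
move=> b0 df f'0.
have [|c] := @MVT_segment R f f' 0 b b0 (fun x _ => df x).
  by apply: continuous_subspaceT => x; exact: drv_continuous.
rewrite in_itv/= subr0 => /andP[c0 cb] h.
by rewrite -subr_ge0 h mulr_ge0// f'0.
Qed.

Lemma drv_ge0 f (f' : R -> R) b : 0 <= b -> f 0 = 0 ->
  (forall s : R, is_derive s 1 f (f' s)) ->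
  (forall s, 0 <= s -> s <= b -> 0 <= f' s) -> 0 <= f b.
Proof. by move=> b0 f0 df f'0; rewrite -f0; exact: drv_mono df f'0. Qed.

Lemma drv_cst f : (forall s : R, is_derive s 1 f 0) -> forall s, f s = f 0.
Proof. by move=> df s; exact: is_derive_0_is_cst. Qed.

(** Takes the place of differentiation under the integral: a quadratic remainder that is uniform
    over the sphere survives averaging, and then yields the derivative of the average. *)
Lemma taylor_derive (V W : normedModType R) (f : V -> W) (w X : V) (L : W) (K r : R) :
  0 < r -> (forall d, `|d| <= r -> `|f (d *: X + w) - f w - d *: L| <= K * d ^+ 2) ->
  is_derive w X f L.
Proof.
move=> r0 hf; have K0 : 0 <= K.
  have := hf r; rewrite gtr0_norm// => /(_ (lexx _)) h.
  by have := le_trans (normr_ge0 _) h; rewrite pmulr_lge0// exprn_gt0.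
have cv : (fun h : R => h^-1 *: (f (h *: X + w) - f w)) @ 0^' --> L.
  apply/cvgrPdist_le => e e0; near=> h.
  have h0 : h != 0 by near: h; exact: nbhs_dnbhs_neq.
  have hr : `|h| <= r.
    near: h; apply: nbhs_dnbhs; exists r => //.
    by move=> k; rewrite /= sub0r normrN => /ltW.
  have he : `|h| * (K + 1) <= e.
    rewrite -ler_pdivlMr; last by lra.
    near: h; apply: nbhs_dnbhs; exists (e / (K + 1)) => /=.
      by rewrite divr_gt0//; lra.
    by move=> h; rewrite /= sub0r normrN => /ltW.
  rewrite -normrN opprB.
  have -> : h^-1 *: (f (h *: X + w) - f w) - L =
      h^-1 *: (f (h *: X + w) - f w - h *: L).
    by rewrite [RHS]scalerBr scalerA mulVf// scale1r.
  rewrite normrZ normfV ler_pdivrMl ?normr_gt0//.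
  apply: le_trans (hf h hr) _; rewrite -(real_normK (num_real h)) expr2.
  rewrite [leLHS](_ : _ = `|h| * (`|h| * K)); last by ring.
  rewrite ler_wpM2l//; apply: le_trans he; rewrite ler_wpM2l//; lra.
apply: DeriveDef; last exact: cvg_lim.
by apply/cvg_ex; eexists; exact: cv.
Unshelve. all: by end_near. Qed.

End DerivationRules.

(** Derivatives of opaque functions are put into the context beforehand, for [eassumption]. The
    rules for inverse and logarithm carry side conditions and are applied by hand. *)
Ltac drv_step := first
  [ eassumption | eapply drvI | eapply drvK | eapply drvD | eapply drvN
  | eapply drvX | eapply drvM | eapply drv_exp | eapply drv_scale ].
Ltac drv := eapply drv_eq; [repeat drv_step|cbn [Nat.pred]].

(** * Scalar estimates for a Busemann function along a geodesic *)

Section BusemannOnGeodesics.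
Set Implicit Arguments.
Unset Strict Implicit.
Context {R : realType}.
Implicit Types (q s d r b : R).

(* [cosh s - q * sinh s] *)
Definition hyp q s : R := ((1 - q) * expR s + (1 + q) * expR (- s)) / 2.

(** The Busemann function of an ideal point along a unit-speed geodesic, normalized to vanish at the
    start; [q] is the cosine of the angle at which the geodesic sees the point. *)
Definition phi q s : R := ln (hyp q s).

Definition dphi q s : R :=
  ((1 - q) * expR s - (1 + q) * expR (- s)) / 2 / hyp q s.

Lemma hyp_gt0 q s : -1 <= q <= 1 -> 0 < hyp q s.
Proof.
move=> /andP[h1 h2]; rewrite /hyp divr_gt0//.
have := expR_gt0 s; have := expR_gt0 (- s) => e1 e2.
have [q0|q0] := leP 0 q.
  by rewrite ltr_wpDl ?mulr_ge0 ?mulr_gt0 ?subr_ge0 ?(ltW e2)//; lra.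
by rewrite ltr_pwDl ?mulr_ge0 ?mulr_gt0 ?(ltW e1)//; lra.
Qed.

Lemma hyp_ge (q s : R) : -1 <= q <= 1 -> expR (- `|s|) <= hyp q s.
Proof.
move=> /andP[q1 q2]; rewrite /hyp.
have h1 : expR (- `|s|) <= expR s.
  by rewrite ler_expR; have := ler_norm (- s); rewrite normrN; lra.
have h2 : expR (- `|s|) <= expR (- s).
  by rewrite ler_expR; have := ler_norm s; lra.
have h3 : (1 - q) * expR (- `|s|) <= (1 - q) * expR s.
  by apply: ler_wpM2l => //; lra.
have h4 : (1 + q) * expR (- `|s|) <= (1 + q) * expR (- s).
  by apply: ler_wpM2l => //; lra.
lra.
Qed.

Lemma sqr_le1 q : (q ^+ 2 <= 1) = (-1 <= q <= 1).
Proof.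
rewrite -ler_norml -[X in _ <= X](expr1n _ 2) -(real_normK (num_real q)).
by rewrite ler_pXn2r ?nnegrE.
Qed.

Lemma hyp0 q : hyp q 0 = 1.
Proof. by rewrite /hyp oppr0 expR0; field. Qed.

Lemma phi0 q : phi q 0 = 0.
Proof. by rewrite /phi hyp0 ln1. Qed.

Lemma dphi0 q : dphi q 0 = - q.
Proof. by rewrite /dphi hyp0 oppr0 expR0; field. Qed.

Lemma hypN q s : hyp q (- s) = hyp (- q) s.
Proof. by rewrite /hyp !opprK; ring. Qed.

Lemma phiN q s : phi q (- s) = phi (- q) s.
Proof. by rewrite /phi hypN. Qed.

Lemma dphiN q s : dphi q (- s) = - dphi (- q) s.
Proof. by rewrite /dphi hypN !opprK -[RHS]mulNr; congr (_ * _); field. Qed.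

(** Rests on [(cosh s - q sinh s)^2 - (sinh s - q cosh s)^2 = 1 - q^2]. *)
Lemma dphi_sqr q s : -1 <= q <= 1 -> 1 - dphi q s ^+ 2 = (1 - q ^+ 2) / hyp q s ^+ 2.
Proof.
move=> /(hyp_gt0 s)/lt0r_neq0; rewrite /dphi => h.
have : hyp q s ^+ 2 - (((1 - q) * expR s - (1 + q) * expR (- s)) / 2) ^+ 2 =
    1 - q ^+ 2.
  by rewrite /hyp expRN; field; rewrite gt_eqF ?expR_gt0.
by move=> <-; field.
Qed.

Lemma dphi_bound q s : -1 <= q <= 1 -> 0 <= 1 - dphi q s ^+ 2 <= 1.
Proof.
move=> q1; rewrite gerBl sqr_ge0 andbT dphi_sqr//.
by rewrite divr_ge0 ?sqr_ge0// subr_ge0 sqr_le1.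
Qed.

Lemma dphi_le1 q s : -1 <= q <= 1 -> -1 <= dphi q s <= 1.
Proof. by move=> /(dphi_bound s)/andP[+ _]; rewrite subr_ge0 sqr_le1. Qed.

Lemma drv_phi q s : -1 <= q <= 1 -> is_derive s 1 (phi q) (dphi q s).
Proof.
move=> q1; eapply drv_eq.
  eapply (@drv_ln _ (hyp q)); first exact: hyp_gt0.
  by rewrite /hyp; repeat drv_step.
by rewrite /dphi; ring.
Qed.

(** The Riccati equation from which all further bounds are integrated. *)
Lemma drv_dphi q s : -1 <= q <= 1 ->
  is_derive s 1 (dphi q) (1 - dphi q s ^+ 2).
Proof.
move=> q1; have h := hyp_gt0 s q1; eapply drv_eq.
  eapply drvM; first by repeat drv_step.
  eapply (@drvV _ (hyp q)); first by rewrite gt_eqF.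
  by rewrite /hyp; repeat drv_step.
rewrite dphi_sqr// /dphi.
rewrite /hyp expRN; field; rewrite (gt_eqF (expR_gt0 s)) /=.
rewrite (_ : _ + _ = 2 * expR s * hyp q s).
  exact: lt0r_neq0 (mulr_gt0 (mulr_gt0 (ltr0Sn R 1) (expR_gt0 s)) h).
by rewrite /hyp expRN; field; rewrite gt_eqF ?expR_gt0.
Qed.

Section Bounds.
Variable q : R.
Hypothesis q1 : -1 <= q <= 1.

Lemma dphi_ge s : 0 <= s -> - q <= dphi q s.
Proof.
move=> s0; rewrite -dphi0; apply: (drv_mono s0 (fun s => drv_dphi s q1)).
by move=> r _ _; have /andP[] := dphi_bound r q1.
Qed.

Lemma dphi_le s : 0 <= s -> dphi q s <= - q + s.
Proof.
move=> s0; rewrite -subr_ge0.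
apply: (@drv_ge0 _ (fun s => - q + s - dphi q s) (fun r => dphi q r ^+ 2) s s0).
- by rewrite dphi0; ring.
- by move=> r; have := drv_dphi r q1 => ?; drv; ring.
- by move=> r _ _; exact: sqr_ge0.
Qed.

Lemma phi_le s : 0 <= s -> phi q s <= - q * s + s ^+ 2 / 2.
Proof.
move=> s0; rewrite -subr_ge0.
apply: (@drv_ge0 _ (fun s => - q * s + s ^+ 2 / 2 - phi q s)
  (fun r => - q + r - dphi q r) s s0).
- by rewrite phi0; field.
- by move=> r; have := drv_phi r q1 => ?; drv; field.
- by move=> r r0 _; have := dphi_le r0; lra.
Qed.

(** The second derivative is [(1 - q^2) / hyp^2], and [hyp q r <= expR s] for [r] in [[0, s]];
    integrating twice produces the factor [expR (- (2 * s))]. *)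
Lemma phi_ge s : 0 <= s ->
  - q * s + expR (- (2 * s)) * (1 - q ^+ 2) * s ^+ 2 / 2 <= phi q s.
Proof.
move=> s0; pose k := expR (- (2 * s)) * (1 - q ^+ 2).
have hk r : 0 <= r -> r <= s -> k <= 1 - dphi q r ^+ 2.
  move=> r0 rs; rewrite dphi_sqr// /k mulrC ler_wpM2l ?subr_ge0 ?sqr_le1//.
  have hr := hyp_gt0 r q1.
  have : hyp q r <= expR s.
    have /andP[h1 h2] := q1.
    have e1 : expR r <= expR s by rewrite ler_expR.
    have e2 : expR (- r) <= expR s by rewrite ler_expR; lra.
    have h3 : (1 - q) * expR r <= (1 - q) * expR s by apply: ler_wpM2l => //; lra.
    have h4 : (1 + q) * expR (- r) <= (1 + q) * expR s.
      by apply: ler_wpM2l => //; lra.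
    rewrite /hyp; lra.
  move=> h.
  rewrite expRN lef_pV2 ?posrE ?expR_gt0 ?exprn_gt0//.
  rewrite (_ : 2 * s = s + s); last by ring.
  rewrite expRD -expr2 lerXn2r ?nnegrE ?(ltW hr)//; exact/ltW/expR_gt0.
have hd r : 0 <= r -> r <= s -> 0 <= dphi q r - (- q + k * r).
  move=> r0 rs.
  apply: (@drv_ge0 _ (fun r => dphi q r - (- q + k * r))
    (fun r => 1 - dphi q r ^+ 2 - k) r r0).
  - by rewrite dphi0; ring.
  - by move=> u; have := drv_dphi u q1 => ?; drv; ring.
  - by move=> u u0 ur; rewrite subr_ge0; apply: hk => //; exact: le_trans rs.
rewrite -subr_ge0 -/k.
apply: (@drv_ge0 _ (fun s => phi q s - (- q * s + k * s ^+ 2 / 2))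
  (fun r => dphi q r - (- q + k * r)) s s0).
- by rewrite phi0; ring.
- by move=> r; have := drv_phi r q1 => ?; drv; field.
- exact: hd.
Qed.

Lemma dphi_sqr_near s : 0 <= s -> `|dphi q s ^+ 2 - q ^+ 2| <= 2 * s.
Proof.
move=> s0; rewrite (_ : _ - _ = (dphi q s - q) * (dphi q s + q)); last by ring.
have := dphi_ge s0; have := dphi_le s0; have /andP[] := dphi_le1 s q1.
have /andP[] := q1 => h1 h2 h3 h4 h5 h6.
rewrite normrM ler_pM// ler_norml; apply/andP; split; lra.
Qed.

(** By [dphi_sqr_near] the derivative [1 - dphi^2] stays within [2 * s] of its initial value
    [1 - q^2]; integration turns this error into [s^2]. *)
Lemma dphi_taylor s : 0 <= s ->
  - q + (1 - q ^+ 2) * s - s ^+ 2 <= dphi q s <= - q + (1 - q ^+ 2) * s + s ^+ 2.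
Proof.
move=> s0; have near r : 0 <= r ->
    - (2 * r) <= dphi q r ^+ 2 - q ^+ 2 /\ dphi q r ^+ 2 - q ^+ 2 <= 2 * r.
  by move=> /dphi_sqr_near; rewrite ler_norml => /andP[].
apply/andP; split; rewrite -subr_ge0.
- apply: (@drv_ge0 _ (fun s => dphi q s - (- q + (1 - q ^+ 2) * s - s ^+ 2))
    (fun r => 1 - dphi q r ^+ 2 - (1 - q ^+ 2) + 2 * r) s s0).
  + by rewrite dphi0; ring.
  + by move=> u; have := drv_dphi u q1 => ?; drv; ring.
  + by move=> r /near[]; lra.
- apply: (@drv_ge0 _ (fun s => - q + (1 - q ^+ 2) * s + s ^+ 2 - dphi q s)
    (fun r => (1 - q ^+ 2) + 2 * r - (1 - dphi q r ^+ 2)) s s0).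
  + by rewrite dphi0; ring.
  + by move=> u; have := drv_dphi u q1 => ?; drv; ring.
  + by move=> r /near[]; lra.
Qed.

Lemma phi_taylor_le s : 0 <= s ->
  phi q s <= - q * s + (1 - q ^+ 2) * s ^+ 2 / 2 + s ^+ 3 / 3.
Proof.
move=> s0; rewrite -subr_ge0.
apply: (@drv_ge0 _ (fun s => - q * s + (1 - q ^+ 2) * s ^+ 2 / 2 + s ^+ 3 / 3
   - phi q s) (fun r => - q + (1 - q ^+ 2) * r + r ^+ 2 - dphi q r) s s0).
- by rewrite phi0; field.
- by move=> r; have := drv_phi r q1 => ?; drv; field.
- by move=> r r0 _; rewrite subr_ge0; have /andP[] := dphi_taylor r0.
Qed.

End Bounds.

Lemma dphi_lipschitz q s d : -1 <= q <= 1 -> 0 <= d ->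
  0 <= dphi q (s + d) - dphi q s <= d.
Proof.
move=> q1 d0; have dd u : is_derive (u : R) 1 (fun d => dphi q (s + d))
    (1 - dphi q (s + u) ^+ 2).
  have h : is_derive (u : R) 1 (fun d => s + d) (1 : R) by drv; ring.
  by have := is_derive1_comp (drv_dphi (s + u) q1) h => /drv_eq; apply; ring.
apply/andP; split.
- apply: (@drv_ge0 _ (fun d => dphi q (s + d) - dphi q s)
    (fun u => 1 - dphi q (s + u) ^+ 2) d d0).
  + by rewrite addr0 subrr.
  + by move=> u; have := dd u => ?; drv; ring.
  + by move=> u _ _; have /andP[] := dphi_bound (s + u) q1.
- rewrite -subr_ge0.
  apply: (@drv_ge0 _ (fun d => d - (dphi q (s + d) - dphi q s))
    (fun u => dphi q (s + u) ^+ 2) d d0).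
  + by rewrite addr0 !subrr.
  + by move=> u; have := dd u => ?; drv; ring.
  + by move=> u _ _; exact: sqr_ge0.
Qed.

Lemma phi_quadratic q s d : -1 <= q <= 1 ->
  `|phi q (s + d) - phi q s - d * dphi q s| <= d ^+ 2 / 2.
Proof.
(* Reflection, [phi q (- s) = phi (- q) s], reduces to increments [d >= 0]. *)
suff pos q' s' d' : -1 <= q' <= 1 -> 0 <= d' ->
    `|phi q' (s' + d') - phi q' s' - d' * dphi q' s'| <= d' ^+ 2 / 2.
  move=> q1; have [d0|/ltW d0] := leP 0 d; first exact: pos.
  have := pos (- q) (- s) (- d); rewrite -opprD !phiN dphiN !opprK mulrNN sqrrN.
  by apply; [have /andP[? ?] := q1; apply/andP; split; lra|rewrite oppr_ge0].
move=> {q s d} /= q1 d0; rename q' into q; rename s' into s; rename d' into d.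
have dd u : is_derive (u : R) 1 (fun d => phi q (s + d)) (dphi q (s + u)).
  have h : is_derive (u : R) 1 (fun d => s + d) (1 : R) by drv; ring.
  by have := is_derive1_comp (drv_phi (s + u) q1) h => /drv_eq; apply; ring.
rewrite ler_norml; apply/andP; split; rewrite -subr_ge0.
- apply: (@drv_ge0 _ (fun d => phi q (s + d) - phi q s - d * dphi q s -
    - (d ^+ 2 / 2)) (fun u => dphi q (s + u) - dphi q s + u) d d0).
  + by rewrite addr0; ring.
  + by move=> u; have := dd u => ?; drv; field.
  + by move=> u u0 _; have /andP[] := dphi_lipschitz s q1 u0; lra.
- apply: (@drv_ge0 _ (fun d => d ^+ 2 / 2 - (phi q (s + d) - phi q s -
    d * dphi q s)) (fun u => u - (dphi q (s + u) - dphi q s)) d d0).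
  + by rewrite addr0; ring.
  + by move=> u; have := dd u => ?; drv; field.
  + by move=> u u0 _; have /andP[] := dphi_lipschitz s q1 u0; lra.
Qed.

End BusemannOnGeodesics.

(** * Algebra of the shift transformations *)

Section ShiftIdentities.
Set Implicit Arguments.
Unset Strict Implicit.
Context {R : realType} {H : hilbertType R}.
Implicit Types (w x y z e : H) (s : R).

Definition sden w z : R := 1 - 2 * inner w z + `|w| ^+ 2 * `|z| ^+ 2.

(** The exponential of the Busemann function of an ideal point [x], equal to 1 at the origin; on the
    sphere its inverse is the conformal factor of [sigma w]. *)
Definition bus w x : R := `|x - w| ^+ 2 / (1 - `|w| ^+ 2).

Lemma sqr_norm_lt1 w : `|w| < 1 -> 0 < 1 - `|w| ^+ 2.
Proof. by move=> w1; rewrite subr_gt0 expr_lt1. Qed.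

Lemma sqr_norm_lt1P w : (`|w| < 1) = (0 < 1 - `|w| ^+ 2).
Proof. by rewrite subr_gt0 expr_lt1. Qed.

Lemma sden_ge w z : (1 - `|w| * `|z|) ^+ 2 <= sden w z.
Proof. by rewrite /sden; have := inner_le w z; lra. Qed.

Lemma sden_le w z : sden w z <= (1 + `|w| * `|z|) ^+ 2.
Proof. by rewrite /sden; have := inner_ge w z; lra. Qed.

Lemma normM_lt1 w z : `|w| < 1 -> `|z| <= 1 -> `|w| * `|z| < 1.
Proof.
move=> w1 z1; apply: le_lt_trans w1.
by rewrite -[leRHS]mulr1 ler_wpM2l.
Qed.

Lemma sden_gt0 w z : `|w| < 1 -> `|z| <= 1 -> 0 < sden w z.
Proof.
move=> w1 z1; apply: lt_le_trans (sden_ge w z).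
by rewrite exprn_gt0// subr_gt0 normM_lt1.
Qed.

Lemma sden_sphere w x : `|x| = 1 -> sden w x = `|x - w| ^+ 2.
Proof. by move=> x1; rewrite sqr_normB /sden x1 (innerC w); ring. Qed.

Lemma sqr_sigma w z : sden w z != 0 ->
  `|sigma w z| ^+ 2 = `|z - w| ^+ 2 / sden w z.
Proof.
move=> D0; rewrite -inner_norm /sigma -/(sden w z) !innerE sqr_normB.
rewrite (innerC z w) !inner_norm; move: D0; rewrite /sden.
by move: (`|w| ^+ 2) (`|z| ^+ 2) => n k D0; field.
Qed.

Lemma subr1_sqr_sigma w z : sden w z != 0 ->
  1 - `|sigma w z| ^+ 2 = (1 - `|w| ^+ 2) * (1 - `|z| ^+ 2) / sden w z.
Proof.
move=> D0; rewrite sqr_sigma// sqr_normB (innerC z); move: D0.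
by rewrite /sden; move: (`|w| ^+ 2) (`|z| ^+ 2) => n k D0; field.
Qed.

Lemma inner_sigma w z y : inner (sigma w z) y = (sden w z)^-1 *
  ((1 - `|w| ^+ 2) * inner z y - (1 + `|z| ^+ 2 - 2 * inner w z) * inner w y).
Proof. by rewrite /sigma !innerE. Qed.

Lemma sigma_sphere w x : `|w| < 1 -> `|x| = 1 -> `|sigma w x| = 1.
Proof.
move=> w1 x1; have x1' : `|x| <= 1 by rewrite x1.
have := subr1_sqr_sigma (lt0r_neq0 (sden_gt0 w1 x1')).
rewrite x1 expr1n subrr mulr0 mul0r => /eqP; rewrite subr_eq0 eq_sym.
by rewrite sqrp_eq1// => /eqP.
Qed.

Lemma sigma_ball w z : `|w| < 1 -> `|z| < 1 -> `|sigma w z| < 1.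
Proof.
move=> w1 z1; have D0 := sden_gt0 w1 (ltW z1).
by rewrite sqr_norm_lt1P subr1_sqr_sigma ?gt_eqF// divr_gt0// mulr_gt0 ?sqr_norm_lt1.
Qed.

Lemma sden_sigma w z : sden w z != 0 ->
  sden (- w) (sigma w z) = (1 - `|w| ^+ 2) ^+ 2 / sden w z.
Proof.
move=> D0; rewrite {1}/sden normrN sqr_sigma// innerNl innerC inner_sigma.
rewrite !inner_norm sqr_normB !(innerC z); move: D0; rewrite /sden.
by move: (`|w| ^+ 2) (`|z| ^+ 2) => n k D0; field.
Qed.

Lemma sigmaK w z : `|w| < 1 -> `|z| <= 1 -> sigma (- w) (sigma w z) = z.
Proof.
move=> w1 z1; have D0 := lt0r_neq0 (sden_gt0 w1 z1).
have n0 := lt0r_neq0 (sqr_norm_lt1 w1).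
(* Tested against every [y], the vector identity becomes a rational identity between inner
   products. *)
apply: inner_ext => y; rewrite inner_sigma sden_sigma// normrN sqr_sigma//.
rewrite !innerNl (innerC w (sigma w z)) !inner_sigma !inner_norm sqr_normB.
rewrite !(innerC z w); move: D0 n0; rewrite /sden.
by move: (`|w| ^+ 2) (`|z| ^+ 2) => n k D0 n0; field; rewrite n0 D0.
Qed.

Lemma sigmaVK w z : `|w| < 1 -> `|z| <= 1 -> sigma w (sigma (- w) z) = z.
Proof. by move=> w1 z1; rewrite -[X in sigma X _]opprK sigmaK ?normrN. Qed.

Lemma bus_gt0 w x : `|w| < 1 -> `|x| = 1 -> 0 < bus w x.
Proof.
move=> w1 x1; rewrite /bus -sden_sphere// divr_gt0 ?sqr_norm_lt1//.
by rewrite sden_gt0// x1.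
Qed.

(** The cocycle property of Busemann functions: after a shift by [w], the ideal point [x] is seen at
    [sigma w x]. Its logarithm splits the potential at a moved point. *)
Lemma bus_move w z x : `|w| < 1 -> `|z| < 1 -> `|x| = 1 ->
  bus (sigma (- w) z) x = bus w x * bus z (sigma w x).
Proof.
move=> w1 z1 x1.
have D0 : sden (- w) z != 0 by rewrite gt_eqF// sden_gt0 ?normrN// ltW.
have D1 : sden w x != 0 by rewrite gt_eqF// sden_gt0// x1.
have n0 := lt0r_neq0 (sqr_norm_lt1 w1).
have n1 := lt0r_neq0 (sqr_norm_lt1 z1).
rewrite /bus subr1_sqr_sigma// !sqr_normB.
rewrite sqr_sigma// [X in _ = _ * (X / _)]addrAC.
rewrite sqr_sigma// !sqr_normB normrN (innerC x (sigma _ _)) !inner_sigma.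
rewrite x1 !innerNl !innerNr normrN (innerC z w) (innerC x w) (innerC z x).
move: D0 D1 n0 n1; rewrite /sden innerNl normrN x1 expr1n mulr1.
by move: (`|w| ^+ 2) (`|z| ^+ 2) => n k D0 D1 n0 n1; field; rewrite n0 n1 D0 D1.
Qed.

(** For unit vectors [1 - inner x y] is half the squared chord, and a conformal map of the sphere
    multiplies squared chords by the product of its factors at the two endpoints. *)
Lemma inner_sigma_sphere w x y : `|w| < 1 -> `|x| = 1 -> `|y| = 1 ->
  1 - inner (sigma w x) (sigma w y) = (1 - inner x y) / (bus w x * bus w y).
Proof.
move=> w1 x1 y1.
have D0 : sden w x != 0 by rewrite gt_eqF// sden_gt0// x1.
have D1 : sden w y != 0 by rewrite gt_eqF// sden_gt0// y1.
have n0 := lt0r_neq0 (sqr_norm_lt1 w1).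
rewrite /bus -!sden_sphere// inner_sigma (innerC x (sigma _ _)).
rewrite (innerC w (sigma _ _)) !inner_sigma !inner_norm x1 y1.
rewrite (innerC y x) (innerC y w).
move: D0 D1 n0; rewrite /sden x1 y1 expr1n mulr1.
by move: (`|w| ^+ 2) => n D0 D1 n0; field; rewrite n0 D0 D1.
Qed.

(* [sigma (sigma (- w) z)] and [sigma z \o sigma w] differ by a linear isometry,
   which disappears in inner products. *)
Lemma inner_sigma_comp w z x y :
  `|w| < 1 -> `|z| < 1 -> `|x| = 1 -> `|y| = 1 ->
  inner (sigma (sigma (- w) z) x) (sigma (sigma (- w) z) y) =
  inner (sigma z (sigma w x)) (sigma z (sigma w y)).
Proof.
move=> w1 z1 x1 y1; have w'1 : `|sigma (- w) z| < 1.
  by rewrite sigma_ball ?normrN.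
apply/eqP; rewrite -(inj_eq (addrI (-1))) -eqr_opp !opprD !opprK; apply/eqP.
rewrite inner_sigma_sphere// inner_sigma_sphere ?sigma_sphere//.
rewrite inner_sigma_sphere// !bus_move//.
have b1 := lt0r_neq0 (bus_gt0 w1 x1); have b2 := lt0r_neq0 (bus_gt0 w1 y1).
have b3 := lt0r_neq0 (bus_gt0 z1 (sigma_sphere w1 x1)).
have b4 := lt0r_neq0 (bus_gt0 z1 (sigma_sphere w1 y1)).
by field; rewrite b1 b2 b3 b4.
Qed.

Lemma sqr_norm_sigmaB w x y : `|w| < 1 -> `|x| = 1 -> `|y| = 1 ->
  `|sigma w x - sigma w y| ^+ 2 = `|x - y| ^+ 2 / (bus w x * bus w y).
Proof.
move=> w1 x1 y1; have := inner_sigma_sphere w1 x1 y1.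
rewrite !sqr_normB !sigma_sphere// x1 y1 => h.
rewrite [LHS](_ : _ = 2 * (1 - inner (sigma w x) (sigma w y))); last by ring.
by rewrite h; ring.
Qed.

(* [tanh (s / 2)] *)
Definition th s : R := (expR s - 1) / (expR s + 1).

Lemma expR1_gt0 s : 0 < expR s + 1 :> R.
Proof. by rewrite addr_gt0 ?expR_gt0. Qed.

Lemma subr1_sqr_th s : 1 - th s ^+ 2 = 4 * expR s / (expR s + 1) ^+ 2.
Proof. by rewrite /th; field; rewrite gt_eqF// expR1_gt0. Qed.

Lemma th_norm s : `|th s| < 1.
Proof.
rewrite -(@expr_lt1 _ 2)// real_normK ?num_real// -subr_gt0 subr1_sqr_th.
by rewrite divr_gt0 ?mulr_gt0 ?exprn_gt0 ?expR_gt0 ?expR1_gt0.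
Qed.

(** The hyperbolic tangent is [dphi] at [q = 0], so [th] inherits its bounds. *)
Lemma th_dphi s : th s = dphi 0 (s / 2).
Proof.
rewrite /th /dphi /hyp expRN {1 2}(_ : s = s / 2 + s / 2); last by field.
rewrite expRD; have e0 := expR_gt0 (s / 2).
have e1 : expR (s / 2) ^+ 2 + 1 != 0.
  by rewrite gt_eqF// addr_gt0 ?exprn_gt0.
by field; rewrite -expr2 e1 gt_eqF.
Qed.

Lemma th_ge0 s : 0 <= s -> 0 <= th s.
Proof.
move=> s0; rewrite divr_ge0 ?(ltW (expR1_gt0 s))// subr_ge0.
by rewrite -[leLHS]expR0 ler_expR.
Qed.

Lemma th_le s : 0 <= s -> th s <= s / 2.
Proof.
move=> s0; rewrite th_dphi -[leRHS]add0r -[X in _ <= X + _]oppr0.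
by apply: dphi_le; rewrite ?divr_ge0//; apply/andP; split; lra.
Qed.

Lemma th_taylor s : 0 <= s -> `|th s - s / 2| <= (s / 2) ^+ 2.
Proof.
move=> s0; rewrite th_dphi.
have q0 : -1 <= (0 : R) <= 1 by apply/andP; split; lra.
have := dphi_taylor q0 (divr_ge0 s0 (ler0n R 2)) => /andP[h1 h2].
by rewrite ler_norml; apply/andP; split; move: h1 h2; lra.
Qed.

(** The right side is [2 sinh s]; the bound trades a hyperbolic length for Euclidean data. *)
Lemma th_expand s : 0 <= s -> s <= 4 * th s / (1 - th s ^+ 2).
Proof.
move=> s0; have e0 := expR_gt0 s.
have e1 : 1 <= expR s by rewrite -[leLHS]expR0 ler_expR.
apply: (@le_trans _ _ (expR s - 1)).
  by rewrite -subr_ge0; have := expR_ge1Dx s; lra.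
rewrite subr1_sqr_th /th.
rewrite [leRHS](_ : _ = (expR s - 1) * (1 + (expR s)^-1)).
  by rewrite ler_peMr ?subr_ge0// lerDl invr_ge0 ltW.
by field; rewrite !gt_eqF ?expR1_gt0.
Qed.

Lemma norm_th s e : `|e| = 1 -> `|th s *: e| < 1.
Proof. by move=> e1; rewrite normrZ e1 mulr1 th_norm. Qed.

Lemma bus_th s e y : `|e| = 1 -> `|y| = 1 ->
  bus (th s *: e) y = hyp (inner y e) s.
Proof.
move=> e1 y1; rewrite /bus sqr_normB y1 innerZr normrZ e1 mulr1.
rewrite real_normK ?num_real// subr1_sqr_th /th /hyp expRN.
by field; rewrite !gt_eqF ?expR1_gt0 ?expR_gt0.
Qed.

(* The endpoint of the geodesic of length [s] that starts at [w] in the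
   direction [e]. *)
Definition gmove w e s : H := sigma (- w) (th s *: e).

Lemma gmove_ball w e s : `|w| < 1 -> `|e| = 1 -> `|gmove w e s| < 1.
Proof. by move=> w1 e1; rewrite sigma_ball ?normrN// norm_th. Qed.

Lemma bus_gmove w e s x : `|w| < 1 -> `|e| = 1 -> `|x| = 1 ->
  bus (gmove w e s) x = bus w x * hyp (inner (sigma w x) e) s.
Proof.
by move=> w1 e1 x1; rewrite bus_move ?norm_th// bus_th ?sigma_sphere.
Qed.

(** With [w'] the endpoint, [|w' - w|^2 = (th s)^2 * sden w w'] and [sden w w' <= 4]. The first
    bound then uses [th s <= s / 2], the second [th_expand]. *)
Lemma gmove_dist w e s : `|w| < 1 -> `|e| = 1 -> 0 <= s ->
  `|gmove w e s - w| <= s /\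
  s <= 8 * `|gmove w e s - w| /
    ((1 - `|w| ^+ 2) * (1 - `|gmove w e s| ^+ 2)).
Proof.
move=> w1 e1 s0; have z1 := norm_th s e1; set w' := gmove w e s.
have w'1 : `|w'| < 1 by exact: gmove_ball.
have zE : sigma w w' = th s *: e by rewrite /w' /gmove sigmaVK ?ltW.
have D0 : 0 < sden w w' by rewrite sden_gt0// ltW.
have D4 : sden w w' <= 4.
  apply: le_trans (sden_le _ _) _; rewrite [leRHS](_ : 4 = 2 ^+ 2); last by ring.
  rewrite lerXn2r ?nnegrE ?addr_ge0 ?mulr_ge0//.
  by have := normM_lt1 w1 (ltW w'1); lra.
have := sqr_sigma (lt0r_neq0 D0); have := subr1_sqr_sigma (lt0r_neq0 D0).
rewrite zE normrZ e1 mulr1 real_normK ?num_real// => h1 h2.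
have t0 := th_ge0 s0; have hd : `|w' - w| ^+ 2 = th s ^+ 2 * sden w w'.
  by rewrite h2 divfK// gt_eqF.
have r0 := Num.Theory.sqrtr_ge0 (sden w w').
have dE : `|w' - w| = th s * Num.sqrt (sden w w').
  apply/eqP; rewrite -(@eqrXn2 _ 2) ?(mulr_ge0 t0 r0)//.
  by rewrite hd (exprMn _ (th s)) sqr_sqrtr// ltW.
have r2 : Num.sqrt (sden w w') <= 2.
  rewrite -(@ler_pXn2r _ 2) ?nnegrE// sqr_sqrtr ?(ltW D0)// expr2; lra.
split.
  rewrite dE; apply: (@le_trans _ _ (s / 2 * 2)); last by rewrite divfK.
  by apply: ler_pM => //; exact: th_le.
apply: le_trans (th_expand s0) _; rewrite h1.
have n0 := sqr_norm_lt1 w1; have n1 := sqr_norm_lt1 w'1.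
rewrite invf_div mulrA ler_pM2r ?invr_gt0 ?mulr_gt0// dE.
have -> : 4 * th s * sden w w' = 4 * th s * Num.sqrt (sden w w') *
    Num.sqrt (sden w w') by rewrite -[in LHS](sqr_sqrtr (ltW D0)); ring.
rewrite [leRHS](_ : _ = 4 * th s * Num.sqrt (sden w w') * 2); last by ring.
apply: ler_wpM2l => //; exact: mulr_ge0 (mulr_ge0 (ler0n R 4) t0) r0.
Qed.

(** Polar coordinates of [sigma w w'], with [ln ((1 + r) / (1 - r))] inverting [th]; [e0] serves as
    direction when [w' = w]. *)
Lemma gmove_exists w w' e0 : `|w| < 1 -> `|w'| < 1 -> `|e0| = 1 ->
  exists e s, [/\ `|e| = 1, 0 <= s & w' = gmove w e s].
Proof.
move=> w1 w'1 e01; pose z := sigma w w'.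
have z1 : `|z| < 1 by exact: sigma_ball.
have [s s0 sE] : exists2 s, 0 <= s & th s = `|z|.
  have h : 0 < (1 + `|z|) / (1 - `|z|) by rewrite divr_gt0 ?subr_gt0 ?ltr_pwDl.
  exists (ln ((1 + `|z|) / (1 - `|z|))).
    rewrite ln_ge0// ler_pdivlMr ?subr_gt0// mul1r lerD2l.
    by rewrite -subr_ge0 opprK addr_ge0.
  rewrite /th lnK ?posrE//.
  move: z1; move: `|z| => r r1; field.
  by rewrite subr_eq0 gt_eqF//=; lra.
have [z0|z0] := eqVneq z 0.
  exists e0, 0; split => //; rewrite /gmove /th expR0 subrr mul0r scale0r -z0.
  by rewrite /z sigmaK// ltW.
exists (`|z|^-1 *: z), s; split => //.
  by rewrite normrZ normfV normr_id mulVf// normr_eq0.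
rewrite /gmove sE scalerA mulfV ?normr_eq0// scale1r /z sigmaK//.
exact: ltW.
Qed.

End ShiftIdentities.

(** * The Poincare distance compared with the norm *)

Section DistanceBounds.
Set Implicit Arguments.
Unset Strict Implicit.
Context {R : realType} {H : hilbertType R}.
Implicit Types (u v w X : H) (c : R -> H).

Lemma pnormE w X : `|w| < 1 -> pnorm w X = 2 / (1 - `|w| ^+ 2) * `|X|.
Proof.
move=> w1; have n0 := sqr_norm_lt1 w1.
rewrite /pnorm /pmetric inner_norm.
rewrite [X in Num.sqrt X](_ : _ = (2 / (1 - `|w| ^+ 2) * `|X|) ^+ 2).
  by rewrite sqrtr_sqr ger0_norm// mulr_ge0// divr_ge0// ltW.
by field; rewrite gt_eqF.
Qed.

Lemma pnorm_continuous c t : {for t, continuous c} ->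
  {for t, continuous (derive1 c)} -> `|c t| < 1 ->
  {for t, continuous (fun s => pnorm (c s) (derive1 c s))}.
Proof.
move=> cc cd c1; have n0 := sqr_norm_lt1 c1.
have cn : (fun s => 1 - `|c s| ^+ 2) @ t --> 1 - `|c t| ^+ 2.
  apply: cvgB; first exact: cvg_cst.
  by rewrite expr2; under eq_fun do rewrite expr2; apply: cvgM; exact: cvg_norm.
apply: (continuous_comp (f := fun s => pmetric (c s) (derive1 c s) (derive1 c s))
  (g := Num.sqrt)); last exact: sqrt_continuous.
rewrite /continuous_at /pmetric; apply: cvgM.
  apply: cvgM; first exact: cvg_cst.
  apply: cvgV; first by rewrite expf_neq0// gt_eqF.
  by rewrite expr2; under eq_fun do rewrite expr2; apply: cvgM.
rewrite inner_norm expr2; under eq_fun do rewrite inner_norm expr2.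
by apply: cvgM; apply: cvg_norm.
Qed.

Lemma curve_continuous c t : derivable c t 1 -> {for t, continuous c}.
Proof. by move=> /derivable1_diffP/differentiable_continuous. Qed.

Lemma pnorm_curve_integrable u v c : curve_between u v c ->
  lebesgue_measure.-integrable `[(0 : R), 1]
    (EFin \o (fun t => pnorm (c t) (derive1 c t))).
Proof.
move=> [dc cc c0 c1 cb]; apply: continuous_compact_integrable.
  exact: segment_compact.
apply/continuous_in_subspaceT => t; rewrite mem_setE => /itvP t01.
apply: pnorm_continuous; [exact: curve_continuous|exact: cc|].
by apply: cb; rewrite !t01.
Qed.

(** The conformal factor is at least 2, and projecting the velocity onto the direction [e] of the
    chord leaves an integral for the fundamental theorem of calculus. *)
Lemma plength_ge u v c : curve_between u v c -> 2 * `|u - v| <= plength c.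
Proof.
move=> cuv; have ip := pnorm_curve_integrable cuv.
have [dc cc c0 c1 cb] := cuv.
have [uv|uv] := eqVneq u v.
  by rewrite uv subrr normr0 mulr0 /plength; apply: Rintegral_ge0 => t _;
     exact: sqrtr_ge0.
pose e := `|u - v|^-1 *: (v - u).
have nuv : 0 < `|u - v| by rewrite normr_gt0 subr_eq0.
have e1 : `|e| = 1.
  by rewrite normrZ normfV normr_id distrC mulVf// distrC gt_eqF.
have dg (t : R) : is_derive t 1 (fun s => inner (c s) e) (inner (derive1 c t) e).
  apply: is_derive_innerl; rewrite derive1E; exact/derivableP.
pose f t := 2 * inner (derive1 c t) e.
have cf : continuous f.
  move=> t; apply: cvgM; first exact: cvg_cst.
  rewrite innerC; under eq_fun do rewrite innerC.
  apply: (continuous_comp (f := derive1 c) (g := inner e)); first exact: cc.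
  exact: inner_continuous.
have dF (t : R) : is_derive t 1 (fun s => 2 * inner (c s) e) (f t).
  by have := dg t => ?; drv; rewrite /f; ring.
have fi : lebesgue_measure.-integrable `[(0 : R), 1] (EFin \o f).
  apply: continuous_compact_integrable; first exact: segment_compact.
  exact: continuous_subspaceT.
have := @continuous_FTC2 R f (fun s => 2 * inner (c s) e) 0 1 ltr01.
move=> /(_ (continuous_subspaceT cf)) ftc.
have {}ftc : \int[lebesgue_measure]_(t in `[0, 1]) f t = 2 * `|u - v|.
  rewrite /Rintegral ftc/=.
  - rewrite c0 c1 -mulrBr -innerBl /e innerZr inner_norm expr2.
    by rewrite (distrC v u) mulKf ?gt_eqF.
  - split.
    + by move=> t _; have [] := dF t.
    + by apply: cvg_at_right_filter; exact: (drv_continuous (dF 0)).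
    + by apply: cvg_at_left_filter; exact: (drv_continuous (dF 1)).
  - by move=> t _; rewrite derive1E; have [_] := dF t.
rewrite -ftc; apply: le_Rintegral => //= t.
rewrite in_itv/= => t01; rewrite pnormE ?cb// /f.
apply: (@le_trans _ _ (2 * `|derive1 c t|)).
  by rewrite ler_pM2l//; apply: le_trans (inner_le _ _) _; rewrite e1 mulr1.
rewrite ler_wpM2r// ler_peMr// invf_ge1 ?sqr_norm_lt1 ?cb//.
Qed.

(** Convexity keeps the chord in the ball of radius [rho], where the conformal factor is at most
    [2 / (1 - rho ^+ 2)]. *)
Lemma segment_curve u v (rho : R) : `|u| <= rho -> `|v| <= rho -> rho < 1 ->
  exists2 c, curve_between u v c &
    plength c <= 2 / (1 - rho ^+ 2) * `|u - v|.
Proof.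
move=> ur vr r1; pose c (t : R) := u + t *: (v - u).
have dc (t : R) : is_derive t 1 c (v - u).
  by rewrite /c; drv; rewrite add0r scale1r.
have d1 : derive1 c = cst (v - u).
  by apply/funext => t; rewrite derive1E; have [_] := dc t.
have cr t : 0 <= t <= 1 -> `|c t| <= rho.
  move=> /andP[t0 t1].
  have -> : c t = (1 - t) *: u + t *: v.
    by rewrite /c scalerBr scalerBl scale1r addrA addrAC.
  apply: le_trans (ler_normD _ _) _; rewrite !normrZ !ger0_norm ?subr_ge0//.
  have h1 : (1 - t) * `|u| <= (1 - t) * rho by rewrite ler_wpM2l ?subr_ge0.
  have h2 : t * `|v| <= t * rho by rewrite ler_wpM2l.
  by move: h1 h2; lra.
have r0 : 0 <= rho by exact: le_trans (normr_ge0 u) ur.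
have cuv : curve_between u v c.
  split.
  - by move=> t; have [] := dc t.
  - by rewrite d1; exact: cst_continuous.
  - by rewrite /c scale0r addr0.
  - by rewrite /c scale1r addrC subrK.
  - by move=> t /cr h; exact: le_lt_trans r1.
exists c => //.
have -> : 2 / (1 - rho ^+ 2) * `|u - v| =
    \int[lebesgue_measure]_(t in `[(0 : R), 1]) (2 / (1 - rho ^+ 2) * `|u - v|).
  rewrite Rintegral_cst//= lebesgue_measure_itv/= lte_fin ltr01.
  by rewrite oppr0 adde0 mulr1.
apply: le_Rintegral => //.
- exact: pnorm_curve_integrable cuv.
- apply: continuous_compact_integrable; first exact: segment_compact.
  by apply: continuous_subspaceT => t; exact: cvg_cst.
move=> t /=; rewrite in_itv/= => t01; have ct := cr t t01.
rewrite pnormE ?(le_lt_trans ct)// d1 /cst distrC.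
rewrite ler_wpM2r// ler_wpM2l// lef_pV2 ?posrE ?sqr_norm_lt1 ?(le_lt_trans ct)//.
  by rewrite lerD2l lerN2 lerXn2r ?nnegrE.
by rewrite subr_gt0 expr_lt1.
Qed.

Lemma has_lbound_plength u v :
  has_lbound [set plength c | c in curve_between u v].
Proof.
exists 0 => _ [c _ <-]; apply: Rintegral_ge0 => t _; exact: sqrtr_ge0.
Qed.

(** With [pdist_ge] this makes distance and norm comparable on every ball of radius below 1, so
    rates can be proved in the norm. *)
Lemma pdist_le u v (rho : R) : `|u| <= rho -> `|v| <= rho -> rho < 1 ->
  pdist u v <= 2 / (1 - rho ^+ 2) * `|u - v|.
Proof.
move=> ur vr r1; have [c cuv] := segment_curve ur vr r1.
apply: le_trans; apply: ge_inf; first exact: has_lbound_plength.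
by exists c.
Qed.

Lemma pdist_ge u v : `|u| < 1 -> `|v| < 1 -> 2 * `|u - v| <= pdist u v.
Proof.
move=> u1 v1; apply: lb_le_inf => [|_ [c cuv <-]]; last exact: plength_ge.
(* The infimum of an empty set would be a default value; the segment shows that admissible curves
   exist. *)
have := @segment_curve u v (Num.max `|u| `|v|).
rewrite !le_max !lexx orbT gt_max u1 v1 => /(_ isT isT isT)[c cuv _].
by exists (plength c), c.
Qed.

End DistanceBounds.

(** * Geodesics and the exponential map *)

Section Geodesics.
Set Implicit Arguments.
Unset Strict Implicit.
Context {R : realType} {H : hilbertType R}.
Implicit Types (w X e y : H) (c : R -> H) (r t : R).

Lemma cvg_inner (T : Type) (F : set_system T) (FF : Filter F) (f g : T -> H)
    (a b : H) : f @ F --> a -> g @ F --> b ->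
  (fun x => inner (f x) (g x)) @ F --> inner a b.
Proof.
move=> fa gb; rewrite inner_polar; under eq_fun do rewrite inner_polar.
have sq (h : T -> H) (k : H) : h @ F --> k ->
    (fun x => `|h x| ^+ 2) @ F --> `|k| ^+ 2.
  move=> hk; rewrite expr2; under eq_fun do rewrite expr2.
  by apply: cvgM; exact: cvg_norm.
apply: cvgM; first exact: cvg_cst.
by apply: cvgB; [apply: cvgB|]; apply: sq => //; exact: cvgD.
Qed.

Lemma drv_inner (f g : R -> H) (a b : H) t :
  is_derive (t : R) 1 f a -> is_derive t 1 g b ->
  is_derive (t : R) 1 (fun s => inner (f s) (g s)) (inner a (g t) + inner (f t) b).
Proof.
move=> df dg; have cg := drv_continuous dg.
have qf : (fun h : R => h^-1 *: (f (h *: 1 + t) - f t)) @ 0^' --> a.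
  by case: df => dr <-; exact: dr.
have qg : (fun h : R => h^-1 *: (g (h *: 1 + t) - g t)) @ 0^' --> b.
  by case: dg => dr <-; exact: dr.
have gt : (fun h : R => g (h *: 1 + t)) @ 0^' --> g t.
  apply: cvg_trans cg; apply: cvg_comp; last exact: cvg_id.
  move=> A; rewrite !nbhs_nearE.
  have : (fun h : R => h *: (1 : R) + t) @ (0 : R) --> (0 : R) *: (1 : R) + t.
    by apply: cvgD; [apply: cvgZ; [exact: cvg_id|exact: cvg_cst]|exact: cvg_cst].
  by rewrite scale0r add0r => h /h; exact: nbhs_dnbhs.
have cv : (fun h : R => h^-1 *: (inner (f (h *: 1 + t)) (g (h *: 1 + t)) -
    inner (f t) (g t))) @ 0^' --> inner a (g t) + inner (f t) b.
  rewrite (_ : (fun h : R => _) = fun h =>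
    inner (h^-1 *: (f (h *: 1 + t) - f t)) (g (h *: 1 + t)) +
    inner (f t) (h^-1 *: (g (h *: 1 + t) - g t))).
    by apply: cvgD; apply: cvg_inner => //; exact: cvg_cst.
  by apply/funext => h; rewrite !innerE /GRing.scale/=; ring.
apply: DeriveDef; last exact: cvg_lim.
by apply/cvg_ex; eexists; exact: cv.
Qed.

Lemma drv_sqnorm (f : R -> H) (a : H) t : is_derive (t : R) 1 f a ->
  is_derive (t : R) 1 (fun s => `|f s| ^+ 2) (2 * inner (f t) a).
Proof.
move=> df; under eq_fun do rewrite -inner_norm.
by apply: (drv_eq (drv_inner df df)); rewrite (innerC a); ring.
Qed.

(** The operator factors: [y1 - r * y] solves [p' = - r p] and vanishes, after which [y' = r y].
    Each first-order equation is solved by an exponential factor. *)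
Lemma linear_ode_zero r (y y1 : R -> R) :
  (forall t, is_derive (t : R) 1 y (y1 t)) ->
  (forall t, is_derive (t : R) 1 y1 (r ^+ 2 * y t)) ->
  y 0 = 0 -> y1 0 = 0 -> forall t, y t = 0.
Proof.
move=> dy dy1 y0 y10.
have first_order (k : R) (p : R -> R) : (forall t, is_derive (t : R) 1 p (k * p t)) ->
    p 0 = 0 -> forall t, p t = 0.
  move=> dp p0 t; pose q s := p s * expR (- (k * s)).
  have dq s : is_derive (s : R) 1 q 0.
    by have := dp s => ?; rewrite /q; drv; ring.
  have := drv_cst dq t; rewrite /q p0 mul0r => /eqP.
  by rewrite mulf_eq0 (gt_eqF (expR_gt0 _)) orbF => /eqP.
have p0 : forall t, y1 t - r * y t = 0.
  apply: (@first_order (- r) (fun t => y1 t - r * y t)); last by rewrite y0 y10; ring.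
  by move=> t; have := dy t => ?; have := dy1 t => ?; drv; ring.
apply: (first_order r y _ y0) => t.
by apply: (drv_eq (dy t)); apply/eqP; rewrite -subr_eq0 p0.
Qed.

(** The conformal factor: [pnorm w X = confD w * |X|] in the ball. *)
Definition confD w : R := 2 / (1 - `|w| ^+ 2).

Section GeodesicEquations.
Variable c : R -> H.
Hypothesis gc : geodesic c.

Let c' := derive1 c.
Let D t := confD (c t).
Let speed2 t := D t ^+ 2 * `|c' t| ^+ 2.

Lemma geodesic_derive t : is_derive (t : R) 1 c (c' t).
Proof. by have [_ d _ _] := gc t; rewrite /c' derive1E; exact/derivableP. Qed.

Lemma geodesic_derive2 t : is_derive (t : R) 1 c'
  (- (D t *: (2 * inner (c t) (c' t) *: c' t - `|c' t| ^+ 2 *: c t))).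
Proof.
have [_ _ d e] := gc t; have := derivableP d; rewrite -derive1E.
move=> /drv_eq; apply; move/eqP: e; rewrite addr_eq0 => /eqP ->.
congr (- _); rewrite /christoffel -/c' inner_norm /D /confD.
by rewrite -scalerDl; congr (_ *: (_ *: _ - _)); ring.
Qed.

Lemma confD_derive t :
  is_derive (t : R) 1 D (D t ^+ 2 * inner (c t) (c' t)).
Proof.
have [c1 _ _ _] := gc t; have n0 := sqr_norm_lt1 c1.
rewrite /D /confD; eapply drv_eq.
  eapply drvM; first exact: drvK.
  eapply (@drvV _ (fun s => 1 - `|c s| ^+ 2)); first by rewrite gt_eqF.
  by eapply drvD; [exact: drvK|apply: drvN; exact: drv_sqnorm (geodesic_derive t)].
by field; rewrite gt_eqF.
Qed.

Lemma sqr_norm_confD t : `|c t| ^+ 2 = 1 - 2 / D t.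
Proof.
have [c1 _ _ _] := gc t; have n0 := sqr_norm_lt1 c1.
by rewrite /D /confD; field; rewrite gt_eqF.
Qed.

Lemma D_neq0 t : D t != 0.
Proof.
have [c1 _ _ _] := gc t; have n0 := sqr_norm_lt1 c1.
by rewrite gt_eqF// divr_gt0.
Qed.

(** Makes the coefficient in [confD_derive2] and [momentum_derive2] a constant, hence those
    equations linear. *)
Lemma speed_cst t : speed2 t = speed2 0.
Proof.
apply: drv_cst => {}t; have dD := confD_derive t.
have dk := drv_sqnorm (geodesic_derive2 t).
rewrite /speed2; drv.
by rewrite /= !innerE !inner_norm (innerC (c' t) (c t)) /=; ring.
Qed.

Lemma confD_derive2 t : is_derive (t : R) 1 (fun s => D s ^+ 2 * inner (c s) (c' s))
  (speed2 0 * (D t - 1)).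
Proof.
have dD := confD_derive t; rewrite -(speed_cst t) /speed2.
have di := drv_inner (geodesic_derive t) (geodesic_derive2 t).
drv; have := D_neq0 t; have := sqr_norm_confD t.
rewrite !innerE !inner_norm /= => -> D0.
by field.
Qed.

Lemma momentum_derive y t : is_derive (t : R) 1 (fun s => D s * inner (c s) y)
  (D t ^+ 2 * inner (c t) (c' t) * inner (c t) y + D t * inner (c' t) y).
Proof.
have dD := confD_derive t; have di := is_derive_innerl y (geodesic_derive t).
by drv; ring.
Qed.

Lemma momentum_derive2 y t : is_derive (t : R) 1
  (fun s => D s ^+ 2 * inner (c s) (c' s) * inner (c s) y + D s * inner (c' s) y)
  (speed2 0 * (D t * inner (c t) y)).
Proof.
have dD := confD_derive t; have dD2 := confD_derive2 t.
have di := is_derive_innerl y (geodesic_derive t).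
have di2 := is_derive_innerl y (geodesic_derive2 t).
drv; rewrite -(speed_cst t) /speed2 !innerE; ring.
Qed.

End GeodesicEquations.

(* In the coordinates [(D - 1, D c)] of the hyperboloid the geodesic equation
   is linear. *)
Lemma geodesic_unique c1 c2 : geodesic c1 -> geodesic c2 -> c1 0 = c2 0 ->
  derive1 c1 0 = derive1 c2 0 -> forall t, c1 t = c2 t.
Proof.
move=> g1 g2 e0 e1 t.
pose k := confD (c1 0) ^+ 2 * `|derive1 c1 0| ^+ 2.
have k0 : 0 <= k by rewrite mulr_ge0 ?sqr_ge0.
have kE : Num.sqrt k ^+ 2 = k by rewrite sqr_sqrtr.
have kE2 : k = confD (c2 0) ^+ 2 * `|derive1 c2 0| ^+ 2 by rewrite /k e0 e1.
have D12 s : confD (c1 s) = confD (c2 s).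
  apply/eqP; rewrite -subr_eq0; apply/eqP.
  apply: (@linear_ode_zero (Num.sqrt k)
    (fun s => confD (c1 s) - confD (c2 s))
    (fun s => confD (c1 s) ^+ 2 * inner (c1 s) (derive1 c1 s) -
              confD (c2 s) ^+ 2 * inner (c2 s) (derive1 c2 s))) => [u|u||].
  - have := confD_derive g1 u => ?; have := confD_derive g2 u => ?.
    by drv.
  - have := confD_derive2 g1 u => h1; have := confD_derive2 g2 u => h2.
    drv.
    by rewrite kE -/k -kE2; ring.
  - by rewrite e0 subrr.
  - by rewrite e0 e1 subrr.
have D0 := D_neq0 g1 t.
apply: inner_ext => y; apply: (mulfI D0); apply/eqP; rewrite -subr_eq0.
rewrite {2}D12; apply/eqP.
apply: (@linear_ode_zero (Num.sqrt k)
  (fun s => confD (c1 s) * inner (c1 s) y - confD (c2 s) * inner (c2 s) y)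
  (fun s => (confD (c1 s) ^+ 2 * inner (c1 s) (derive1 c1 s) * inner (c1 s) y +
     confD (c1 s) * inner (derive1 c1 s) y) -
    (confD (c2 s) ^+ 2 * inner (c2 s) (derive1 c2 s) * inner (c2 s) y +
     confD (c2 s) * inner (derive1 c2 s) y))) => [u|u||].
- have h1 := momentum_derive g1 y u; have h2 := momentum_derive g2 y u.
  by drv.
- have h1 := momentum_derive2 g1 y u; have h2 := momentum_derive2 g2 y u.
  drv.
  by rewrite kE -/k -kE2; ring.
- by rewrite e0 subrr.
- by rewrite e0 e1 subrr.
Qed.

Section ExplicitGeodesic.
Variables (w e : H) (r : R).
Hypotheses (w1 : `|w| < 1) (e1 : `|e| = 1).

Let n : R := `|w| ^+ 2.
Let D0 : R := 2 / (1 - n).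
Let q0 : R := inner w e.
Let ch t : R := (expR (r * t) + expR (- (r * t))) / 2.
Let sh t : R := (expR (r * t) - expR (- (r * t))) / 2.
(** On the hyperboloid the geodesic is [cosh (r t) P + sinh (r t) Q], with [P] the starting point
    and [Q] its unit tangent. [A] and [B] are the coefficients of [w] and [e] in the space part, and
    [d] is 1 plus the time part; the ball model divides the space part by [d]. *)
Let A t : R := ch t * D0 + sh t * (D0 * q0).
Let B t : R := sh t.
Let d t : R := 1 + ch t * (D0 - 1) + sh t * (D0 * q0).
Let A1 t : R := r * (sh t * D0 + ch t * (D0 * q0)).
Let B1 t : R := r * ch t.
Let d1 t : R := r * (sh t * (D0 - 1) + ch t * (D0 * q0)).
Let al1 t : R := (A1 t * d t - A t * d1 t) / d t ^+ 2.
Let be1 t : R := (B1 t * d t - B t * d1 t) / d t ^+ 2.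
(** Second derivatives of [A / d] and, below, [B / d], simplified by [A'' = r^2 A], [B'' = r^2 B]
    and [d'' = r^2 (d - 1)]. *)
Let al2 t : R := r ^+ 2 * A t / d t ^+ 2 - 2 * d1 t * al1 t / d t.
Let be2 t : R := r ^+ 2 * B t / d t ^+ 2 - 2 * d1 t * be1 t / d t.

Let n1 : 0 < 1 - n. Proof. exact: sqr_norm_lt1. Qed.

Let ch_sh t : ch t ^+ 2 - sh t ^+ 2 = 1.
Proof. by rewrite /ch /sh expRN; field; rewrite gt_eqF ?expR_gt0. Qed.

Let drv_ch t : is_derive (t : R) 1 ch (r * sh t).
Proof. by rewrite /ch; drv; rewrite /sh; ring. Qed.

Let drv_sh t : is_derive (t : R) 1 sh (r * ch t).
Proof. by rewrite /sh; drv; rewrite /ch; ring. Qed.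

Let drvA t : is_derive (t : R) 1 A (A1 t).
Proof.
have hc := drv_ch t; have hs := drv_sh t.
by rewrite /A; drv; rewrite /A1; ring.
Qed.

Let drvd t : is_derive (t : R) 1 d (d1 t).
Proof.
have hc := drv_ch t; have hs := drv_sh t.
by rewrite /d; drv; rewrite /d1; ring.
Qed.

Let drvA1 t : is_derive (t : R) 1 A1 (r ^+ 2 * A t).
Proof.
have hc := drv_ch t; have hs := drv_sh t.
by rewrite /A1; drv; rewrite /A; ring.
Qed.

Let drvB1 t : is_derive (t : R) 1 B1 (r ^+ 2 * B t).
Proof.
by have hc := drv_ch t; rewrite /B1; drv; rewrite /B; ring.
Qed.

Let drvd1 t : is_derive (t : R) 1 d1 (r ^+ 2 * (d t - 1)).
Proof.
have hc := drv_ch t; have hs := drv_sh t.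
by rewrite /d1; drv; rewrite /d; ring.
Qed.

Let dE t : d t = 2 * sden (- w) (th (r * t) *: e) /
  ((1 - n) * (1 - th (r * t) ^+ 2)).
Proof.
rewrite /sden normrN normrZ e1 mulr1 real_normK ?num_real// innerZr innerNl.
rewrite subr1_sqr_th /th /d /ch /sh /D0 expRN -/n -/q0.
have E1 := expR1_gt0 (r * t); have E0 := expR_gt0 (r * t).
by field; rewrite !gt_eqF.
Qed.

Let d_gt0 t : 0 < d t.
Proof.
rewrite dE; have z1 := norm_th (r * t) e1.
have := sqr_norm_lt1 z1; rewrite normrZ e1 mulr1 real_normK ?num_real// => h.
rewrite divr_gt0 ?(mulr_gt0 n1 h)//; apply: mulr_gt0 => //.
by rewrite sden_gt0 ?normrN// ltW.
Qed.

Let d_neq0 t : d t != 0. Proof. by rewrite gt_eqF. Qed.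

Let gmoveE t : gmove w e (r * t) = (A t / d t) *: w + (B t / d t) *: e.
Proof.
apply: inner_ext => y; rewrite /gmove inner_sigma !innerE.
have z1 := norm_th (r * t) e1.
have D1 : 0 < sden (- w) (th (r * t) *: e) by rewrite sden_gt0 ?normrN// ltW.
have h := d_gt0 t; rewrite normrN -/n -/q0.
move: D1; rewrite /sden normrN normrZ e1 mulr1 real_normK ?num_real// innerZr.
rewrite innerNl -/n -/q0 /th /A /B.
move: (lt0r_neq0 h); rewrite /d /ch /sh /D0 expRN.
have := lt0r_neq0 (expR1_gt0 (r * t)); have := lt0r_neq0 (expR_gt0 (r * t)).
move: (expR (r * t)) => a a0 a1 hd /lt0r_neq0 hD.
have n0 := lt0r_neq0 n1.
(* The two denominators must be nonzero in the form that [field] meets them, cleared of inner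
   fractions. *)
have hd' : (1 - n) * 2 * a + (a * a + 1) * (2 - (1 - n)) +
    (a * a - 1) * 2 * q0 != 0.
  move: hd; apply: contraNneq => hd.
  rewrite [X in X == 0](_ : _ = ((1 - n) * 2 * a + (a * a + 1) * (2 - (1 - n)) +
    (a * a - 1) * 2 * q0) / (2 * a * (1 - n))); first by rewrite hd mul0r.
  by field; rewrite a0 n0.
have hD' : (a + 1) ^+ 2 + 2 * (a ^+ 2 - 1) * q0 + n * (a - 1) ^+ 2 != 0.
  move: hD; apply: contraNneq => hD.
  rewrite [X in X == 0](_ : _ = ((a + 1) ^+ 2 + 2 * (a ^+ 2 - 1) * q0 +
    n * (a - 1) ^+ 2) / (a + 1) ^+ 2); first by rewrite hD mul0r.
  by field.
move: (inner w y) (inner e y) => X Y; field.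
rewrite a0 a1 n0 /=; apply/andP; split=> //.
by move: hd'; congr (_ != 0); ring.
Qed.

(** The hyperboloid equation: the squared space part is the squared time part minus 1. [W_dot] is
    its derivative, and [W1_sqr] says that the velocity has Lorentzian square [r ^+ 2]. *)
Let W_sqr t : A t ^+ 2 * n + 2 * A t * B t * q0 + B t ^+ 2 = (d t - 1) ^+ 2 - 1.
Proof.
have := ch_sh t; rewrite /A /B /d => h.
rewrite -[X in _ = _ - X]h /D0; field.
by rewrite gt_eqF.
Qed.

Let W_dot t : A t * A1 t * n + (A t * B1 t + B t * A1 t) * q0 + B t * B1 t =
  (d t - 1) * d1 t.
Proof. by rewrite /A /B /A1 /B1 /d /d1 /D0; field; rewrite gt_eqF. Qed.

Let W1_sqr t : A1 t ^+ 2 * n + 2 * A1 t * B1 t * q0 + B1 t ^+ 2 =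
  d1 t ^+ 2 + r ^+ 2.
Proof.
have := ch_sh t; rewrite /A1 /B1 /d1 => h.
rewrite -[X in _ = _ + X]mulr1 -[X in _ = _ + _ * X]h /D0; field.
by rewrite gt_eqF.
Qed.

Lemma gmove_derive t :
  is_derive (t : R) 1 (fun s => gmove w e (r * s)) (al1 t *: w + be1 t *: e).
Proof.
rewrite (funext gmoveE).
have h1 := drvA t; have h2 := drvd t; have h3 := drv_sh t; have d0 := d_neq0 t.
apply: drvD; apply: drv_scale; eapply drv_eq.
- by eapply drvM; [exact: h1|eapply (drvV d0); exact: h2].
- by rewrite /al1; field.
- by eapply drvM; [exact: h3|eapply (drvV d0); exact: h2].
- by rewrite /be1 /B1; field.
Qed.

Lemma gmove_derive2 t :
  is_derive (t : R) 1 (fun s => al1 s *: w + be1 s *: e) (al2 t *: w + be2 t *: e).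
Proof.
have h1 := drvA t; have h2 := drvd t; have h3 := drv_sh t; have d0 := d_neq0 t.
have h4 := drvA1 t; have h5 := drvB1 t; have h6 := drvd1 t.
have d20 : d t ^+ 2 != 0 by rewrite expf_neq0.
have h7 : is_derive t 1 (fun s => (d s ^+ 2)^-1) (- 2 * d1 t / d t ^+ 3).
  eapply drv_eq; first by eapply (@drvV _ (fun s => d s ^+ 2)); [exact: d20|eapply drvX; exact: h2].
  by rewrite /=; field.
apply: drvD; apply: drv_scale; rewrite /al1 /be1 /B; drv.
- by rewrite /al2 /al1; field.
- by rewrite /be2 /be1 /B1 /B; field.
Qed.

(** The hyperboloid identities express the inner products of position and velocity through [d] and
    [d1]; the geodesic equation is then rational in the coefficients of [w] and [e]. *)
Lemma gmove_geodesic : geodesic (fun t => gmove w e (r * t)).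
Proof.
pose c t := gmove w e (r * t).
have dc1 t : is_derive (t : R) 1 c (al1 t *: w + be1 t *: e) by exact: gmove_derive.
have c1E : derive1 c = fun t => al1 t *: w + be1 t *: e.
  by apply/funext => t; rewrite derive1E; have [_] := dc1 t.
have c2E t : derive1 (derive1 c) t = al2 t *: w + be2 t *: e.
  by rewrite c1E derive1E; have [_] := gmove_derive2 t.
move=> t; have d0 := d_neq0 t; split.
- exact: gmove_ball.
- by have [] := dc1 t.
- by rewrite c1E; have [] := gmove_derive2 t.
rewrite c2E c1E.
have cc : `|gmove w e (r * t)| ^+ 2 = 1 - 2 / d t.
  rewrite gmoveE -inner_norm !innerE !inner_norm e1 (innerC e w) -/n -/q0.
  rewrite [RHS](_ : _ = ((d t - 1) ^+ 2 - 1) / d t ^+ 2); last by field.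
  by rewrite -W_sqr; field.
have cc' : inner (gmove w e (r * t)) (al1 t *: w + be1 t *: e) = d1 t / d t ^+ 2.
  rewrite gmoveE !innerE !inner_norm e1 (innerC e w) -/n -/q0 /al1 /be1.
  rewrite [RHS](_ : _ = (d t * ((d t - 1) * d1 t) - d1 t * ((d t - 1) ^+ 2 - 1))
    / d t ^+ 3); last by field.
  by rewrite -W_sqr -W_dot; field.
have c'c' : inner (al1 t *: w + be1 t *: e) (al1 t *: w + be1 t *: e) =
    r ^+ 2 / d t ^+ 2.
  rewrite !innerE !inner_norm e1 (innerC e w) -/n -/q0 /al1 /be1.
  rewrite [RHS](_ : _ = (d t ^+ 2 * (d1 t ^+ 2 + r ^+ 2) -
     2 * d t * d1 t * ((d t - 1) * d1 t) + d1 t ^+ 2 * ((d t - 1) ^+ 2 - 1))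
    / d t ^+ 4); last by field.
  by rewrite -W_sqr -W_dot -W1_sqr; field.
rewrite /christoffel cc cc' c'c' gmoveE; apply: inner_ext => y; rewrite !innerE.
have -> : 2 / (1 - (1 - 2 / d t)) = d t by rewrite subKr; field.
move: (inner w y) (inner e y) => X Y; rewrite /al2 /be2 /al1 /be1.
by field.
Qed.

Lemma gmove_derive0 :
  derive1 (fun t => gmove w e (r * t)) 0 = ((1 - n) / 2 * r) *: e.
Proof.
rewrite derive1E; have [_ ->] := gmove_derive 0.
have E0 : expR (r * 0) = 1 :> R by rewrite mulr0 expR0.
have E1 : expR (- (r * 0)) = 1 :> R by rewrite mulr0 oppr0 expR0.
have n0 := lt0r_neq0 n1.
have D00 : D0 != 0 by rewrite gt_eqF// divr_gt0.
have ch0 : ch 0 = 1 by rewrite /ch E0 E1; field.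
have sh0 : sh 0 = 0 by rewrite /sh E0 E1; field.
have dE0 : d 0 = D0 by rewrite /d ch0 sh0; ring.
have -> : al1 0 = 0.
  by rewrite /al1 dE0 /A1 /A /d1 ch0 sh0; field.
have -> : be1 0 = (1 - n) / 2 * r.
  by rewrite /be1 dE0 /B1 /B /d1 ch0 sh0 /D0; field.
by rewrite scale0r add0r.
Qed.

Lemma gmove0 : gmove w e 0 = w.
Proof.
have := gmoveE 0; rewrite mulr0 => ->.
have E0 : expR (r * 0) = 1 :> R by rewrite mulr0 expR0.
have E1 : expR (- (r * 0)) = 1 :> R by rewrite mulr0 oppr0 expR0.
have n0 := lt0r_neq0 n1.
have D00 : D0 != 0 by rewrite gt_eqF// divr_gt0.
have ch0 : ch 0 = 1 by rewrite /ch E0 E1; field.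
have sh0 : sh 0 = 0 by rewrite /sh E0 E1; field.
have dE0 : d 0 = D0 by rewrite /d ch0 sh0; ring.
by rewrite dE0 /A /B ch0 sh0 !mul0r mul1r addr0 divff// scale0r addr0 scale1r.
Qed.

(** [gmove] shows that the set inside [pexp] is inhabited, and uniqueness identifies whichever
    geodesic was chosen. The factor [(1 - |w|^2) / 2] converts hyperbolic length into Euclidean
    length at [w]. *)
Lemma pexp_gmove : pexp w (((1 - `|w| ^+ 2) / 2 * r) *: e) = gmove w e r.
Proof.
have ex : [set z | exists c, [/\ geodesic c, c 0 = w,
    derive1 c 0 = ((1 - `|w| ^+ 2) / 2 * r) *: e & c 1 = z]] (gmove w e r).
  exists (fun t => gmove w e (r * t)); split; first exact: gmove_geodesic.
  - by rewrite mulr0 gmove0.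
  - exact: gmove_derive0.
  - by rewrite mulr1.
have [c [gc c0 dc0 c1]] := getPex (ex_intro _ _ ex).
rewrite /pexp -c1 (geodesic_unique gc gmove_geodesic) ?mulr1//.
- by rewrite c0 mulr0 gmove0.
- by rewrite dc0 gmove_derive0.
Qed.

End ExplicitGeodesic.

End Geodesics.

(** * Averages over the sphere and weak integrals *)

Section SphereAverage.
Set Implicit Arguments.
Unset Strict Implicit.
Context {R : realType} {H : hilbertType R}.
Implicit Types (f g : H -> R) (Y : H -> H) (a b M : R) (x y z p : H).

Lemma measurable_continuous f : continuous f ->
  measurable_fun setT (f : borel H -> R).
Proof.
move=> cf; apply: (measurability _ (RGenOInfty.measurableE R)).
move=> _ [_ [a ->] <-]; rewrite setTI; apply: sub_sigma_algebra.
apply: open_comp => [x _|]; first exact: cf.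
exact: interval_open.
Qed.

Lemma measurable_sphere : measurable (sphere : set (borel H)).
Proof.
have := measurable_continuous (@norm_continuous R H).
move=> /(_ measurableT [set 1] (measurable_set1 1)); rewrite setTI.
by congr measurable; apply/seteqP; split => x.
Qed.

(** Restricted to the sphere because [sigma w], for nonzero [w], has a pole at [w / |w|^2], outside
    the closed ball. *)
Definition bounded_mfun f := measurable_fun (sphere : set (borel H)) (f : borel H -> R) /\
  exists M, forall x, sphere x -> `|f x| <= M.

Lemma bm_continuous f : continuous f ->
  (exists M, forall x, sphere x -> `|f x| <= M) -> bounded_mfun f.
Proof.
move=> cf bf; split => //; apply: measurable_funTS; exact: measurable_continuous.
Qed.

Lemma bm_cst a : bounded_mfun (fun=> a).
Proof. by split; [exact: measurable_cst|exists `|a|]. Qed.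

Lemma bm_inner y : bounded_mfun (fun x => inner x y).
Proof.
apply: bm_continuous.
  rewrite (_ : (fun x => _) = inner y); first exact: inner_continuous.
  by apply/funext => x; rewrite innerC.
exists `|y| => x x1; apply: le_trans (cauchy_schwarz _ _) _.
by rewrite x1 mul1r.
Qed.

Lemma bmD f g : bounded_mfun f -> bounded_mfun g ->
  bounded_mfun (fun x => f x + g x).
Proof.
move=> [mf [M hM]] [mg [N hN]]; split; first exact: measurable_funD.
exists (M + N) => x sx; apply: le_trans (ler_normD _ _) _.
by apply: lerD; [exact: hM|exact: hN].
Qed.

Lemma bmM f g : bounded_mfun f -> bounded_mfun g ->
  bounded_mfun (fun x => f x * g x).
Proof.
move=> [mf [M hM]] [mg [N hN]]; split; first exact: measurable_funM.
by exists (M * N) => x sx; rewrite normrM ler_pM// ?hM// hN.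
Qed.

Lemma bmN f : bounded_mfun f -> bounded_mfun (fun x => - f x).
Proof.
move=> [mf [M hM]]; split; first exact: measurable_funN.
by exists M => x sx; rewrite normrN hM.
Qed.

Lemma bmB f g : bounded_mfun f -> bounded_mfun g ->
  bounded_mfun (fun x => f x - g x).
Proof. by move=> bf bg; apply: bmD => //; exact: bmN. Qed.

Lemma bmZ a f : bounded_mfun f -> bounded_mfun (fun x => a * f x).
Proof. by move=> bf; apply: bmM => //; exact: bm_cst. Qed.

Lemma bmX f n : bounded_mfun f -> bounded_mfun (fun x => f x ^+ n).
Proof.
move=> bf; elim: n => [|n IH]; first exact: bm_cst.
by under eq_fun do rewrite exprS; exact: bmM.
Qed.

Lemma eq_bm f g : {in sphere, f =1 g} -> bounded_mfun f -> bounded_mfun g.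
Proof.
move=> fg [mf [M hM]]; split; first exact: eq_measurable_fun mf.
by exists M => x sx; rewrite -fg ?inE// hM.
Qed.

Lemma bmV f m : 0 < m -> (forall x, sphere x -> m <= f x) -> bounded_mfun f ->
  bounded_mfun (fun x => (f x)^-1).
Proof.
move=> m0 mf bf; have f0 x : sphere x -> 0 < f x.
  by move=> /mf; exact: lt_le_trans.
(* On positive reals the inverse is the power with exponent -1, a measurable function. *)
apply: (@eq_bm (fun x => f x `^ (-1))).
  by move=> x; rewrite inE => sx; rewrite powR_inv1// ltW// f0.
split.
  apply: (measurableT_comp (f := fun a : R => a `^ (-1))).
    exact: measurable_powR.
  by have [] := bf.
exists m^-1 => x sx; rewrite powR_inv1 ?(ltW (f0 _ sx))//.
by rewrite gtr0_norm ?invr_gt0 ?f0// lef_pV2 ?posrE ?f0// mf.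
Qed.

Lemma bm_ln f m : 0 < m -> (forall x, sphere x -> m <= f x) -> bounded_mfun f ->
  bounded_mfun (fun x => ln (f x)).
Proof.
move=> m0 mf [mef [M hM]]; split.
  by apply: (measurableT_comp (f := @ln R)) => //; exact: measurable_ln.
have f0 x : sphere x -> 0 < f x by move=> /mf; exact: lt_le_trans.
exists (`|ln m| + `|ln M|) => x sx.
have h1 : ln m <= ln (f x) by rewrite ler_ln ?posrE ?f0// mf.
have h2 : ln (f x) <= ln M.
  have h : f x <= M by apply: le_trans (ler_norm _) (hM _ sx).
  by rewrite ler_ln ?posrE ?f0// (lt_le_trans (f0 _ sx) h).
have := ler_norm (ln M); have := ler_norm (- ln m); rewrite normrN => h3 h4.
have h5 := normr_ge0 (ln M); have h6 := normr_ge0 (ln m).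
rewrite ler_norml; apply/andP; split; lra.
Qed.

Variable mu : probability (borel H) R.
Hypothesis mu_sphere : mu sphere = 1%E.

Definition avg f : R := \int[mu]_(x in (sphere : set (borel H))) f x.

Lemma bm_integrable f : bounded_mfun f ->
  mu.-integrable sphere (EFin \o (f : borel H -> R)).
Proof.
move=> [mf [M hM]]; apply: measurable_bounded_integrable => //.
- exact: measurable_sphere.
- by apply: le_lt_trans (probability_le1 _ measurable_sphere) (ltry _).
- exists M; split; first by rewrite num_real.
  by move=> N MN x sx /=; apply: le_trans (hM _ sx) (ltW MN).
Qed.

Lemma avg_cst a : avg (fun=> a) = a.
Proof.
rewrite /avg Rintegral_cst; last exact: measurable_sphere.
by rewrite -[RHS]mulr1; congr (a * _); exact: (congr1 fine mu_sphere).
Qed.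

Lemma eq_avg f g : (forall x, sphere x -> f x = g x) -> avg f = avg g.
Proof. by move=> fg; apply: eq_Rintegral => x; rewrite inE; exact: fg. Qed.

Lemma avgD f g : bounded_mfun f -> bounded_mfun g ->
  avg (fun x => f x + g x) = avg f + avg g.
Proof.
move=> bf bg; rewrite /avg RintegralD//; first exact: measurable_sphere.
  exact: bm_integrable.
exact: bm_integrable.
Qed.

Lemma avgZ a f : bounded_mfun f -> avg (fun x => a * f x) = a * avg f.
Proof.
move=> bf; rewrite /avg RintegralZl//; first exact: measurable_sphere.
exact: bm_integrable.
Qed.

Lemma avgN f : bounded_mfun f -> avg (fun x => - f x) = - avg f.
Proof.
move=> bf; rewrite -mulN1r -avgZ//; apply: eq_avg => x _; by rewrite mulN1r.
Qed.

Lemma avgB f g : bounded_mfun f -> bounded_mfun g ->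
  avg (fun x => f x - g x) = avg f - avg g.
Proof. by move=> bf bg; rewrite avgD ?avgN//; exact: bmN. Qed.

Lemma le_avg f g : bounded_mfun f -> bounded_mfun g ->
  (forall x, sphere x -> f x <= g x) -> avg f <= avg g.
Proof.
move=> bf bg fg; apply: le_Rintegral => //; first exact: measurable_sphere.
  exact: bm_integrable.
exact: bm_integrable.
Qed.

Lemma avg_le_cst f a : bounded_mfun f -> (forall x, sphere x -> f x <= a) ->
  avg f <= a.
Proof. by move=> bf fa; rewrite -[leRHS]avg_cst le_avg//; exact: bm_cst. Qed.

Lemma avg_ge_cst f a : bounded_mfun f -> (forall x, sphere x -> a <= f x) ->
  a <= avg f.
Proof. by move=> bf fa; rewrite -[leLHS]avg_cst le_avg//; exact: bm_cst. Qed.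

Lemma avg_norm_le f a : bounded_mfun f -> (forall x, sphere x -> `|f x| <= a) ->
  `|avg f| <= a.
Proof.
move=> bf fa; rewrite ler_norml; apply/andP; split.
  by apply: avg_ge_cst => // x /fa; rewrite ler_norml => /andP[].
by apply: avg_le_cst => // x /fa; rewrite ler_norml => /andP[].
Qed.

(** Supplies the unit vector that [gmove_exists] asks for; the zero space carries no such
    measure. *)
Lemma sphere_nonempty : exists x : H, sphere x.
Proof.
have [h|h] := pselect (exists x : H, sphere x) => //; exfalso.
have : sphere = set0 :> set (borel H).
  by apply/seteqP; split => x // sx; apply: h; exists x.
move=> e; move: mu_sphere; rewrite e measure0 => /eqP.
by rewrite eqe eq_sym oner_eq0.
Qed.

(* The weak integral of a bounded field; [force mu w] is [wavg (director w)]. *)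
Definition wavg Y : H :=
  get [set z | forall y : H, inner z y = avg (fun x => inner (Y x) y)].

Definition bounded_field Y := (forall y, bounded_mfun (fun x => inner (Y x) y)) /\
  exists M, forall x, sphere x -> `|Y x| <= M.

(** The bound on [Y] bounds the averaged functional, so the Riesz representation provides a vector
    for [get] to choose. *)
Lemma wavgE Y y : bounded_field Y ->
  inner (wavg Y) y = avg (fun x => inner (Y x) y).
Proof.
move=> [mY [M hM]].
have [] := @riesz_representation R H (fun y => avg (fun x => inner (Y x) y)) M.
- move=> u v; rewrite -avgD//; apply: eq_avg => x _; exact: innerDr.
- move=> k u; rewrite -avgZ//; apply: eq_avg => x _; exact: innerZr.
- move=> u; apply: avg_le_cst => // x sx; apply: le_trans (inner_le _ _) _.
  by rewrite ler_wpM2r// hM.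
move=> z hz; have := @getPex _ [set z | forall y : H,
  inner z y = avg (fun x => inner (Y x) y)] (ex_intro _ z hz).
exact.
Qed.

Lemma wavg_unique Y z : bounded_field Y ->
  (forall y, inner z y = avg (fun x => inner (Y x) y)) -> wavg Y = z.
Proof. by move=> bY hz; apply: inner_ext => y; rewrite wavgE. Qed.

Lemma wavg_norm_le Y M : bounded_field Y -> 0 <= M ->
  (forall x, sphere x -> `|Y x| <= M) -> `|wavg Y| <= M.
Proof.
move=> bY M0 hM; apply: norm_le_inner => // y; rewrite wavgE//.
apply: avg_le_cst; first by have [] := bY.
move=> x sx; apply: le_trans (inner_le _ _) _.
by rewrite ler_wpM2r// hM.
Qed.

End SphereAverage.

(** * Stability makes small caps uniformly light *)

Section Concentration.
Set Implicit Arguments.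
Unset Strict Implicit.
Context {R : realType} {H : hilbertType R}.
Variable mu : probability (borel H) R.
Hypothesis mu_sphere : mu sphere = 1%E.
Hypothesis mu_stable : stable mu.

Definition cap (p : H) (r : R) : set (borel H) := ball p r `&` sphere.

Lemma measurable_cap p r : measurable (cap p r).
Proof.
apply: measurableI; last exact: measurable_sphere.
by apply: sub_sigma_algebra; exact: ball_open.
Qed.

Lemma mu_fin (A : set (borel H)) : measurable A -> mu A = (fine (mu A))%:E.
Proof. by move=> mA; rewrite fineK// fin_num_measure. Qed.

(* Otherwise caps of radius tending to 0 have mass tending to 1/2; by the
   reverse Fatou lemma infinitely many of them share a point, which is then an
   atom of mass 1/2. *)
Lemma caps_uniformly_light : exists r dl : R, [/\ 0 < r, r <= 2^-1, 0 < dl &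
  forall p, fine (mu (cap p r)) <= 2^-1 - dl].
Proof.
apply: contrapT => hn.
(* The shifted indices keep the radius [1 / (n + 2)] at most 1/2 and the mass above
   [1/2 - 1/3 = 1/6]. *)
have hp n : exists p, 2^-1 - n.+3%:R^-1 < fine (mu (cap p (n.+2%:R^-1))).
  apply: contrapT => hp; apply: hn; exists n.+2%:R^-1, n.+3%:R^-1.
  split; rewrite ?invr_gt0 ?ltr0n//.
    by rewrite lef_pV2 ?posrE ?ltr0n// ler_nat.
  by move=> p; rewrite leNgt; apply/negP => h; apply: hp; exists p.
have [p {}hp] := choice hp.
pose F n := cap (p n) (n.+2%:R^-1).
have mF k : measurable (F k) by exact: measurable_cap.
have fin : (mu (\bigcup_(k >= 0) F k) < +oo)%E.
  by apply: le_lt_trans (probability_le1 _ _) (ltry _); exact: bigcup_measurable.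
have cv := lim_sup_set_cvg mu F mF fin.
(* Positive mass of the limit superior serves only to produce a point [a] that lies in infinitely
   many caps. *)
have : (6^-1%:E <= mu (lim_sup_set F))%E.
  rewrite -(cvg_lim _ cv)//; apply: lime_ge; first by apply/cvg_ex; eexists; exact: cv.
  apply: nearW => n.
  have h : (mu (F n) <= mu (\bigcup_(k >= n) F k))%E.
    apply: le_measure; rewrite ?inE//; first exact: bigcup_measurable.
    by apply: bigcup_sup => /=.
  apply: le_trans h; rewrite mu_fin// lee_fin.
  apply: ltW; apply: le_lt_trans (hp n).
  have : (n.+3%:R : R)^-1 <= 3^-1 by rewrite lef_pV2 ?posrE ?ltr0n// ler_nat.
  by move: (n.+3%:R^-1) => u; lra.
have [ha|h0] := pselect (exists a, lim_sup_set F a); last first.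
  have -> : lim_sup_set F = set0.
    by apply/seteqP; split => x // hx; apply: h0; exists x.
  by rewrite measure0 lee_fin leNgt invr_gt0 ltr0n.
case: ha => a ha _.
have sa : sphere a by have [k _ []] := ha 0%N I.
(* Each [C n] contains some [F m] with large [m]: two radii [1 / (m + 2)] add up to less than
   [1 / (n + 1)] once [1 / (m + 1)] is at most half of it. So each [C n] has mass at least 1/2, and
   continuity from above passes this to [a]. *)
pose C n := cap a (n.+1%:R^-1).
have capC : \bigcap_n C n = [set a].
  apply/seteqP; split => x /=; last first.
    move=> -> n _; split => //; apply: ballxx; by rewrite invr_gt0 ltr0n.
  move=> hx; apply/eqP; rewrite -subr_eq0 -normr_eq0 eq_le normr_ge0 andbT.
  apply/ler_addgt0Pr => e e0; rewrite add0r.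
  have [N hN] := eventually_invS_le e0.
  have [+ _] := hx N I; rewrite -ball_normE /= distrC => h.
  exact: le_trans (ltW h) (hN N (leqnn _)).
have mC k : measurable (C k) by exact: measurable_cap.
have cvC : (mu \o C) @ \oo --> mu [set a].
  rewrite -capC; apply: nonincreasing_cvg_mu => //.
  - by apply: le_lt_trans (probability_le1 _ _) (ltry _).
  - exact: bigcapT_measurable.
  - move=> m n mn; apply/subsetPset => x [hb sx]; split => //.
    apply: le_ball hb; by rewrite lef_pV2 ?posrE ?ltr0n// ler_nat.
have := mu_stable sa; apply/negP; rewrite -leNgt.
rewrite -(cvg_lim _ cvC)//; apply: lime_ge; first by apply/cvg_ex; eexists; exact: cvC.
apply: nearW => n /=.
rewrite mu_fin// lee_fin; apply/ler_addgt0Pr => e e0.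
have e'0 : 0 < Num.min e (n.+1%:R^-1 / 2).
  by rewrite lt_min e0 divr_gt0 ?invr_gt0 ?ltr0n.
have [N hN] := eventually_invS_le e'0.
have [m /= Nm [hb _]] := ha N I.
have mle : m.+1%:R^-1 <= e /\ m.+1%:R^-1 <= n.+1%:R^-1 / 2 :> R.
  by have := hN m Nm; rewrite le_min => /andP[].
have [h1 h2] := mle.
have h3 : (m.+3%:R : R)^-1 <= m.+1%:R^-1.
  by rewrite lef_pV2 ?posrE ?ltr0n// ler_nat !ltnS ltnW.
have h4 : (m.+2%:R : R)^-1 <= m.+1%:R^-1.
  by rewrite lef_pV2 ?posrE ?ltr0n// ler_nat ltnS.
have sub : F m `<=` C n.
  move=> x [hx sx]; split => //.
  move: hx hb; rewrite -ball_normE /= => hx hb.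
  have -> : a - x = - (p m - a) + (p m - x).
    by rewrite opprB addrA subrK.
  apply: le_lt_trans (ler_normD _ _) _; rewrite normrN.
  by move: hx hb h2 h4; move: (m.+1%:R^-1) (m.+2%:R^-1) (n.+1%:R^-1) => u v t; lra.
have : fine (mu (F m)) <= fine (mu (C n)).
  by rewrite -lee_fin -!mu_fin//; apply: le_measure; rewrite ?inE.
have := hp m; rewrite -/(F m).
by move: h1 h3; move: (m.+1%:R^-1) (m.+3%:R^-1) => u v; lra.
Qed.

Lemma bm_indic p r : bounded_mfun (\1_(cap p r) : H -> R).
Proof.
split.
  apply: measurable_funTS; apply: measurable_indic; exact: measurable_cap.
exists 1 => x _; rewrite indicE; case: (_ \in _); rewrite ?normr1 ?normr0//.
Qed.

Lemma avg_indic p r : avg mu (\1_(cap p r) : H -> R) = fine (mu (cap p r)).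
Proof.
rewrite /avg /Rintegral integral_indic//.
- by congr (fine (mu _)); rewrite setIidl// => x [].
- exact: measurable_sphere.
- exact: measurable_cap.
Qed.

End Concentration.

(** * The potential along geodesics *)

Section PotentialAlongGeodesics.
Set Implicit Arguments.
Unset Strict Implicit.
Context {R : realType} {H : hilbertType R}.
Variable mu : probability (borel H) R.
Hypothesis mu_sphere : mu sphere = 1%E.
Implicit Types (w x y z e : H) (s : R).

Lemma inner_sigma_unit w x e : `|w| < 1 -> sphere x -> `|e| = 1 ->
  -1 <= inner (sigma w x) e <= 1.
Proof. by move=> w1 x1 e1; rewrite inner_unit// sigma_sphere. Qed.

Lemma sphere_norm x : sphere x -> `|x| = 1. Proof. by []. Qed.

Lemma sden_sphere_ge w x : `|w| < 1 -> sphere x ->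
  (1 - `|w|) ^+ 2 <= sden w x.
Proof. by move=> w1 x1; have := sden_ge w x; rewrite (sphere_norm x1) mulr1. Qed.

Lemma bm_sden w : bounded_mfun (sden w : H -> R).
Proof.
apply: (@eq_bm _ _ (fun x => 1 - 2 * inner x w + `|w| ^+ 2)).
  by move=> x; rewrite inE => x1; rewrite /sden (sphere_norm x1) expr1n mulr1 innerC.
apply: bmD; last exact: bm_cst.
by apply: bmB; [exact: bm_cst|apply: bmZ; exact: bm_inner].
Qed.

Lemma bm_sigma w y : `|w| < 1 -> bounded_mfun (fun x => inner (sigma w x) y).
Proof.
move=> w1; apply: (@eq_bm _ _ (fun x => (sden w x)^-1 *
  ((1 - `|w| ^+ 2) * inner x y - (2 - 2 * inner x w) * inner w y))).
  move=> x; rewrite inE => x1; rewrite inner_sigma (sphere_norm x1) expr1n.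
  by rewrite (innerC x w) (_ : 1 + 1 = 2 :> R).
apply: bmM.
  apply: (@bmV _ _ _ ((1 - `|w|) ^+ 2)); last exact: bm_sden.
    by rewrite exprn_gt0// subr_gt0.
  by move=> x; exact: sden_sphere_ge.
apply: bmB; first by apply: bmZ; exact: bm_inner.
apply: bmM; last exact: bm_cst.
by apply: bmB; [exact: bm_cst|apply: bmZ; exact: bm_inner].
Qed.

Lemma bfield_sigma w : `|w| < 1 -> bounded_field (sigma w).
Proof.
move=> w1; split => [y|]; first exact: bm_sigma.
by exists 1 => x x1; rewrite sigma_sphere.
Qed.

Lemma bus_ge w x : `|w| < 1 -> sphere x -> (1 - `|w|) ^+ 2 <= bus w x.
Proof.
move=> w1 x1; rewrite /bus -sden_sphere//; apply: le_trans (sden_sphere_ge w1 x1) _.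
rewrite ler_peMr ?(ltW (sden_gt0 _ _)) ?(sphere_norm x1)//.
by rewrite invf_ge1 ?sqr_norm_lt1// gerBl sqr_ge0.
Qed.

Lemma bm_bus w : `|w| < 1 -> bounded_mfun (bus w : H -> R).
Proof.
move=> w1; apply: (@eq_bm _ _ (fun x => sden w x * (1 - `|w| ^+ 2)^-1)).
  by move=> x; rewrite inE => x1; rewrite /bus sden_sphere.
by apply: bmM; [exact: bm_sden|exact: bm_cst].
Qed.

Lemma bm_ln_bus w : `|w| < 1 -> bounded_mfun (fun x => ln (bus w x)).
Proof.
move=> w1; apply: (@bm_ln _ _ _ ((1 - `|w|) ^+ 2)); last exact: bm_bus.
  by rewrite exprn_gt0// subr_gt0.
by move=> x; exact: bus_ge.
Qed.

Lemma bm_hyp w e s : `|w| < 1 ->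
  bounded_mfun (fun x => hyp (inner (sigma w x) e) s).
Proof.
move=> w1; have b := bm_sigma e w1; rewrite /hyp; apply: bmM; last exact: bm_cst.
by apply: bmD; (apply: bmM; [|exact: bm_cst]); [apply: bmB|apply: bmD] => //;
  exact: bm_cst.
Qed.

Lemma bm_phi w e s : `|w| < 1 -> `|e| = 1 ->
  bounded_mfun (fun x => phi (inner (sigma w x) e) s).
Proof.
move=> w1 e1; apply: (@bm_ln _ _ _ (expR (- `|s|))); last exact: bm_hyp.
  exact: expR_gt0.
by move=> x x1; apply: hyp_ge; exact: inner_sigma_unit.
Qed.

Lemma bm_dphi w e s : `|w| < 1 -> `|e| = 1 ->
  bounded_mfun (fun x => dphi (inner (sigma w x) e) s).
Proof.
move=> w1 e1; have b := bm_sigma e w1; rewrite /dphi; apply: bmM; last first.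
  apply: (@bmV _ _ _ (expR (- `|s|))); last exact: bm_hyp.
    exact: expR_gt0.
  by move=> x x1; apply: hyp_ge; exact: inner_sigma_unit.
apply: bmM; last exact: bm_cst.
by apply: bmB; (apply: bmM; [|exact: bm_cst]); [apply: bmB|apply: bmD] => //;
  exact: bm_cst.
Qed.

Definition mean w : H := wavg mu (sigma w).

(** The second moment, not centred, of the measure seen from [w]; [1 - cov w e e] is the second
    derivative of the potential at [w] along [e]. *)
Definition cov w e e' : R :=
  avg mu (fun x => inner (sigma w x) e * inner (sigma w x) e').

Lemma inner_mean w e : `|w| < 1 ->
  inner (mean w) e = avg mu (fun x => inner (sigma w x) e).
Proof. by move=> w1; rewrite wavgE//; exact: bfield_sigma. Qed.

Lemma mean_norm w : `|w| < 1 -> `|mean w| <= 1.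
Proof.
move=> w1; apply: (wavg_norm_le mu_sphere) => //; first exact: bfield_sigma.
by move=> x x1; rewrite sigma_sphere.
Qed.

Lemma covE w e : cov w e e = avg mu (fun x => inner (sigma w x) e ^+ 2).
Proof. by apply: eq_avg => x _; rewrite expr2. Qed.

Lemma bm_sigma_sqr w e : `|w| < 1 ->
  bounded_mfun (fun x => inner (sigma w x) e ^+ 2).
Proof. by move=> w1; apply: bmX; exact: bm_sigma. Qed.

Lemma bm_1sigma_sqr w e : `|w| < 1 ->
  bounded_mfun (fun x => 1 - inner (sigma w x) e ^+ 2).
Proof. by move=> w1; apply: bmB; [exact: bm_cst|exact: bm_sigma_sqr]. Qed.

Lemma avg_1sigma_sqr w e : `|w| < 1 ->
  avg mu (fun x => 1 - inner (sigma w x) e ^+ 2) = 1 - cov w e e.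
Proof.
move=> w1; rewrite avgB// ?avg_cst// ?covE//; first exact: bm_cst.
exact: bm_sigma_sqr.
Qed.

Lemma potentialE w : potential mu w = avg mu (fun x => ln (bus w x)).
Proof. by []. Qed.

Lemma potential_gmove w e s : `|w| < 1 -> `|e| = 1 ->
  potential mu (gmove w e s) =
  potential mu w + avg mu (fun x => phi (inner (sigma w x) e) s).
Proof.
move=> w1 e1; rewrite !potentialE -avgD//; last 2 first.
- exact: bm_ln_bus.
- exact: bm_phi.
apply: eq_avg => x x1; rewrite bus_gmove// lnM ?posrE ?bus_gt0//.
by rewrite hyp_gt0// inner_sigma_unit.
Qed.

(** The scalar bounds on [phi] and [dphi] are affine in [q] and [1 - q^2], so this and [avg_affine]
    serve all of them. *)
Lemma bm_affine w e a b c : `|w| < 1 ->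
  bounded_mfun (fun x => a * inner (sigma w x) e +
    b * (1 - inner (sigma w x) e ^+ 2) + c).
Proof.
move=> w1; apply: bmD; last exact: bm_cst.
by apply: bmD; apply: bmZ; [exact: bm_sigma|exact: bm_1sigma_sqr].
Qed.

Lemma avg_affine w e a b c : `|w| < 1 ->
  avg mu (fun x => a * inner (sigma w x) e +
    b * (1 - inner (sigma w x) e ^+ 2) + c) =
  a * inner (mean w) e + b * (1 - cov w e e) + c.
Proof.
move=> w1; have b1 := bm_sigma e w1; have b2 := bm_1sigma_sqr e w1.
have b3 : bounded_mfun (fun x => a * inner (sigma w x) e) by exact: bmZ.
have b4 : bounded_mfun (fun x => b * (1 - inner (sigma w x) e ^+ 2)).
  exact: bmZ.
rewrite avgD//; [|exact: bmD|exact: bm_cst].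
by rewrite avgD// !avgZ// avg_cst// inner_mean// avg_1sigma_sqr.
Qed.

Lemma potential_le w e s : `|w| < 1 -> `|e| = 1 -> 0 <= s ->
  potential mu (gmove w e s) - potential mu w <=
  - inner (mean w) e * s + s ^+ 2 / 2.
Proof.
move=> w1 e1 s0; rewrite potential_gmove// addrAC subrr add0r.
have -> : - inner (mean w) e * s + s ^+ 2 / 2 = (- s) * inner (mean w) e +
  0 * (1 - cov w e e) + s ^+ 2 / 2 by ring.
rewrite -avg_affine//; apply: le_avg => //; [exact: bm_phi|exact: bm_affine|].
by move=> x x1; have := phi_le (inner_sigma_unit w1 x1 e1) s0; lra.
Qed.

Lemma potential_ge w e s : `|w| < 1 -> `|e| = 1 -> 0 <= s ->
  - inner (mean w) e * s + expR (- (2 * s)) * (1 - cov w e e) * s ^+ 2 / 2 <=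
  potential mu (gmove w e s) - potential mu w.
Proof.
move=> w1 e1 s0; rewrite potential_gmove// addrAC subrr add0r; set k := expR _.
have -> : - inner (mean w) e * s + k * (1 - cov w e e) * s ^+ 2 / 2 =
  (- s) * inner (mean w) e + (k * s ^+ 2 / 2) * (1 - cov w e e) + 0 by ring.
rewrite -avg_affine//; apply: le_avg => //; [exact: bm_affine|exact: bm_phi|].
by move=> x x1; have := phi_ge (inner_sigma_unit w1 x1 e1) s0; rewrite -/k; lra.
Qed.

Lemma avg_phi_taylor w e s : `|w| < 1 -> `|e| = 1 -> 0 <= s ->
  avg mu (fun x => phi (inner (sigma w x) e) s) <=
  - inner (mean w) e * s + (1 - cov w e e) * s ^+ 2 / 2 + s ^+ 3 / 3.
Proof.
move=> w1 e1 s0.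
have -> : - inner (mean w) e * s + (1 - cov w e e) * s ^+ 2 / 2 + s ^+ 3 / 3 =
  (- s) * inner (mean w) e + (s ^+ 2 / 2) * (1 - cov w e e) + s ^+ 3 / 3.
  by ring.
rewrite -avg_affine//; apply: le_avg => //; [exact: bm_phi|exact: bm_affine|].
by move=> x x1; have := phi_taylor_le (inner_sigma_unit w1 x1 e1) s0; lra.
Qed.

Lemma avg_dphi_le w e s : `|w| < 1 -> `|e| = 1 -> 0 <= s ->
  avg mu (fun x => dphi (inner (sigma w x) e) s) <= - inner (mean w) e + s.
Proof.
move=> w1 e1 s0.
have -> : - inner (mean w) e + s =
  (- 1) * inner (mean w) e + 0 * (1 - cov w e e) + s by ring.
rewrite -avg_affine//; apply: le_avg => //; [exact: bm_dphi|exact: bm_affine|].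
by move=> x x1; have := dphi_le (inner_sigma_unit w1 x1 e1) s0; lra.
Qed.

Lemma avg_dphi_ge w e s : `|w| < 1 -> `|e| = 1 -> 0 <= s ->
  - inner (mean w) e + (1 - cov w e e) * s - s ^+ 2 <=
  avg mu (fun x => dphi (inner (sigma w x) e) s).
Proof.
move=> w1 e1 s0.
have -> : - inner (mean w) e + (1 - cov w e e) * s - s ^+ 2 =
  (- 1) * inner (mean w) e + s * (1 - cov w e e) + (- s ^+ 2) by ring.
rewrite -avg_affine//; apply: le_avg => //; [exact: bm_affine|exact: bm_dphi|].
by move=> x x1; have /andP[] := dphi_taylor (inner_sigma_unit w1 x1 e1) s0; lra.
Qed.

Lemma avg_dphi0 w e : `|w| < 1 -> `|e| = 1 ->
  avg mu (fun x => dphi (inner (sigma w x) e) 0) = - inner (mean w) e.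
Proof.
move=> w1 e1; rewrite inner_mean// -avgN//; last exact: bm_sigma.
by apply: eq_avg => x _; rewrite dphi0.
Qed.

Lemma avg_phi0 w e : avg mu (fun x => phi (inner (sigma w x) e) 0) = 0.
Proof. by rewrite -[RHS](avg_cst mu_sphere); apply: eq_avg => x _; exact: phi0. Qed.

Lemma avg_phi_derive w e r t : `|w| < 1 -> `|e| = 1 ->
  is_derive (t : R) 1 (fun t => avg mu (fun x => phi (inner (sigma w x) e) (t * r)))
    (r * avg mu (fun x => dphi (inner (sigma w x) e) (t * r))).
Proof.
move=> w1 e1; apply: (@taylor_derive _ _ _ _ _ _ _ (r ^+ 2 / 2) 1) => // d _.
rewrite /GRing.scale/= mulr1 (addrC _ t).
have bd : bounded_mfun (fun x => d * (r * dphi (inner (sigma w x) e) (t * r))).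
  by do 2! apply: bmZ; exact: bm_dphi.
have bp : bounded_mfun (fun x => phi (inner (sigma w x) e) ((t + d) * r) -
    phi (inner (sigma w x) e) (t * r)) by apply: bmB; exact: bm_phi.
have -> : d * (r * avg mu (fun x => dphi (inner (sigma w x) e) (t * r))) =
    avg mu (fun x => d * (r * dphi (inner (sigma w x) e) (t * r))).
  by rewrite !avgZ//; [exact: bm_dphi|apply: bmZ; exact: bm_dphi].
rewrite -avgB//; [|exact: bm_phi|exact: bm_phi].
rewrite -avgB//; apply: avg_norm_le => //; first exact: bmB.
move=> x x1.
have := phi_quadratic (t * r) (d * r) (inner_sigma_unit w1 x1 e1).
rewrite -mulrDl; move=> h; rewrite [leRHS](_ : _ = (d * r) ^+ 2 / 2); last by field.
by move: h; congr (`| _ - _ | <= _); ring.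
Qed.

End PotentialAlongGeodesics.

(** * Coercivity and nondegeneracy from stability *)

Section Coercivity.
Set Implicit Arguments.
Unset Strict Implicit.
Context {R : realType} {H : hilbertType R}.
Variable mu : probability (borel H) R.
Hypothesis mu_sphere : mu sphere = 1%E.
Hypothesis mu_stable : stable mu.
Implicit Types (w x y z e : H) (s : R).

(** Let [eta = 1 - |w|]. Up to constants, a point outside the cap around [w / |w|] contributes at
    least [- ln eta], and a point inside at least [ln eta]. The cap has mass at most [1/2 - dl], so
    the balance is at least [- 2 * dl * ln eta]. *)
Lemma potential_coercive : exists (a dl : R), 0 < dl /\
  forall w, `|w| < 1 -> a - dl * ln (1 - `|w|) <= potential mu w.
Proof.
have [r [dl [r0 r1 dl0 hc]]] := caps_uniformly_light mu_stable.
have r20 : 0 < r ^+ 2 / 2 by rewrite divr_gt0// exprn_gt0.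
have r21 : r ^+ 2 / 2 <= 4^-1.
  have : r * r <= 2^-1 * 2^-1 by rewrite ler_pM// ltW.
  by rewrite expr2; lra.
exists (ln (r ^+ 2 / 2) - ln 2), (2 * dl); split; first by rewrite mulr_gt0.
move=> w w1; set eta := 1 - `|w|.
have eta0 : 0 < eta by rewrite subr_gt0.
have eta1 : eta <= 1 by rewrite gerBl.
have lneta : ln eta <= 0 by rewrite ln_le0.
have lnr : ln (r ^+ 2 / 2) <= 0 by rewrite ln_le0//; lra.
pose p := `|w|^-1 *: w.
pose K := ln (r ^+ 2 / 2) - ln (2 * eta).
have n0 := sqr_norm_lt1 w1.
have lb x : sphere x -> K + (2 * ln eta - ln (r ^+ 2 / 2)) * \1_(cap p r) x <=
    ln (bus w x).
  move=> x1.
  have xw : eta <= `|x - w|.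
    by have := lerB_dist x w; rewrite sphere_norm.
  have xw0 : 0 < `|x - w| by exact: lt_le_trans xw.
  have h1 : 1 - `|w| ^+ 2 <= 2 * eta.
    rewrite /eta; have := sqr_ge0 (1 - `|w|); rewrite !expr2; lra.
  have h2 : - ln (2 * eta) <= - ln (1 - `|w| ^+ 2).
    by rewrite lerN2 ler_ln ?posrE ?mulr_gt0.
  rewrite /bus [ln (_ / (1 - _))]ln_div ?posrE ?exprn_gt0// /K.
  have h3 : 2 * ln eta <= ln (`|x - w| ^+ 2).
    have -> : 2 * ln eta = ln (eta ^+ 2) by rewrite lnXn// mulr_natl.
    by rewrite ler_ln ?posrE ?exprn_gt0// lerXn2r ?nnegrE ?(ltW eta0).
  rewrite indicE; have [cx|cx] := boolP (x \in _).
    by rewrite mulr1; move: h2 h3; lra.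
  rewrite mulr0 addr0.
  suff h4 : ln (r ^+ 2 / 2) <= ln (`|x - w| ^+ 2) by move: h2 h4; lra.
  rewrite ler_ln ?posrE ?exprn_gt0//.
  (* For small [w] the direction [p] carries no information, but then [|x - w| >= 1/2], which
     suffices because [r <= 1/2]. *)
  have [w2|w2] := leP `|w| 2^-1.
    have h5 : 2^-1 <= `|x - w| by move: xw; rewrite /eta; lra.
    have : 2^-1 * 2^-1 <= `|x - w| * `|x - w| by rewrite ler_pM.
    by rewrite -expr2 -expr2; move: r21; lra.
  have wn0 : `|w| != 0 by rewrite gt_eqF//; lra.
  have xp : r <= `|x - p|.
    rewrite leNgt; apply/negP => h; move/negP: cx; apply; rewrite inE; split => //.
    by rewrite -ball_normE /= distrC.
  have hxp : r ^+ 2 <= `|x - p| ^+ 2 by rewrite lerXn2r ?nnegrE ?(ltW r0).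
  have -> : `|x - w| ^+ 2 = eta ^+ 2 + `|w| * `|x - p| ^+ 2.
    rewrite !sqr_normB /p innerZr normrZ normfV normr_id mulVf// sphere_norm//.
    by rewrite /eta; field.
  have h6 : 2^-1 * r ^+ 2 <= `|w| * `|x - p| ^+ 2.
    by rewrite ler_pM ?sqr_ge0// ltW.
  by move: h6 (sqr_ge0 eta); lra.
have bK : bounded_mfun (fun x => K + (2 * ln eta - ln (r ^+ 2 / 2)) *
    \1_(cap p r) x).
  by apply: bmD; [exact: bm_cst|apply: bmZ; exact: bm_indic].
have := le_avg mu bK (bm_ln_bus w1) lb.
rewrite -potentialE avgD// ?avgZ// ?avg_cst ?avg_indic//; last 3 first.
- exact: bm_indic.
- exact: bm_cst.
- by apply: bmZ; exact: bm_indic.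
apply: le_trans; rewrite /K.
have := hc p; set P := fine _ => hP.
have P0 : 0 <= P by exact: fine_ge0.
rewrite [ln (2 * eta)]lnM ?posrE//.
have h7 : 0 <= (- ln (r ^+ 2 / 2)) * P by rewrite mulr_ge0// oppr_ge0.
have h8 : 0 <= (- ln eta) * (2^-1 - dl - P) by rewrite mulr_ge0 ?oppr_ge0 ?subr_ge0.
by move: h7 h8; lra.
Qed.

Lemma potential_bounded_below : exists a : R, forall w, `|w| < 1 -> a <= potential mu w.
Proof.
have [a [dl [dl0 h]]] := potential_coercive; exists a => w w1.
apply: le_trans (h w w1); rewrite lerDl oppr_ge0.
by rewrite pmulr_rle0// ln_le0// gerBl.
Qed.

Lemma sublevel_bounded c : exists rho : R, [/\ 0 <= rho, rho < 1 &
  forall w, `|w| < 1 -> potential mu w <= c -> `|w| <= rho].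
Proof.
have [a [dl [dl0 h]]] := potential_coercive.
exists (Num.max 0 (1 - expR ((a - c) / dl))); split.
- by rewrite le_max lexx.
- by rewrite gt_max ltr01 ltrBlDr ltrDl expR_gt0.
move=> w w1 wc; rewrite le_max; apply/orP; right.
rewrite lerBrDr -lerBrDl -ler_ln ?posrE ?expR_gt0 ?subr_gt0// expRK.
by rewrite ler_pdivrMr//; have := h w w1; move: wc; lra.
Qed.

(** [1 - q^2] can be small only if [sigma w x] is near [e] or [- e], that is, if [x] lies in one of
    two caps around [sigma (- w) e] and [sigma (- w) (- e)]. Their masses sum to at most
    [1 - 2 * dl], which leaves [2 * dl] where [1 - q^2 >= k^2]. *)
Lemma cov_bounded rho : rho < 1 -> exists2 lam : R, 0 < lam &
  forall w e, `|w| <= rho -> `|e| = 1 -> lam <= 1 - cov mu w e e.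
Proof.
move=> rho1; have [r [dl [r0 r1 dl0 hc]]] := caps_uniformly_light mu_stable.
have [rho0|rho0] := ltP rho 0.
  exists 1 => // w e wr; have := le_lt_trans wr rho0.
  by rewrite normr_lt0.
have rho2 : 0 < 1 - rho ^+ 2 by rewrite subr_gt0 expr_lt1.
(* [B] bounds [bus] for [|w| <= rho], hence the contraction of chords by [sigma w]; [k] is half the
   squared length left of a chord of length [r]. *)
pose B := 4 / (1 - rho ^+ 2).
have B0 : 0 < B by rewrite divr_gt0.
pose k := r ^+ 2 / (2 * B ^+ 2).
have k0 : 0 < k.
  by apply: divr_gt0; [exact: exprn_gt0|apply: mulr_gt0 => //; exact: exprn_gt0].
exists (k ^+ 2 * (2 * dl)); first exact: mulr_gt0 (exprn_gt0 2 k0) (mulr_gt0 (ltr0Sn R 1) dl0).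
move=> w e wr e1; have w1 : `|w| < 1 by exact: le_lt_trans rho1.
have busB x : sphere x -> bus w x <= B.
  move=> x1; rewrite /bus /B ler_pM ?sqr_ge0 ?invr_ge0 ?(ltW (sqr_norm_lt1 w1))//.
    have h : `|x - w| <= 2.
      by apply: le_trans (ler_normB _ _) _; rewrite sphere_norm//; lra.
    have : `|x - w| * `|x - w| <= 2 * 2 by rewrite ler_pM.
    by rewrite -expr2; lra.
  rewrite lef_pV2 ?posrE ?sqr_norm_lt1// lerD2l lerN2.
  by rewrite lerXn2r ?nnegrE.
have away e' x : `|e'| = 1 -> sphere x -> x \notin cap (sigma (- w) e') r ->
    k <= 1 - inner (sigma w x) e'.
  move=> e'1 x1 cx; set p := sigma (- w) e' in cx.
  have p1 : `|p| = 1 by rewrite sigma_sphere// normrN.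
  have pE : sigma w p = e' by rewrite sigmaVK// e'1.
  have xp : r <= `|x - p|.
    rewrite leNgt; apply/negP => h; move/negP: cx; apply; rewrite inE; split => //.
    by rewrite -ball_normE /= distrC.
  have hxp : r ^+ 2 <= `|x - p| ^+ 2 by rewrite lerXn2r ?nnegrE ?(ltW r0).
  have := sqr_norm_sigmaB w1 x1 p1.
  rewrite pE sqr_normB sigma_sphere// e'1 => h.
  have b1 := bus_gt0 w1 x1; have b2 := bus_gt0 w1 p1.
  have : r ^+ 2 / B ^+ 2 <= `|x - p| ^+ 2 / (bus w x * bus w p).
    rewrite ler_pM ?sqr_ge0 ?invr_ge0 ?sqr_ge0//.
    have BB : bus w x * bus w p <= B ^+ 2.
      by rewrite expr2 ler_pM ?(ltW b1) ?(ltW b2) ?busB.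
    by rewrite lef_pV2 ?posrE ?(mulr_gt0 b1 b2) ?(exprn_gt0 _ B0).
  have -> : r ^+ 2 / B ^+ 2 = 2 * k by rewrite /k; field; rewrite gt_eqF.
  by rewrite -h; lra.
pose c1 := cap (sigma (- w) e) r; pose c2 := cap (sigma (- w) (- e)) r.
have lb x : sphere x -> k ^+ 2 * (1 - \1_c1 x - \1_c2 x) <=
    1 - inner (sigma w x) e ^+ 2.
  move=> x1; have q1 := inner_sigma_unit w1 x1 e1.
  have q2 : 0 <= 1 - inner (sigma w x) e ^+ 2 by rewrite subr_ge0 sqr_le1.
  have k2 : 0 <= k ^+ 2 by exact: sqr_ge0.
  rewrite !indicE; have [cx1|cx1] := boolP (x \in c1).
    by apply: le_trans q2; rewrite mulr_ge0_le0//; case: (x \in c2); rewrite /=; lra.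
  have [cx2|cx2] := boolP (x \in c2).
    by apply: le_trans q2; rewrite mulr_ge0_le0//=; lra.
  rewrite /= !subr0 mulr1.
  have h1 := away e x e1 x1 cx1.
  have h2 : k <= 1 + inner (sigma w x) e.
    by have := away (- e) x _ x1 cx2; rewrite normrN innerNr opprK; exact.
  have : k * k <= (1 - inner (sigma w x) e) * (1 + inner (sigma w x) e).
    by rewrite ler_pM// ltW.
  by rewrite -expr2; lra.
have bI : bounded_mfun (fun x => k ^+ 2 * (1 - \1_c1 x - \1_c2 x)).
  apply: bmZ; apply: bmB; last exact: bm_indic.
  by apply: bmB; [exact: bm_cst|exact: bm_indic].
have := le_avg mu bI (bm_1sigma_sqr e w1) lb.
rewrite avg_1sigma_sqr// avgZ//; last first.
  by apply: bmB; [apply: bmB; [exact: bm_cst|]|]; exact: bm_indic.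
rewrite avgB//; last 2 first.
- by apply: bmB; [exact: bm_cst|exact: bm_indic].
- exact: bm_indic.
rewrite avgB//; last 2 first.
- exact: bm_cst.
- exact: bm_indic.
rewrite avg_cst// !avg_indic//.
apply: le_trans; rewrite ler_wpM2l ?sqr_ge0//.
by have := hc (sigma (- w) e); have := hc (sigma (- w) (- e)); rewrite -/c1 -/c2; lra.
Qed.

End Coercivity.

(** * Existence and uniqueness of the zero of the mean *)

Section Barycenter.
Set Implicit Arguments.
Unset Strict Implicit.
Context {R : realType} {H : hilbertType R}.
Variable mu : probability (borel H) R.
Hypothesis mu_sphere : mu sphere = 1%E.
Hypothesis mu_stable : stable mu.
Implicit Types (w x y z e : H) (s r : R).

Local Notation Psi := (potential mu).
Local Notation m := (mean mu).

(** A move by [|m w|] along [m w] minimizes the quadratic upper bound [- |m w| s + s^2 / 2]. *)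
Lemma potential_descent w : `|w| < 1 ->
  exists2 w', `|w'| < 1 & Psi w' <= Psi w - `|m w| ^+ 2 / 2.
Proof.
move=> w1; have [m0|m0] := eqVneq (m w) 0.
  by exists w => //; rewrite m0 normr0 expr0n/= mul0r subr0.
have nm : `|m w| != 0 by rewrite normr_eq0.
pose e := `|m w|^-1 *: m w.
have e1 : `|e| = 1 by rewrite normrZ normfV normr_id mulVf.
exists (gmove w e `|m w|); first exact: gmove_ball.
have := potential_le mu_sphere w1 e1 (normr_ge0 (m w)).
have -> : inner (m w) e = `|m w| by rewrite innerZr inner_norm expr2 mulKf.
by rewrite expr2; lra.
Qed.

(** Geodesic lengths inside the ball of radius [rho] are at most [S], by [gmove_dist] with
    displacement at most 2; this freezes the factor [expR (- (2 * s))] of [potential_ge], and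
    [cov_bounded] gives the rest. *)
Lemma strong_convexity rho : rho < 1 -> exists2 k : R, 0 < k &
  forall w e s, `|w| <= rho -> `|e| = 1 -> 0 <= s -> `|gmove w e s| <= rho ->
    k * s ^+ 2 <= Psi (gmove w e s) - Psi w + inner (m w) e * s.
Proof.
move=> rho1; have [lam lam0 hlam] := cov_bounded mu_sphere mu_stable rho1.
pose S := 16 / ((1 - rho ^+ 2) * (1 - rho ^+ 2)).
exists (expR (- (2 * S)) * lam / 2).
  by rewrite divr_gt0// mulr_gt0// expR_gt0.
move=> w e s wr e1 s0 w'r; have w1 := le_lt_trans wr rho1.
have w'1 := le_lt_trans w'r rho1; have := potential_ge mu_sphere w1 e1 s0.
have rho0 : 0 <= rho by exact: le_trans (normr_ge0 w) wr.
have n0 : 0 < 1 - rho ^+ 2 by rewrite subr_gt0 expr_lt1.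
have nle x : `|x| <= rho -> 1 - rho ^+ 2 <= 1 - `|x| ^+ 2.
  by move=> xr; rewrite lerD2l lerN2 lerXn2r ?nnegrE.
have sS : s <= S.
  have [_ h] := gmove_dist w1 e1 s0; apply: le_trans h _; rewrite /S.
  apply: ler_pM.
  - by rewrite mulr_ge0.
  - by rewrite invr_ge0 mulr_ge0// ltW// sqr_norm_lt1.
  - have := ler_normB (gmove w e s) w; move: rho1 wr w'r; lra.
  - rewrite lef_pV2 ?posrE ?(mulr_gt0 n0 n0)//.
      by rewrite ler_pM ?nle// ltW.
    by apply: mulr_gt0; exact: sqr_norm_lt1.
have h : expR (- (2 * S)) * lam * s ^+ 2 <=
    expR (- (2 * s)) * (1 - cov mu w e e) * s ^+ 2.
  rewrite ler_wpM2r ?sqr_ge0// ler_pM ?(ltW lam0) ?(ltW (expR_gt0 _))//.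
    by rewrite ler_expR; lra.
  exact: hlam.
by move: h; lra.
Qed.

Lemma potential_min w w' : `|w| < 1 -> m w = 0 -> `|w'| < 1 -> Psi w <= Psi w'.
Proof.
move=> w1 m0 w'1; have [e0 e01] := sphere_nonempty mu_sphere.
have [e [s [e1 s0 ->]]] := gmove_exists w1 w'1 e01.
have := potential_ge mu_sphere w1 e1 s0; rewrite m0 inner0l => h.
rewrite -subr_ge0; apply: le_trans h; rewrite oppr0 mul0r add0r.
rewrite !mulr_ge0 ?sqr_ge0 ?invr_ge0 ?(ltW (expR_gt0 _))//.
rewrite -avg_1sigma_sqr//; apply: avg_ge_cst => //; first exact: bm_1sigma_sqr.
by move=> x x1; rewrite subr_ge0 sqr_le1 inner_sigma_unit.
Qed.

Lemma mean_zero_unique w w' : `|w| < 1 -> `|w'| < 1 -> m w = 0 -> m w' = 0 ->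
  w = w'.
Proof.
move=> w1 w'1 m0 m'0; have [e0 e01] := sphere_nonempty mu_sphere.
have r1 : Num.max `|w| `|w'| < 1 by rewrite gt_max w1.
have [k k0 hk] := strong_convexity r1.
have [e [s [e1 s0 w'E]]] := gmove_exists w1 w'1 e01.
have := hk w e s; rewrite -w'E !le_max !lexx orbT => /(_ isT e1 s0 isT).
rewrite m0 inner0l mul0r addr0 => h.
have hmin := potential_min w'1 m'0 w1.
have : k * s ^+ 2 <= 0 by move: h hmin; lra.
rewrite pmulr_rle0// real_exprn_even_le0 ?num_real//= => /eqP s00.
have [+ _] := gmove_dist w1 e1 s0; rewrite -w'E s00.
by rewrite normr_le0 subr_eq0 => /eqP.
Qed.

(** Coercivity confines a minimizing sequence to one ball, [potential_descent] sends its means to 0,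
    and convexity then makes it Cauchy. Its limit minimizes, and one more descent from there forces
    the mean to vanish. *)
Lemma mean_zero_exists : exists2 w, `|w| < 1 & m w = 0.
Proof.
have [e0 e01] := sphere_nonempty mu_sphere.
have [a ha] := potential_bounded_below mu_sphere mu_stable.
have [j [z [hj hz]]] : exists (j : R) (z : nat -> H),
    (forall w, [set w : H | `|w| < 1] w -> j <= Psi w) /\
    forall n, [set w : H | `|w| < 1] (z n) /\ Psi (z n) <= j + n.+1%:R^-1.
  apply: inf_sequence; last by exists a.
  by exists 0; rewrite /= normr0.
have z1 n : `|z n| < 1 by have [] := hz n.
have [rho [rho0 rho1 hrho]] := sublevel_bounded mu_sphere mu_stable (j + 1).
have zr n : `|z n| <= rho.
  apply: hrho => //; have [_ h] := hz n; apply: le_trans h _; rewrite lerD2l.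
  by rewrite invf_le1 ?ltr0n// ler1n.
have [k k0 hk] := strong_convexity rho1.
have mz n : `|m (z n)| ^+ 2 <= 2 * n.+1%:R^-1.
  have [w' w'1 h] := potential_descent (z1 n).
  have := hj w' w'1; have [_] := hz n; move: h.
  by move: (n.+1%:R^-1) => u; lra.
have [l hl] : exists l : H, forall e : R, 0 < e -> exists N, forall n,
    (N <= n)%N -> `|l - z n| <= e.
  apply: cauchy_limit => d d0.
  (* [1 + k^-1] collects the excess in value of [z p] and, divided by [k], the contribution of the
     mean at [z n]. *)
  have q0 : 0 < (k * d ^+ 2 / 2) / (1 + k^-1).
    by rewrite !divr_gt0 ?mulr_gt0 ?exprn_gt0// ltr_wpDr// invr_ge0 ltW.
  have [N hN] := eventually_invS_le q0.
  exists N => n p Nn Np.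
  have [e [s [e1 s0 zE]]] := gmove_exists (z1 n) (z1 p) e01.
  have [h1 _] := gmove_dist (z1 n) e1 s0; rewrite -zE distrC in h1.
  apply: le_trans h1 _.
  have := hk (z n) e s (zr n) e1 s0; rewrite -zE => /(_ (zr p)) h2.
  have h3 : inner (m (z n)) e <= `|m (z n)|.
    by have := inner_le (m (z n)) e; rewrite e1 mulr1.
  have h4 : inner (m (z n)) e * s <= `|m (z n)| * s by rewrite ler_wpM2r.
  have h5 : `|m (z n)| * s <= `|m (z n)| ^+ 2 / k / 2 + k * s ^+ 2 / 2.
    rewrite -subr_ge0 [leRHS](_ : _ = (`|m (z n)| - k * s) ^+ 2 / (2 * k)).
      by rewrite divr_ge0 ?sqr_ge0// mulr_ge0// ltW.
    by field; rewrite gt_eqF.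
  have h6 : `|m (z n)| ^+ 2 / k <= 2 * n.+1%:R^-1 / k.
    by rewrite ler_wpM2r ?invr_ge0 ?(ltW k0).
  have h7 := hj (z n) (z1 n); have [_ h8] := hz p.
  have := hN n Nn; have := hN p Np => h9 h10.
  have h12 : n.+1%:R^-1 / k <= (k * d ^+ 2 / 2) / (1 + k^-1) / k.
    by rewrite ler_wpM2r ?invr_ge0 ?(ltW k0).
  have h13 : (k * d ^+ 2 / 2) / (1 + k^-1) + (k * d ^+ 2 / 2) / (1 + k^-1) / k =
      k * d ^+ 2 / 2.
    by field; rewrite (gt_eqF k0) gt_eqF//; lra.
  rewrite -(@ler_pXn2r _ 2) ?nnegrE ?(ltW d0)// -(ler_pM2l k0).
  move: h2 h4 h5 h6 h7 h8 h9 h10 h12 h13.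
  move: (n.+1%:R^-1) (p.+1%:R^-1) (_ / (1 + k^-1)) => u v b.
  move: (k * s ^+ 2) (k * d ^+ 2) (`|m (z n)| * s) => c1 c2 c3.
  move: (`|m (z n)| ^+ 2 / k) (inner _ _ * s) (Psi _) (Psi _) => c4 c5 c6 c7.
  by rewrite -!mulrA; move: (u / k) (b / k) => c8 c9; lra.
have lr : `|l| <= rho.
  apply/ler_addgt0Pr => d d0; have [N hN] := hl d d0.
  have := hN N (leqnn _); have := zr N.
  have := ler_normD (z N) (l - z N); rewrite addrC subrK; lra.
have l1 := le_lt_trans lr rho1.
have n0 : 0 < 1 - rho ^+ 2 by rewrite subr_gt0 expr_lt1.
have nle x : `|x| <= rho -> 1 - rho ^+ 2 <= 1 - `|x| ^+ 2.
  by move=> xr; rewrite lerD2l lerN2 lerXn2r ?nnegrE.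
(* Half of continuity is enough: [potential_le] on the geodesic from [z n] to [l], whose length
   tends to 0. *)
have Pl : Psi l <= j.
  apply/ler_addgt0Pr => d d0.
  pose d' := Num.min 1 (d / 4).
  have d'0 : 0 < d' by rewrite lt_min ltr01 divr_gt0.
  have [h1 h2] : d' <= 1 /\ d' <= d / 4 by rewrite !ge_min !lexx orbT.
  pose q := d' * ((1 - rho ^+ 2) * (1 - rho ^+ 2)) / 8.
  have q0 : 0 < q by rewrite divr_gt0// mulr_gt0// mulr_gt0.
  have [N1 hN1] := hl q q0; have [N2 hN2] := eventually_invS_le (divr_gt0 d0 (ltr0Sn R 1)).
  pose n := maxn N1 N2; have h3 := hN1 n (leq_maxl _ _).
  have h4 := hN2 n (leq_maxr _ _).
  have [e [s [e1 s0 lE]]] := gmove_exists (z1 n) l1 e01.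
  have [_ h5] := gmove_dist (z1 n) e1 s0; rewrite -lE in h5.
  have sd : s <= d'.
    apply: le_trans h5 _; rewrite ler_pdivrMr ?mulr_gt0 ?sqr_norm_lt1//.
    apply: (@le_trans _ _ (d' * ((1 - rho ^+ 2) * (1 - rho ^+ 2)))).
      by move: h3; rewrite /q; lra.
    by rewrite ler_wpM2l ?(ltW d'0)// ler_pM ?nle// ltW.
  have := potential_le mu_sphere (z1 n) e1 s0; rewrite -lE => h6.
  have h7 : - inner (m (z n)) e <= 1.
    have := inner_ge (m (z n)) e; rewrite e1 mulr1.
    by have := mean_norm mu_sphere (z1 n); lra.
  have h8 : - inner (m (z n)) e * s <= s.
    by rewrite -[leRHS]mul1r ler_wpM2r.
  have h9 : s ^+ 2 <= s by rewrite expr2 ler_piMl//; exact: le_trans h1.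
  have [_ h10] := hz n.
  by move: h2 h4 sd h6 h8 h9 h10; move: (n.+1%:R^-1) => u; lra.
exists l => //; have [w' w'1 h] := potential_descent l1.
have h2 := hj w' w'1; apply/eqP.
rewrite -normr_eq0 -sqrf_eq0 eq_le sqr_ge0 andbT.
by move: h h2 Pl; lra.
Qed.

(** * Mean, potential gap and distance to the minimizer *)

Section NearMinimizer.
Variable ws : H.
Hypotheses (ws1 : `|ws| < 1) (mws : m ws = 0).

Lemma mean_le_potential w : `|w| < 1 -> `|m w| ^+ 2 / 2 <= Psi w - Psi ws.
Proof.
move=> w1; have [w' w'1 h] := potential_descent w1.
by have := potential_min ws1 mws w'1; lra.
Qed.

(** On the geodesic from [w] to [ws] the potential does not rise overall, so strong convexity leaves
    [k s^2 <= |m w| s]. *)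
Lemma dist_le_mean rho : rho < 1 -> exists2 k : R, 0 < k &
  forall w, `|w| <= rho -> k * `|w - ws| <= `|m w|.
Proof.
move=> rho1; have [e0 e01] := sphere_nonempty mu_sphere.
have r'1 : Num.max rho `|ws| < 1 by rewrite gt_max rho1.
have [k k0 hk] := strong_convexity r'1; exists k => // w wr.
have w1 := le_lt_trans wr rho1.
have [e [s [e1 s0 wsE]]] := gmove_exists w1 ws1 e01.
have := hk w e s; rewrite -wsE !le_max wr lexx orbT => /(_ isT e1 s0 isT) h1.
have h2 := potential_min ws1 mws w1.
have h3 : inner (m w) e <= `|m w| by have := inner_le (m w) e; rewrite e1 mulr1.
have h4 : inner (m w) e * s <= `|m w| * s by rewrite ler_wpM2r.
have [h5 _] := gmove_dist w1 e1 s0; rewrite -wsE distrC in h5.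
apply: (@le_trans _ _ (k * s)); first by rewrite ler_wpM2l// ltW.
have [->|sn0] := eqVneq s 0; first by rewrite mulr0.
have sp : 0 < s by rewrite lt_neqAle eq_sym sn0.
by rewrite -(ler_pM2r sp) -mulrA -expr2; move: h1 h2 h4; lra.
Qed.

(** The potential gap dominates [|m w|^2 / 2] and is itself at most [s^2 / 2], since the slope at
    [ws] is zero. *)
Lemma mean_le_dist rho : rho < 1 -> exists2 C : R, 0 < C &
  forall w, `|w| <= rho -> `|m w| <= C * `|w - ws|.
Proof.
move=> rho1; have [e0 e01] := sphere_nonempty mu_sphere.
have [r0|r0] := ltP rho 0.
  by exists 1 => // w wr; have := le_lt_trans wr r0; rewrite normr_lt0.
have n0 : 0 < 1 - rho ^+ 2 by rewrite subr_gt0 expr_lt1.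
have n1 := sqr_norm_lt1 ws1.
exists (8 / ((1 - `|ws| ^+ 2) * (1 - rho ^+ 2))).
  by rewrite divr_gt0// mulr_gt0.
move=> w wr; have w1 := le_lt_trans wr rho1.
have [e [s [e1 s0 wE]]] := gmove_exists ws1 w1 e01.
have [_ h1] := gmove_dist ws1 e1 s0; rewrite -wE in h1.
have h2 := potential_le mu_sphere ws1 e1 s0; rewrite -wE mws inner0l in h2.
have h3 := mean_le_potential w1.
have : `|m w| ^+ 2 <= s ^+ 2 by move: h2 h3; lra.
rewrite ler_pXn2r ?nnegrE// => ms; apply: le_trans ms (le_trans h1 _).
rewrite -mulrA [leRHS]mulrAC -[leRHS]mulrA ler_wpM2l//.
rewrite ler_wpM2l// lef_pV2 ?posrE ?(mulr_gt0 n1) ?sqr_norm_lt1//.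
by rewrite ler_wpM2l ?(ltW n1)// lerD2l lerN2 lerXn2r ?nnegrE.
Qed.

End NearMinimizer.

(** * The mean at a shifted point *)

Lemma bm_sigma_comp w z y : `|w| < 1 -> `|z| < 1 ->
  bounded_mfun (fun x => inner (sigma z (sigma w x)) y).
Proof.
move=> w1 z1; have bs u : bounded_mfun (fun x => inner (sigma w x) u).
  exact: bm_sigma.
have b1 : bounded_mfun (fun x => 1 - 2 * inner (sigma w x) z + `|z| ^+ 2).
  by apply: bmD; [apply: bmB; [exact: bm_cst|exact: bmZ]|exact: bm_cst].
apply: (@eq_bm _ _ (fun x => (1 - 2 * inner (sigma w x) z + `|z| ^+ 2)^-1 *
  ((1 - `|z| ^+ 2) * inner (sigma w x) y -
   (2 - 2 * inner (sigma w x) z) * inner z y))).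
  move=> x; rewrite inE => x1; rewrite [in RHS]inner_sigma /sden.
  rewrite (sigma_sphere w1 x1) expr1n mulr1 (innerC z (sigma w x)).
  by rewrite (_ : 1 + 1 = 2 :> R).
apply: bmM.
  apply: (@bmV _ _ _ ((1 - `|z|) ^+ 2)) => //.
    by rewrite exprn_gt0// subr_gt0.
  move=> x x1; have := sden_ge z (sigma w x).
  by rewrite /sden (sigma_sphere w1 x1) expr1n !mulr1 (innerC z).
apply: bmB; first exact: bmZ.
apply: bmM; last exact: bm_cst.
by apply: bmB; [exact: bm_cst|exact: bmZ].
Qed.

Lemma bfield_sigma_comp w z : `|w| < 1 -> `|z| < 1 ->
  bounded_field (fun x => sigma z (sigma w x)).
Proof.
move=> w1 z1; split => [y|]; first exact: bm_sigma_comp.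
by exists 1 => x x1; rewrite !sigma_sphere.
Qed.

(** The squared norm of a mean is a double average of inner products, so [inner_sigma_comp] applies
    under the averages and the isometry itself stays implicit. *)
Lemma mean_move_norm w z : `|w| < 1 -> `|z| < 1 ->
  `|m (sigma (- w) z)| = `|wavg mu (fun x => sigma z (sigma w x))|.
Proof.
move=> w1 z1; have w'1 : `|sigma (- w) z| < 1 by rewrite sigma_ball// normrN.
apply/eqP; rewrite -(@eqrXn2 _ 2)// -!inner_norm inner_mean//.
rewrite wavgE//; last exact: bfield_sigma_comp.
apply/eqP; apply: eq_avg => x x1.
rewrite innerC inner_mean// innerC wavgE//; last exact: bfield_sigma_comp.
by apply: eq_avg => x' x'1; rewrite inner_sigma_comp// innerC.
Qed.

(** Expands the shift in its parameter at 0. The exact remainder is [th^2 / D] times a vector of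
    norm at most [8 + 4], and [D >= 1/4] for [th <= 1/2], whence 48. *)
Lemma sigma_expand (th : R) y e u : `|e| = 1 -> `|y| = 1 -> 0 <= th -> th <= 2^-1 ->
  inner (sigma (th *: e) y) u <= inner y u +
    2 * th * (inner y e * inner y u - inner e u) + 48 * th ^+ 2 * `|u|.
Proof.
move=> e1 y1 th0 th2; set q := inner y e.
have /andP[q1 q2] : -1 <= q <= 1 by exact: inner_unit.
pose D := 1 - 2 * (th * q) + th ^+ 2.
have D4 : 4^-1 <= D.
  have h : th * q <= th * 1 by rewrite ler_wpM2l.
  have : 2^-1 * 2^-1 <= (1 - th) * (1 - th) by rewrite ler_pM//; lra.
  by rewrite /D expr2; lra.
have D0 : 0 < D by lra.
have E : inner (sigma (th *: e) y) u - (inner y u +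
    2 * th * (q * inner y u - inner e u)) =
    th ^+ 2 / D * ((-2 + 4 * q ^+ 2 - 2 * q * th) * inner y u +
      (2 * th - 2 * q) * inner e u).
  rewrite inner_sigma /sden normrZ e1 y1 mulr1 real_normK ?num_real//.
  rewrite expr1n mulr1 !innerZl (innerC e y) -/q -/D.
  by move: (lt0r_neq0 D0); rewrite /D => ?; field.
rewrite -lerBlDl E.
have h1 : (-2 + 4 * q ^+ 2 - 2 * q * th) * inner y u <= 8 * `|u|.
  apply: le_trans (ler_norm _) _; rewrite normrM; apply: ler_pM => //.
    have q21 : q ^+ 2 <= 1 by rewrite sqr_le1 q1.
    have q20 := sqr_ge0 q.
    have h : `|q * th| <= 1 * 1 by rewrite normrM ler_pM// ler_norml; apply/andP; split; lra.
    by move: h; rewrite !ler_norml => /andP[h2 h3]; apply/andP; split; lra.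
  by have := cauchy_schwarz y u; rewrite y1 mul1r.
have h2 : (2 * th - 2 * q) * inner e u <= 4 * `|u|.
  apply: le_trans (ler_norm _) _; rewrite normrM; apply: ler_pM => //.
    by rewrite ler_norml; apply/andP; split; lra.
  by have := cauchy_schwarz e u; rewrite e1 mul1r.
have h3 : th ^+ 2 / D <= 4 * th ^+ 2.
  rewrite mulrC ler_wpM2r ?sqr_ge0//.
  by rewrite -[leRHS]invrK lef_pV2 ?posrE.
apply: (@le_trans _ _ (th ^+ 2 / D * (12 * `|u|))).
  by rewrite ler_wpM2l ?divr_ge0 ?sqr_ge0 ?(ltW D0)//; lra.
apply: (@le_trans _ _ (4 * th ^+ 2 * (12 * `|u|))).
  by rewrite ler_wpM2r// mulr_ge0.
by rewrite [leLHS](_ : _ = 48 * th ^+ 2 * `|u|)//; ring.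
Qed.

Lemma cov_norm w e u : `|w| < 1 -> `|e| = 1 -> `|cov mu w e u| <= `|u|.
Proof.
move=> w1 e1; apply: avg_norm_le => //; first by apply: bmM; exact: bm_sigma.
move=> x x1; rewrite normrM.
have h1 := cauchy_schwarz (sigma w x) e; have h2 := cauchy_schwarz (sigma w x) u.
rewrite sigma_sphere// e1 mulr1 in h1; rewrite sigma_sphere// mul1r in h2.
by rewrite -[leRHS]mul1r ler_pM.
Qed.

(** * A single damped Newton step *)

Section NewtonStep.
Variables (alpha c1 c2 : R).
Hypotheses (alpha0 : 0 <= alpha) (c10 : 0 < c1) (c12 : c1 < c2) (c21 : c2 < 1).

(** The value of the merit function at 0 has been subtracted, and [r * - inner (m w) e] is its slope
    there. *)
Definition armijo w e r t :=
  avg mu (fun x => phi (inner (sigma w x) e) (t * r)) <=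
    c1 * t * (r * - inner (m w) e).

Definition weak_wolfe w e r t := c2 * (r * - inner (m w) e) <=
    r * avg mu (fun x => dphi (inner (sigma w x) e) (t * r)).

(* [r *: e] is the Newton direction at [w], seen from the origin through
   [sigma w] and measured in hyperbolic length. *)
Definition newton_dir w e r := [/\ `|e| = 1, 0 <= r & forall y,
  r * ((1 + alpha * `|m w| ^+ 2) * inner e y - cov mu w e y) = inner (m w) y].

(** The common form of a step of either algorithm; the convergence analysis refers to this relation
    alone. *)
Definition newton_step w w' := exists e r t,
  [/\ newton_dir w e r, 0 < t, armijo w e r t /\ weak_wolfe w e r t,
      armijo w e r 1 /\ weak_wolfe w e r 1 -> t = 1 & w' = gmove w e (t * r)].

Section Direction.
Variables (w e : H) (r lam : R).
Hypotheses (w1 : `|w| < 1) (hd : newton_dir w e r) (lam0 : 0 < lam)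
  (hlam : lam <= 1 - cov mu w e e).

Lemma newton_dir_mean :
  inner (m w) e = r * (1 + alpha * `|m w| ^+ 2 - cov mu w e e).
Proof. by have [e1 _ h] := hd; rewrite -h inner_norm e1 expr1n mulr1. Qed.

Lemma newton_dir_ge : r * lam <= inner (m w) e.
Proof.
have [_ r0 _] := hd; rewrite newton_dir_mean ler_wpM2l//.
have := mulr_ge0 alpha0 (sqr_ge0 `|m w|); move: hlam; lra.
Qed.

Lemma newton_dir_le : r * lam <= `|m w|.
Proof.
have [e1 _ _] := hd; apply: le_trans newton_dir_ge _.
by have := inner_le (m w) e; rewrite e1 mulr1.
Qed.

(** The regularized operator has norm at most [(1 + alpha) + 1], because [|m w| <= 1]. *)
Lemma mean_le_newton_dir : `|m w| <= (2 + alpha) * r.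
Proof.
have [e1 r0 h] := hd; apply: norm_le_inner => [|y].
  by rewrite mulr_ge0// addr_ge0.
rewrite -h [(2 + alpha) * r]mulrC -mulrA ler_wpM2l//.
have m1 := mean_norm mu_sphere w1.
have m2 : `|m w| ^+ 2 <= 1 by rewrite expr_le1.
have h1 : (1 + alpha * `|m w| ^+ 2) * inner e y <= (1 + alpha) * `|y|.
  apply: le_trans (ler_norm _) _; rewrite normrM; apply: ler_pM => //.
    rewrite ger0_norm ?addr_ge0 ?mulr_ge0 ?sqr_ge0// lerD2l.
    by rewrite -[leRHS]mulr1 ler_wpM2l.
  by have := cauchy_schwarz e y; rewrite e1 mul1r.
have := cov_norm y w1 e1; rewrite ler_norml => /andP[h2 _].
by move: h1 h2; lra.
Qed.

(** The slope rises at most at unit rate, so the Wolfe condition forces [(1 - c2) * p <= t * r] with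
    [p] the initial rate of descent. The Armijo condition then yields a decrease by
    [c1 * (1 - c2) * p^2], and [p >= r * lam >= lam / (2 + alpha) * |m w|]. *)
Lemma armijo_decrease t : 0 < t -> armijo w e r t -> weak_wolfe w e r t ->
  Psi (gmove w e (t * r)) <=
  Psi w - c1 * (1 - c2) * (lam / (2 + alpha)) ^+ 2 * `|m w| ^+ 2.
Proof.
move=> t0 ha hw; have [e1 r0 _] := hd.
rewrite potential_gmove// lerD2l; apply: le_trans ha _.
have hge := newton_dir_ge; set p := inner (m w) e in hge *.
have p0 : 0 <= p by apply: le_trans hge; rewrite mulr_ge0// ltW.
have key : (1 - c2) * p <= t * r \/ p = 0.
  have [r00|rn0] := eqVneq r 0.
    by right; rewrite /p newton_dir_mean r00 mul0r.
  left; have rp : 0 < r by rewrite lt_neqAle eq_sym rn0.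
  have s0 : 0 <= t * r by rewrite mulr_ge0// ltW.
  have := avg_dphi_le mu_sphere w1 e1 s0; rewrite -/p => h.
  move: hw; rewrite /weak_wolfe -/p mulrCA ler_pM2l// => h2.
  by move: h h2; lra.
have step : c1 * t * (r * - p) <= - (c1 * (1 - c2) * p ^+ 2).
  case: key => [h|->]; last by rewrite oppr0 !mulr0 expr0n/= mulr0 oppr0.
  rewrite [leLHS](_ : _ = - (c1 * (p * (t * r)))); last by ring.
  rewrite lerN2 -[leLHS]mulrA ler_wpM2l ?(ltW c10)//.
  rewrite [leLHS](_ : _ = p * ((1 - c2) * p)); last by ring.
  by rewrite ler_wpM2l.
apply: le_trans step _; rewrite lerN2 -[leLHS]mulrA.
rewrite ler_wpM2l ?mulr_ge0 ?subr_ge0 ?(ltW c10) ?(ltW c21)//.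
rewrite -exprMn lerXn2r ?nnegrE ?mulr_ge0 ?invr_ge0 ?addr_ge0 ?(ltW lam0)//.
apply: le_trans hge; rewrite mulrAC ler_pdivrMr; last by move: alpha0; lra.
by have := ler_wpM2l (ltW lam0) mean_le_newton_dir; lra.
Qed.

(** With [b = 1 - cov] and [g = alpha * |m w|^2] the slope is [- r (b + g)]. The unit step changes
    the merit by at most [- r^2 (b / 2 + g) + r^3 / 3], against the required [- c1 r^2 (b + g)]: the
    margin [(1/2 - c1) b] pays for [r / 3]. The new slope is at least [- r (g + r)], which settles
    the Wolfe condition. *)
Lemma unit_step_accepted :
  alpha * `|m w| ^+ 2 + r <= c2 * lam -> r <= 3 * (2^-1 - c1) * lam ->
  c1 < 2^-1 -> armijo w e r 1 /\ weak_wolfe w e r 1.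
Proof.
move=> hr1 hr2 c1h; have [e1 r0 _] := hd.
have hm := newton_dir_mean.
have hb := hlam.
set p := inner (m w) e in hm; set b := 1 - cov mu w e e in hb.
have {}hm : p = r * (b + alpha * `|m w| ^+ 2) by rewrite hm /b; ring.
set g := alpha * `|m w| ^+ 2 in hr1 hm.
have g0 : 0 <= g by rewrite mulr_ge0 ?sqr_ge0.
have c1p : 0 <= 2^-1 - c1 by rewrite subr_ge0 ltW.
split; rewrite /armijo /weak_wolfe mul1r.
  apply: le_trans (avg_phi_taylor mu_sphere w1 e1 r0) _.
  rewrite -/p -/b hm mulr1 -subr_ge0.
  rewrite [leRHS](_ : _ = r ^+ 2 * ((2^-1 - c1) * b + (1 - c1) * g - r / 3)).
    rewrite mulr_ge0 ?sqr_ge0//.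
    have h1 : (2^-1 - c1) * lam <= (2^-1 - c1) * b by rewrite ler_wpM2l.
    have h2 : 0 <= (1 - c1) * g by rewrite mulr_ge0//; lra.
    by move: h1 h2 hr2; lra.
  by field.
rewrite mulrCA ler_wpM2l//.
apply: le_trans _ (avg_dphi_ge mu_sphere w1 e1 r0); rewrite -/p -/b hm -subr_ge0.
rewrite [leRHS](_ : _ = r * (c2 * b + c2 * g - (g + r))); last by ring.
rewrite mulr_ge0//.
have c20 : 0 <= c2 by move: c10 c12; lra.
have h1 : c2 * lam <= c2 * b by rewrite ler_wpM2l.
have h2 : 0 <= c2 * g by rewrite mulr_ge0.
by move: h1 h2 hr1; lra.
Qed.

(* The Newton equation cancels the first-order term of the mean of the shifted
   measure. *)
Lemma unit_step_mean : r <= 1 ->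
  `|m (gmove w e r)| <= (13 + alpha * (2 + alpha)) * r ^+ 2.
Proof.
move=> r1; have [e1 r0 h] := hd.
rewrite /gmove mean_move_norm ?norm_th//; set t := th r.
have t0 : 0 <= t by exact: th_ge0.
have tr : t <= r / 2 by exact: th_le.
have t2 : t <= 2^-1 by lra.
have := th_taylor r0; rewrite -/t => tt.
have K0 : 0 <= (13 + alpha * (2 + alpha)) * r ^+ 2.
  by rewrite mulr_ge0 ?sqr_ge0// addr_ge0// mulr_ge0// addr_ge0.
apply: norm_le_inner => // u; rewrite wavgE//; last first.
  by apply: bfield_sigma_comp => //; exact: norm_th.
have bs v : bounded_mfun (fun x => inner (sigma w x) v) by exact: bm_sigma.
have bc : bounded_mfun (fun x => inner (sigma w x) e * inner (sigma w x) u).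
  exact: bmM.
pose cst := - (2 * t * inner e u) + 48 * t ^+ 2 * `|u|.
have b2 : bounded_mfun (fun x => 2 * t * (inner (sigma w x) e * inner (sigma w x) u)).
  exact: bmZ.
have b3 : bounded_mfun (fun x => inner (sigma w x) u +
    2 * t * (inner (sigma w x) e * inner (sigma w x) u)) by exact: bmD.
have := @le_avg R H mu (fun x => inner (sigma (t *: e) (sigma w x)) u)
  (fun x => inner (sigma w x) u +
    2 * t * (inner (sigma w x) e * inner (sigma w x) u) + cst).
move=> /(_ (bm_sigma_comp _ _ _) (bmD b3 (bm_cst _))) => le.
apply: (le_trans (le _ _ _)) => //; first exact: norm_th.
  move=> x x1; have := @sigma_expand t (sigma w x) e u e1 (sigma_sphere w1 x1) t0 t2.
  by rewrite /cst; lra.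
rewrite avgD//; last exact: bm_cst.
rewrite avgD// avgZ// avg_cst// -inner_mean// -/(cov mu w e u) /cst.
have hu := h u; have cn := cov_norm u w1 e1.
have en : `|inner e u| <= `|u| by have := cauchy_schwarz e u; rewrite e1 mul1r.
have h1 : (2 * t - r) * (cov mu w e u - inner e u) <= r ^+ 2 * `|u|.
  apply: le_trans (ler_norm _) _; rewrite normrM.
  have k1 : `|2 * t - r| <= r ^+ 2 / 2.
    rewrite (_ : 2 * t - r = 2 * (t - r / 2)); last by field.
    by rewrite normrM ger0_norm//; move: tt; rewrite exprMn exprVn; lra.
  have k2 : `|cov mu w e u - inner e u| <= 2 * `|u|.
    by apply: le_trans (ler_normB _ _) _; lra.
  apply: le_trans (ler_pM _ _ k1 k2) _ => //.
  by rewrite [leLHS](_ : _ = r ^+ 2 * `|u|)//; field.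
have h2 : r * (alpha * `|m w| ^+ 2) * inner e u <= alpha * (2 + alpha) * r ^+ 2 * `|u|.
  apply: le_trans (ler_norm _) _; rewrite normrM.
  apply: ler_pM => //; rewrite ger0_norm; last first.
    by rewrite mulr_ge0// mulr_ge0// sqr_ge0.
  have m1 := mean_norm mu_sphere w1.
  have k : `|m w| ^+ 2 <= (2 + alpha) * r.
    rewrite expr2; apply: le_trans mean_le_newton_dir.
    by rewrite ler_piMl.
  have := ler_wpM2l (mulr_ge0 r0 alpha0) k.
  by rewrite expr2; lra.
have h3 : 48 * t ^+ 2 * `|u| <= 12 * r ^+ 2 * `|u|.
  rewrite ler_wpM2r//.
  have : t * t <= (r / 2) * (r / 2) by rewrite ler_pM.
  by rewrite !expr2; lra.
(* Inserting the Newton equation leaves three errors: the regularization, with constant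
   [alpha * (2 + alpha)]; [2 * t] in place of [r], with constant 1; and the remainder of
   [sigma_expand], with constant 12. *)
have -> : inner (m w) u + 2 * t * cov mu w e u +
    (- (2 * t * inner e u) + 48 * t ^+ 2 * `|u|) =
  r * (alpha * `|m w| ^+ 2) * inner e u +
  (2 * t - r) * (cov mu w e u - inner e u) + 48 * t ^+ 2 * `|u|.
  by rewrite -hu; ring.
by move: h1 h2 h3; lra.
Qed.

End Direction.

End NewtonStep.

End Barycenter.

(** * Uniform first-order expansions *)

Section UniformTaylor.
Set Implicit Arguments.
Unset Strict Implicit.
Context {R : realType}.
Implicit Types (V : normedModType R) (I : Type).

(* First-order expansion at 0 of a family of curves, uniform over the indices
   in [P]. *)
Definition utaylor I V (P : I -> Prop) (f : I -> R -> V) (f0 f1 : I -> V) :=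
  exists K r : R, [/\ 0 <= K, 0 < r, r <= 1 &
    forall i, P i -> [/\ `|f0 i| <= K, `|f1 i| <= K &
      forall d, `|d| <= r -> `|f i d - f0 i - d *: f1 i| <= K * d ^+ 2]].

Section Closure.
Variables (I : Type) (P : I -> Prop).

Lemma utaylor_eq V (f g : I -> R -> V) (f0 f1 g0 g1 : I -> V) :
  (forall i d, P i -> f i d = g i d) -> (forall i, P i -> f0 i = g0 i) ->
  (forall i, P i -> f1 i = g1 i) ->
  utaylor P f f0 f1 -> utaylor P g g0 g1.
Proof.
move=> fg fg0 fg1 [K [r [K0 r0 r1 h]]]; exists K, r; split => // i Pi.
by have [h0 h1 h2] := h i Pi; rewrite -fg0// -fg1//; split => // d dr; rewrite -fg// h2.
Qed.

Lemma utaylor_affine V (a b : I -> V) (M : R) :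
  (forall i, P i -> `|a i| <= M /\ `|b i| <= M) ->
  utaylor P (fun i d => a i + d *: b i) a b.
Proof.
move=> h; exists `|M|, 1; split => // i Pi; have [ha hb] := h i Pi; split.
- exact: le_trans ha (ler_norm _).
- exact: le_trans hb (ler_norm _).
- move=> d _; rewrite (addrC (a i)) addrK subrr normr0.
  by rewrite mulr_ge0// sqr_ge0.
Qed.

Lemma utaylorD V (f g : I -> R -> V) f0 f1 g0 g1 :
  utaylor P f f0 f1 -> utaylor P g g0 g1 ->
  utaylor P (fun i d => f i d + g i d) (fun i => f0 i + g0 i)
    (fun i => f1 i + g1 i).
Proof.
move=> [K [r [K0 r0 r1 hf]]] [L [s [L0 s0 s1 hg]]].
exists (K + L), (Num.min r s); split; rewrite ?addr_ge0 ?lt_min ?r0 ?ge_min ?r1//.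
move=> i Pi; have [a0 a1 a2] := hf i Pi; have [b0 b1 b2] := hg i Pi; split.
- by apply: le_trans (ler_normD _ _) _; exact: lerD.
- by apply: le_trans (ler_normD _ _) _; exact: lerD.
move=> d; rewrite le_min => /andP[dr ds].
have -> : f i d + g i d - (f0 i + g0 i) - d *: (f1 i + g1 i) =
    (f i d - f0 i - d *: f1 i) + (g i d - g0 i - d *: g1 i).
  by rewrite scalerDr !opprD [LHS](AC (2*2*2) (1*3*5*(2*4*6))).
by apply: le_trans (ler_normD _ _) _; rewrite mulrDl lerD ?a2 ?b2.
Qed.

Lemma utaylorZ V (f : I -> R -> R) (g : I -> R -> V) f0 f1 g0 g1 :
  utaylor P f f0 f1 -> utaylor P g g0 g1 ->
  utaylor P (fun i d => f i d *: g i d) (fun i => f0 i *: g0 i)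
    (fun i => f0 i *: g1 i + f1 i *: g0 i).
Proof.
move=> [K [r [K0 r0 r1 hf]]] [L [s [L0 s0 s1 hg]]].
exists (6 * (K * L)), (Num.min r s); split; rewrite ?mulr_ge0 ?lt_min ?r0 ?ge_min ?r1//.
have KL : 0 <= K * L by rewrite mulr_ge0.
move=> i Pi; have [a0 a1 a2] := hf i Pi; have [b0 b1 b2] := hg i Pi.
have p00 : `|f0 i| * `|g0 i| <= K * L by rewrite ler_pM.
have p01 : `|f0 i| * `|g1 i| <= K * L by rewrite ler_pM.
have p10 : `|f1 i| * `|g0 i| <= K * L by rewrite ler_pM.
have p11 : `|f1 i| * `|g1 i| <= K * L by rewrite ler_pM.
split.
- by rewrite normrZ; lra.
- by apply: le_trans (ler_normD _ _) _; rewrite !normrZ; lra.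
move=> d; rewrite le_min => /andP[dr ds].
have d1 : `|d| <= 1 by exact: le_trans dr r1.
have d2 : d ^+ 2 <= 1 by rewrite -(real_normK (num_real d)) expr_le1.
(* The three products are bounded by 3, 2 and 1 times [K * L * d ^+ 2], whence the constant 6. *)
have -> : f i d *: g i d - f0 i *: g0 i - d *: (f0 i *: g1 i + f1 i *: g0 i) =
    (f i d - f0 i - d * f1 i) *: g i d +
    ((f0 i + d * f1 i) *: (g i d - g0 i - d *: g1 i) +
     (d ^+ 2 * f1 i) *: g1 i).
  have E1 : f i d *: g i d = (f i d - f0 i - d * f1 i) *: g i d +
      (f0 i + d * f1 i) *: (g i d - g0 i - d *: g1 i) +
      (f0 i + d * f1 i) *: (g0 i + d *: g1 i).
    have -> : g i d - g0 i - d *: g1 i = g i d - (g0 i + d *: g1 i).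
      by rewrite opprD addrA.
    rewrite scalerBr -[RHS]addrA subrK -scalerDl; congr (_ *: _); ring.
  have E2 : (f0 i + d * f1 i) *: (g0 i + d *: g1 i) = f0 i *: g0 i +
      (d *: (f0 i *: g1 i + f1 i *: g0 i) + (d ^+ 2 * f1 i) *: g1 i).
    rewrite scalerDl !scalerDr !scalerA (mulrC d (f0 i)) -addrA; congr (_ + _).
    by rewrite addrA; congr (_ + _ *: _); ring.
  rewrite E1 E2; apply/eqP; rewrite !subr_eq; apply/eqP.
  by rewrite [LHS](AC (2*(1*2)) (1*(2*5)*4*3)).
have ga : `|g i d| <= 3 * L.
  rewrite -[g i d](subrK (g0 i)) -[X in X + g0 i](subrK (d *: g1 i)).
  have h1 : `|d *: g1 i| <= L by rewrite normrZ -[leRHS]mul1r ler_pM.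
  have h2 : `|g i d - g0 i - d *: g1 i| <= L.
    by apply: le_trans (b2 d ds) _; rewrite -[leRHS]mulr1 ler_wpM2l.
  apply: le_trans (ler_normD _ _) _; have := ler_normD (g i d - g0 i - d *: g1 i) (d *: g1 i).
  lra.
have fa : `|f0 i + d * f1 i| <= 2 * K.
  have h1 : `|d * f1 i| <= K by rewrite normrM -[leRHS]mul1r ler_pM.
  by apply: le_trans (ler_normD _ _) _; lra.
have h1 : `|f i d - f0 i - d * f1 i| * `|g i d| <= K * d ^+ 2 * (3 * L).
  by rewrite ler_pM ?a2.
have h2 : `|f0 i + d * f1 i| * `|g i d - g0 i - d *: g1 i| <= 2 * K * (L * d ^+ 2).
  by rewrite ler_pM ?b2.
have h3 : `|d ^+ 2 * f1 i| * `|g1 i| <= d ^+ 2 * (K * L).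
  by rewrite normrM -mulrA (ger0_norm (sqr_ge0 d)) ler_wpM2l ?sqr_ge0.
apply: le_trans (ler_normD _ _) _.
rewrite normrZ; apply: le_trans (lerD h1 (ler_normD _ _)) _.
rewrite (normrZ (f0 i + d * f1 i)) (normrZ (d ^+ 2 * f1 i)).
by move: h2 h3; lra.
Qed.

Lemma utaylorV (f : I -> R -> R) f0 f1 (c : R) : 0 < c ->
  (forall i, P i -> c <= f0 i) -> utaylor P f f0 f1 ->
  utaylor P (fun i d => (f i d)^-1) (fun i => (f0 i)^-1)
    (fun i => - (f1 i / f0 i ^+ 2)).
Proof.
move=> c0 hc [K [r [K0 r0 r1 hf]]].
(* On this radius the function stays above [c / 2], so its inverse stays bounded. *)
have q0 : 0 < c / (4 * (K + 1)) by rewrite divr_gt0// mulr_gt0//; lra.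
have c2 : 0 < c ^+ 2 by rewrite exprn_gt0.
have c3 : 0 < c ^+ 3 by rewrite exprn_gt0.
exists (6 * K ^+ 2 / c ^+ 3 + c^-1 + K / c ^+ 2), (Num.min r (c / (4 * (K + 1)))).
have t1 : 0 <= 6 * K ^+ 2 / c ^+ 3 by rewrite divr_ge0 ?mulr_ge0 ?sqr_ge0// ltW.
have t2 : 0 <= c^-1 by rewrite invr_ge0 ltW.
have t3 : 0 <= K / c ^+ 2 by rewrite divr_ge0// ltW.
split; rewrite ?addr_ge0 ?lt_min ?r0 ?ge_min ?r1//.
move=> i Pi; have [a0 a1 a2] := hf i Pi; have ci := hc i Pi.
have f00 : 0 < f0 i by exact: lt_le_trans ci.
split.
- have : `|(f0 i)^-1| <= c^-1.
    by rewrite gtr0_norm ?invr_gt0// lef_pV2 ?posrE.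
  by lra.
- have : `|- (f1 i / f0 i ^+ 2)| <= K / c ^+ 2.
    rewrite normrN normrM normfV ler_pM// lef_pV2 ?posrE ?normr_gt0 ?expf_neq0 ?gt_eqF//.
    by rewrite ger0_norm ?sqr_ge0// lerXn2r ?nnegrE ?(ltW c0) ?(ltW f00).
  by lra.
move=> d; rewrite le_min => /andP[dr dq].
have d1 : `|d| <= 1 by exact: le_trans dr r1.
have := a2 d dr; set rho := f i d - f0 i - d *: f1 i => hrho.
have fE : f i d = f0 i + d * f1 i + rho by rewrite /rho /GRing.scale/=; ring.
have dd : d ^+ 2 <= `|d|.
  by rewrite -(real_normK (num_real d)) expr2 ler_piMl.
have hd : `|d * f1 i| <= `|d| * K by rewrite normrM ler_wpM2l.
have hrho2 : `|rho| <= K * `|d| by apply: le_trans hrho _; rewrite ler_wpM2l.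
have hq : `|d| * (4 * (K + 1)) <= c by rewrite -ler_pdivlMr//; lra.
have fc : c / 2 <= f i d.
  rewrite fE; move: hd hrho2; rewrite !ler_norml => /andP[h1 _] /andP[h2 _].
  have h3 : 0 <= `|d| by [].
  by move: hq; lra.
have fd0 : 0 < f i d by apply: lt_le_trans fc; rewrite divr_gt0.
have -> : (f i d)^-1 - (f0 i)^-1 - d *: - (f1 i / f0 i ^+ 2) =
    (- (rho * f0 i) + d ^+ 2 * f1 i ^+ 2 + d * f1 i * rho) / (f i d * f0 i ^+ 2).
  rewrite /GRing.scale/=; have -> : rho = f i d - f0 i - d * f1 i by [].
  by field; rewrite !gt_eqF.
have den : (f i d * f0 i ^+ 2)^-1 <= 2 / c ^+ 3.
  have -> : 2 / c ^+ 3 = (c / 2 * c ^+ 2)^-1 by field; rewrite gt_eqF.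
  rewrite lef_pV2 ?posrE ?mulr_gt0 ?exprn_gt0//.
  by apply: ler_pM => //; rewrite ?sqr_ge0 ?divr_ge0 ?(ltW c0)// lerXn2r ?nnegrE// ltW.
have num : `|- (rho * f0 i) + d ^+ 2 * f1 i ^+ 2 + d * f1 i * rho| <=
    3 * K ^+ 2 * d ^+ 2.
  have h1 : `|rho * f0 i| <= K * d ^+ 2 * K by rewrite normrM ler_pM.
  have h2 : `|d ^+ 2 * f1 i ^+ 2| <= d ^+ 2 * K ^+ 2.
    rewrite normrM !ger0_norm ?sqr_ge0// ler_wpM2l ?sqr_ge0//.
    by rewrite -(real_normK (num_real (f1 i))) lerXn2r ?nnegrE.
  have h3 : `|d * f1 i * rho| <= K * (K * d ^+ 2).
    rewrite normrM ler_pM//; apply: le_trans hd _.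
    by rewrite -[leRHS]mul1r ler_wpM2r.
  apply: le_trans (ler_normD _ _) _.
  have := ler_normD (- (rho * f0 i)) (d ^+ 2 * f1 i ^+ 2); rewrite normrN.
  by move: h1 h2 h3; rewrite !expr2; lra.
rewrite normrM (gtr0_norm (x := (_ * _)^-1)) ?invr_gt0 ?mulr_gt0 ?exprn_gt0//.
apply: (@le_trans _ _ (3 * K ^+ 2 * d ^+ 2 * (2 / c ^+ 3))).
  by rewrite ler_pM// invr_ge0 mulr_ge0 ?sqr_ge0// ltW.
rewrite [leLHS](_ : _ = 6 * K ^+ 2 / c ^+ 3 * d ^+ 2); last by ring.
by rewrite ler_wpM2r ?sqr_ge0// -addrA lerDl addr_ge0.
Qed.

End Closure.

End UniformTaylor.

(** * The derivative of the force and the Newton direction *)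

Section ForceDerivative.
Set Implicit Arguments.
Unset Strict Implicit.
Context {R : realType} {H : hilbertType R}.
Variable mu : probability (borel H) R.
Hypothesis mu_sphere : mu sphere = 1%E.
Implicit Types (w x y z e X Y : H) (s r : R).

Lemma directorE w x : sphere x ->
  director w x = ((1 - `|w| ^+ 2) / 2) *: sigma w x.
Proof.
move=> x1; apply: inner_ext => y.
rewrite [RHS]innerZl inner_sigma /director /sden.
by rewrite !innerE (sphere_norm x1) expr1n mulr1; ring.
Qed.

Lemma bfield_director w : `|w| < 1 -> bounded_field (director w).
Proof.
move=> w1; split => [y|].
  apply: (@eq_bm _ _ (fun x => ((1 - `|w| ^+ 2) / 2) * inner (sigma w x) y)).
    by move=> x; rewrite inE => x1; rewrite (directorE w x1) [RHS]innerZl.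
  by apply: bmZ; exact: bm_sigma.
exists `|(1 - `|w| ^+ 2) / 2| => x x1.
by rewrite directorE// normrZ sigma_sphere// mulr1.
Qed.

Lemma force_mean w : `|w| < 1 ->
  force mu w = ((1 - `|w| ^+ 2) / 2) *: mean mu w.
Proof.
move=> w1; apply: (wavg_unique mu_sphere); first exact: bfield_director.
move=> y; rewrite innerZl inner_mean// -avgZ//; last exact: bm_sigma.
by apply: eq_avg => x x1; rewrite (directorE w x1) [RHS]innerZl.
Qed.

Lemma barycenter_mean w :
  conformal_barycenter mu w <-> `|w| < 1 /\ mean mu w = 0.
Proof.
split=> -[w1 h]; split => //; last by rewrite force_mean// h scaler0.
apply/eqP; move/eqP: h; rewrite force_mean// scaler_eq0 => /orP[|//].
by rewrite mulf_eq0 invr_eq0 (gt_eqF (sqr_norm_lt1 w1)) pnatr_eq0.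
Qed.

Lemma pnorm_force w : `|w| < 1 -> pnorm w (force mu w) = `|mean mu w|.
Proof.
move=> w1; have n0 := sqr_norm_lt1 w1.
rewrite pnormE// force_mean// normrZ ger0_norm; last by rewrite divr_ge0// ltW.
by field; rewrite gt_eqF.
Qed.

(** The covariant derivative of the director field is [X] paired with [sigma w x], times
    [sigma w x], minus [X]; removing the Christoffel term leaves the ordinary derivative. *)
Definition director_derive w X x : H :=
  inner (sigma w x) X *: sigma w x - X
  - christoffel w X (((1 - `|w| ^+ 2) / 2) *: sigma w x).

(** The closure rules follow the formula of the director, uniformly in [x] because the denominator
    stays above [(1 - |w|)^2]; matching the resulting coefficients is a rational identity. *)
Lemma utaylor_director w X : `|w| < 1 ->
  utaylor sphere (fun x d => director (d *: X + w) x) (director w)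
    (director_derive w X).
Proof.
move=> w1; have n0 := sqr_norm_lt1 w1.
pose M := `|w| + `|X| + 1 + 1.
have M0 : 0 <= M by rewrite /M !addr_ge0.
have wM : `|w| <= M by rewrite /M; have := normr_ge0 X; lra.
have XM : `|X| <= M by rewrite /M; have := normr_ge0 w; lra.
have Tv : utaylor sphere (fun (_ : H) d => w + d *: X) (fun=> w) (fun=> X).
  exact: (@utaylor_affine R H sphere H (fun=> w) (fun=> X) M).
have Tx : utaylor sphere (fun x d => x + d *: (0 : H)) id (fun=> 0).
  apply: (@utaylor_affine R H sphere H id (fun=> 0) M) => x x1.
  rewrite normr0 (sphere_norm x1) /M; split => //.
  by have := normr_ge0 X; have := normr_ge0 w; lra.
have Tc k : utaylor sphere (fun (_ : H) (d : R) => k + d *: (0 : R)) (fun=> k) (fun=> 0).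
  by apply: (@utaylor_affine R H sphere R (fun=> k) (fun=> 0) `|k|); rewrite normr0.
have Ta : utaylor sphere (fun x (d : R) => inner w x + d *: inner X x)
    (inner w) (inner X).
  apply: (@utaylor_affine R H sphere R (inner w) (inner X) M) => x x1.
  have := cauchy_schwarz w x; have := cauchy_schwarz X x.
  by rewrite (sphere_norm x1) !mulr1; lra.
have Tn : utaylor sphere (fun (_ : H) (d : R) => `|w + d *: X| ^+ 2)
    (fun=> `|w| ^+ 2) (fun=> 2 * inner w X).
  exists (M ^+ 2 * 2), 1; split; rewrite ?mulr_ge0 ?sqr_ge0// => x _.
  have wM2 : `|w| ^+ 2 <= M ^+ 2 by rewrite lerXn2r ?nnegrE.
  have XM2 : `|X| ^+ 2 <= M ^+ 2 by rewrite lerXn2r ?nnegrE.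
  have M2 := sqr_ge0 M.
  split.
  - by rewrite ger0_norm ?sqr_ge0//; lra.
  - rewrite normrM ger0_norm// mulrC ler_wpM2r//.
    by apply: le_trans (cauchy_schwarz _ _) _; rewrite expr2 ler_pM.
  - move=> d _; rewrite sqr_normD innerZr normrZ exprMn real_normK ?num_real//.
    rewrite /GRing.scale/= [X in `|X|](_ : _ = d ^+ 2 * `|X| ^+ 2); last by ring.
    have e := mulr_ge0 (sqr_ge0 d) (sqr_ge0 `|X|).
    rewrite (ger0_norm e) mulrC ler_wpM2r ?sqr_ge0//; lra.
have T1n := utaylorD (Tc 1) (utaylorZ (Tc (- 1)) Tn).
have T1a := utaylorD (Tc 1) (utaylorZ (Tc (- 1)) Ta).
have TD := utaylorD (utaylorD (Tc 1) (utaylorZ (Tc (- 2)) Ta)) Tn.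
have c0 : 0 < (1 - `|w|) ^+ 2 by rewrite exprn_gt0// subr_gt0.
have D0 x : sphere x -> (1 - `|w|) ^+ 2 <= 1 + -2 *: inner w x + `|w| ^+ 2.
  move=> x1; have := sden_sphere_ge w1 x1.
  by rewrite /sden (sphere_norm x1) expr1n mulr1 /GRing.scale/= mulNr.
have TiD := utaylorV c0 D0 TD.
have TN := utaylorD (utaylorZ (utaylorZ T1n T1n) Tx) (utaylorZ (Tc (- 1))
  (utaylorZ (utaylorZ (Tc 2) (utaylorZ T1n T1a)) Tv)).
have T := utaylorZ (Tc (2^-1)) (utaylorZ TiD TN).
apply: utaylor_eq T => [x d x1|x x1|x x1].
- rewrite /director (addrC (d *: X)); apply: inner_ext => y.
  rewrite [inner (w + d *: X) x]innerDl innerZl !innerE /GRing.scale/=.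
  by rewrite !mulr0 !addr0 !mulNr !mul1r; ring.
- rewrite /director; apply: inner_ext => y.
  by rewrite !innerE /GRing.scale/=; rewrite !mulNr !mul1r; ring.
- have D1 := lt0r_neq0 (lt_le_trans c0 (D0 x x1)).
  have n1 := lt0r_neq0 n0.
  rewrite /director_derive /christoffel; apply: inner_ext => y.
  rewrite !innerE !inner_norm (sphere_norm x1) expr1n mulr1 /GRing.scale/=.
  rewrite (innerC x X) (innerC X w); move: n1 D1.
  rewrite /GRing.scale/=.
  move: (`|w| ^+ 2) (inner w x) (inner w X) (inner X x) => n a p q.
  move: (inner w y) (inner X y) (inner x y) => wy Xy xy n1 D1.
  have D2 : 1 - 2 * a + n != 0 by move: D1; rewrite mulNr.
  have -> : 1 + -2 * a + n = 1 - 2 * a + n by ring.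
  by field; rewrite n1 D2.
Qed.

Lemma bm_director_derive w X y : `|w| < 1 ->
  bounded_mfun (fun x => inner (director_derive w X x) y).
Proof.
move=> w1; have b u := bm_sigma u w1.
apply: (@eq_bm _ _ (fun x => inner (sigma w x) X * inner (sigma w x) y -
  inner X y - inner (sigma w x) (((1 - `|w| ^+ 2) / 2 * (2 / (1 - `|w| ^+ 2))) *:
    (inner w X *: y + inner X y *: w - inner w y *: X)))).
  move=> x _; rewrite /director_derive /christoffel; move: (sigma w x) => u.
  by rewrite !innerE (innerC w u) (innerC X u); ring.
apply: bmB; last exact: b.
by apply: bmB; [exact: bmM|exact: bm_cst].
Qed.

Lemma bfield_director_derive w X : `|w| < 1 -> bounded_field (director_derive w X).
Proof.
move=> w1; split => [y|]; first exact: bm_director_derive.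
have [K [r [_ _ _ h]]] := utaylor_director X w1.
by exists K => x x1; have [] := h x x1.
Qed.

Lemma force_derive w X : `|w| < 1 ->
  is_derive w X (force mu) (wavg mu (director_derive w X)).
Proof.
move=> w1; have [K [r [K0 r0 r1 h]]] := utaylor_director X w1.
(* For such [d] the point [d *: X + w] stays in the ball; the added 1 covers [X = 0]. *)
have q0 : 0 < (1 - `|w|) / (`|X| + 1) / 2.
  by rewrite !divr_gt0 ?subr_gt0// ltr_wpDl.
apply: (@taylor_derive _ _ _ _ _ _ _ K (Num.min r ((1 - `|w|) / (`|X| + 1) / 2))).
  by rewrite lt_min r0.
move=> d; rewrite le_min => /andP[dr dq].
have v1 : `|d *: X + w| < 1.
  apply: le_lt_trans (ler_normD _ _) _; rewrite normrZ -ltrBrDr.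
  have h1 : `|d| * `|X| <= (1 - `|w|) / (`|X| + 1) / 2 * (`|X| + 1).
    by rewrite ler_pM// lerDl.
  apply: le_lt_trans h1 _; rewrite mulrAC divfK; last first.
    by rewrite gt_eqF// ltr_wpDl.
  by move: w1; lra.
apply: norm_le_inner => [|y]; first by rewrite mulr_ge0// sqr_ge0.
have b1 := bfield_director v1; have b2 := bfield_director w1.
have b3 := bfield_director_derive X w1.
have [m1 _] := b1; have [m2 _] := b2; have [m3 _] := b3.
have -> : inner (force mu (d *: X + w) - force mu w -
    d *: wavg mu (director_derive w X)) y =
  avg mu (fun x => inner (director (d *: X + w) x) y - inner (director w x) y -
    d * inner (director_derive w X x) y).
  rewrite !innerE (wavgE mu_sphere y b1) (wavgE mu_sphere y b2).
  rewrite (wavgE mu_sphere y b3) avgB//; [|exact: bmB|exact: bmZ].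
  by rewrite avgB// avgZ.
apply: avg_le_cst => //; first by apply: bmB; [exact: bmB|exact: bmZ].
move=> x x1; have [_ _ /(_ d dr) hx] := h x x1.
rewrite -innerZl -!innerBl; apply: le_trans (inner_le _ _) _.
by rewrite ler_wpM2r.
Qed.

(** The Christoffel terms of [nabla] and [director_derive] cancel. To see this under the average,
    the Christoffel operator is moved onto [y], which gives the vector [g]. *)
Lemma inner_nabla_force w X y : `|w| < 1 ->
  inner (nabla (force mu) w X) y = cov mu w X y - inner X y.
Proof.
move=> w1; rewrite /nabla; have [_ ->] := force_derive X w1.
rewrite innerDl wavgE//; last exact: bfield_director_derive.
pose g := (2 / (1 - `|w| ^+ 2)) *:
    (inner w X *: y + inner X y *: w - inner w y *: X).
have hg Y : inner (christoffel w X Y) y = inner Y g.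
  by rewrite /christoffel /g !innerE (innerC w Y) (innerC X Y); ring.
rewrite hg force_mean// innerZl inner_mean//.
have b u := bm_sigma u w1.
rewrite (@eq_avg _ _ _ _ (fun x => inner (sigma w x) X * inner (sigma w x) y -
  inner X y - (1 - `|w| ^+ 2) / 2 * inner (sigma w x) g)); last first.
  by move=> x _; rewrite /director_derive !innerBl hg !innerZl.
rewrite avgB//; [|by apply: bmB; [exact: bmM|exact: bm_cst]|exact: bmZ].
rewrite avgB//; [|exact: bmM|exact: bm_cst].
by rewrite avg_cst// avgZ// subrK.
Qed.

Section Direction.
Variables (alpha lam : R) (w : H).
Hypotheses (alpha0 : 0 <= alpha) (w1 : `|w| < 1) (lam0 : 0 < lam)
  (hlam : forall e, `|e| = 1 -> lam <= 1 - cov mu w e e).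

Let reg := regularized_nabla alpha mu w.
Let a X Y : R := (1 + alpha * `|mean mu w| ^+ 2) * inner X Y - cov mu w X Y.

Lemma inner_regularized_nabla X y : inner (reg X) y = - a X y.
Proof.
rewrite /reg /regularized_nabla innerBl innerZl inner_nabla_force// pnorm_force//.
by rewrite /a; ring.
Qed.

Lemma covC X Y : cov mu w X Y = cov mu w Y X.
Proof. by apply: eq_avg => x _; rewrite mulrC. Qed.

Lemma covDl X Y Z : cov mu w (X + Y) Z = cov mu w X Z + cov mu w Y Z.
Proof.
rewrite /cov -avgD//; [|by apply: bmM; exact: bm_sigma..].
by apply: eq_avg => x _; rewrite innerDr mulrDl.
Qed.

Lemma covZl k X Z : cov mu w (k *: X) Z = k * cov mu w X Z.
Proof.
rewrite /cov -avgZ//; last by apply: bmM; exact: bm_sigma.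
by apply: eq_avg => x _; rewrite innerZr mulrA.
Qed.

Lemma cov0l Z : cov mu w 0 Z = 0.
Proof. by rewrite -(scale0r (0 : H)) covZl mul0r. Qed.

Lemma cov_sub X : lam * `|X| ^+ 2 <= `|X| ^+ 2 - cov mu w X X.
Proof.
have [->|X0] := eqVneq X 0.
  by rewrite cov0l normr0 expr0n/= mulr0 subr0.
have nX : `|X| != 0 by rewrite normr_eq0.
pose e := `|X|^-1 *: X.
have e1 : `|e| = 1 by rewrite normrZ normfV normr_id mulVf.
have XE : X = `|X| *: e by rewrite scalerA mulfV// scale1r.
have -> : cov mu w X X = `|X| ^+ 2 * cov mu w e e.
  by rewrite {1 2}XE covZl covC covZl; ring.
by have := ler_wpM2l (sqr_ge0 `|X|) (hlam e1); lra.
Qed.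

Lemma form_coercive X : lam * `|X| ^+ 2 <= a X X.
Proof.
apply: le_trans (cov_sub X) _; rewrite /a inner_norm.
have := mulr_ge0 (mulr_ge0 alpha0 (sqr_ge0 `|mean mu w|)) (sqr_ge0 `|X|).
by lra.
Qed.

Lemma form_bounded X Y : a X Y <=
  (1 + alpha * `|mean mu w| ^+ 2 + 1) * (`|X| * `|Y|).
Proof.
have h1 := inner_le X Y.
have h2 : - cov mu w X Y <= `|X| * `|Y|.
  rewrite -avgN//; last by apply: bmM; exact: bm_sigma.
  apply: avg_le_cst => //.
    by apply: bmN; apply: bmM; exact: bm_sigma.
  move=> x x1; apply: le_trans (ler_norm _) _; rewrite normrN normrM.
  have := cauchy_schwarz (sigma w x) X; have := cauchy_schwarz (sigma w x) Y.
  by rewrite sigma_sphere// !mul1r => *; rewrite ler_pM.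
have c0 : 0 <= 1 + alpha * `|mean mu w| ^+ 2.
  by rewrite addr_ge0// mulr_ge0// sqr_ge0.
by rewrite [leRHS]mulrDl mul1r /a; apply: lerD => //; rewrite ler_wpM2l.
Qed.

(** Coercivity makes the operator injective and Lax-Milgram places the force in its range, so [pinv]
    returns the true preimage. If that is 0, any unit vector serves as direction, with [r = 0]. *)
Lemma newton_direction_dir : exists e r, newton_dir mu alpha w e r /\
  newton_direction alpha mu w = ((1 - `|w| ^+ 2) / 2 * r) *: e.
Proof.
have [z hz] : exists z, forall y, a z y = inner (mean mu w) y.
  apply: (symmetric_lax_milgram lam0 _ _ _ form_coercive form_bounded).
  - by move=> x y; rewrite /a innerC covC.
  - by move=> x y u; rewrite /a innerDl covDl; ring.
  - by move=> k x y; rewrite /a innerZl covZl; ring.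
  - exact: innerDr.
  - by move=> k x; rewrite innerZr.
  - exact: inner_le.
have inj : injective reg.
  move=> X Y XY; apply/eqP; rewrite -subr_eq0 -normr_eq0 -sqrf_eq0.
  rewrite eq_le sqr_ge0 andbT -(pmulr_rle0 _ lam0).
  apply: le_trans (form_coercive _) _.
  have h y : a X y = a Y y by apply: oppr_inj; rewrite -!inner_regularized_nabla XY.
  have aB y : a (X - Y) y = a X y - a Y y.
    by rewrite /a -scaleN1r innerDl innerZl covDl covZl; ring.
  by rewrite aB h subrr.
have vE : newton_direction alpha mu w = ((1 - `|w| ^+ 2) / 2) *: z.
  rewrite /newton_direction; apply/eqP; rewrite eqr_oppLR; apply/eqP.
  have -> : force mu w = reg (- (((1 - `|w| ^+ 2) / 2) *: z)).
    apply: inner_ext => y; rewrite inner_regularized_nabla force_mean// innerZl -hz.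
    have -> : - (((1 - `|w| ^+ 2) / 2) *: z) = (- ((1 - `|w| ^+ 2) / 2)) *: z.
      by rewrite scaleNr.
    by rewrite /a innerZl covZl; ring.
  by apply: pinvKV; [move=> X Y _ _; exact: inj|rewrite inE].
have [e0 e01] := sphere_nonempty mu_sphere.
have [z0|z0] := eqVneq z 0.
  exists e0, 0; split; last by rewrite vE z0 scaler0 mulr0 scale0r.
  by split => // y; rewrite mul0r -hz z0 /a inner0l cov0l mulr0 subr0.
have nz : `|z| != 0 by rewrite normr_eq0.
exists (`|z|^-1 *: z), `|z|; split; last first.
  by rewrite vE scalerA -mulrA mulfV// mulr1.
split => [|//|y]; first by rewrite normrZ normfV normr_id mulVf.
rewrite -hz /a innerZl covZl; by field.
Qed.

End Direction.

End ForceDerivative.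

(** * Both algorithms perform the same step *)

Section Reduction.
Set Implicit Arguments.
Unset Strict Implicit.
Context {R : realType} {H : hilbertType R}.
Implicit Types (mu : probability (borel H) R) (w x y z e X Y : H) (s r : R).

Lemma sigma0 z : sigma 0 z = z.
Proof.
rewrite /sigma inner0l normr0 expr0n/= mul0r mulr0 subr0 addr0 invr1 !scale1r.
by rewrite scaler0 subr0.
Qed.

Lemma mu_sphereC mu : mu sphere = 1%E -> mu (~` sphere) = 0%E.
Proof.
move=> h; have := probability_setC mu (@measurable_sphere R H).
by move=> ->; rewrite h subee.
Qed.

Lemma bounded_mfun_integrable mu (f : borel H -> R) M :
  measurable_fun setT f -> (forall x, `|f x| <= M) ->
  mu.-integrable setT (EFin \o f).
Proof.
move=> mf hM; apply: measurable_bounded_integrable => //.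
  by rewrite (le_lt_trans (probability_le1 _ _)) ?ltry.
exists M; split; first by rewrite num_real.
by move=> N MN x _ /=; exact: le_trans (hM x) (ltW MN).
Qed.

(** Measures live on all of [H], so variables are changed there for [f] cut off outside the sphere;
    the complement is [mu]-null, and [sigma w] maps the sphere into itself. *)
Lemma avg_pushforward mu w (f : H -> R) : mu sphere = 1%E -> `|w| < 1 ->
  bounded_mfun f ->
  avg (pushforward_sigma w mu) f = avg mu (fun x => f (sigma w x)).
Proof.
move=> mu1 w1 [mf [M hM]].
have msph := @measurable_sphere R H.
pose g : borel H -> R := f \_ sphere.
have mg : measurable_fun setT g
  by have [h _] := measurable_restrictT (f : borel H -> R) msph; exact: h.
have gM x : `|g x| <= `|M|.
  rewrite /g patchE; case: ifPn => [|_]; last by rewrite normr0.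
  by rewrite inE => sx; apply: le_trans (hM x sx) (ler_norm _).
have ms := @measurable_sigma_borel R H w.
have mgs : measurable_fun setT (fun x : borel H => g (sigma_borel w x)).
  exact: measurableT_comp.
have ig := bounded_mfun_integrable mu mgs (fun x => gM (sigma_borel w x)).
rewrite /avg Rintegral_mkcond /Rintegral; congr fine.
rewrite /pushforward_sigma integral_distribution//; last first.
  by apply/measurable_EFinP.
rewrite (negligible_integral (measurableC msph) measurableT ig (mu_sphereC mu1)).
rewrite setDE setCK setTI; apply: eq_integral => x; rewrite inE => sx /=.
by rewrite /g patchE ifT// inE; exact: sigma_sphere.
Qed.

Lemma pushforward_sphere mu w : mu sphere = 1%E -> `|w| < 1 ->
  pushforward_sigma w mu sphere = 1%E.
Proof.
move=> mu1 w1; have msph := @measurable_sphere R H.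
have ms := @measurable_sigma_borel R H w.
have mp : measurable (sigma_borel w @^-1` (sphere : set (borel H))).
  by rewrite -[X in measurable X]setTI; exact: ms.
apply/eqP; rewrite eq_le; apply/andP; split; first exact: probability_le1.
rewrite -mu1; apply: le_measure; rewrite ?inE//.
by move=> x sx; exact: sigma_sphere.
Qed.

Lemma mean_pushforward mu w : mu sphere = 1%E -> `|w| < 1 ->
  mean (pushforward_sigma w mu) 0 = mean mu w.
Proof.
move=> mu1 w1; have z1 : `|0 : H| < 1 by rewrite normr0.
apply: inner_ext => y; rewrite !inner_mean//; last exact: pushforward_sphere.
rewrite avg_pushforward//; last exact: bm_sigma.
by apply: eq_avg => x _; rewrite sigma0.
Qed.

Lemma cov_pushforward mu w X Y : mu sphere = 1%E -> `|w| < 1 ->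
  cov (pushforward_sigma w mu) 0 X Y = cov mu w X Y.
Proof.
move=> mu1 w1; have z1 : `|0 : H| < 1 by rewrite normr0.
rewrite /cov avg_pushforward//; last by apply: bmM; exact: bm_sigma.
by apply: eq_avg => x _; rewrite sigma0.
Qed.

Lemma merit_gmove mu w e r : mu sphere = 1%E -> `|w| < 1 -> `|e| = 1 ->
  merit mu w (((1 - `|w| ^+ 2) / 2 * r) *: e) =
  fun t => potential mu w + avg mu (fun x => phi (inner (sigma w x) e) (t * r)).
Proof.
move=> mu1 w1 e1; apply/funext => t; rewrite /merit scalerA.
rewrite (_ : t * ((1 - `|w| ^+ 2) / 2 * r) = (1 - `|w| ^+ 2) / 2 * (t * r)).
  by rewrite pexp_gmove// potential_gmove.
by ring.
Qed.

Lemma pexp_scale w e r t : `|w| < 1 -> `|e| = 1 ->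
  pexp w (t *: (((1 - `|w| ^+ 2) / 2 * r) *: e)) = gmove w e (t * r).
Proof.
move=> w1 e1; rewrite scalerA -pexp_gmove//; congr (pexp w (_ *: e)); ring.
Qed.

(** The constant [a] cancels from both conditions. It is the potential at the current iterate in
    (A), and that of the shifted measure at the origin in (B). *)
Lemma step_size_gmove mu (c1 c2 a : R) w e r t :
  mu sphere = 1%E -> `|w| < 1 -> `|e| = 1 ->
  step_size c1 c2 (fun t => a + avg mu (fun x => phi (inner (sigma w x) e) (t * r)))
    t ->
  [/\ 0 < t, armijo mu c1 w e r t /\ weak_wolfe mu c2 w e r t &
    armijo mu c1 w e r 1 /\ weak_wolfe mu c2 w e r 1 -> t = 1].
Proof.
move=> mu_sphere w1 e1; set f := fun t => _.
have df s : derive1 f s = r * avg mu (fun x => dphi (inner (sigma w x) e) (s * r)).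
  have h := avg_phi_derive mu_sphere r s w1 e1.
  have dfs : is_derive (s : R) 1 f
      (r * avg mu (fun x => dphi (inner (sigma w x) e) (s * r))).
    by eapply drv_eq; [eapply drvD; [exact: drvK|exact: h]|rewrite add0r].
  by rewrite derive1E; have [_ ->] := dfs.
have f0 : f 0 = a by rewrite /f mul0r avg_phi0// addr0.
have df0 : derive1 f 0 = r * - inner (mean mu w) e by rewrite df mul0r avg_dphi0.
have eqv s : wolfe c1 c2 f s <-> armijo mu c1 w e r s /\ weak_wolfe mu c2 w e r s.
  by rewrite /wolfe df0 f0 df /armijo /weak_wolfe /f lerD2l.
by move=> [t0 /eqv h1 h2]; split => // /eqv.
Qed.

Section Steps.
Variables (mu : probability (borel H) R) (alpha c1 c2 : R).
Hypotheses (mu_sphere : mu sphere = 1%E) (mu_stable : stable mu).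
Hypothesis alpha0 : 0 <= alpha.

Let nondegenerate w : `|w| < 1 -> exists2 lam : R, 0 < lam &
  forall e, `|e| = 1 -> lam <= 1 - cov mu w e e.
Proof.
move=> w1; have [lam lam0 h] := cov_bounded mu_sphere mu_stable w1.
by exists lam => // e e1; exact: h.
Qed.

Lemma newton_iterates_step (w : nat -> H) k :
  newton_iterates alpha c1 c2 mu w -> `|w k| < 1 ->
  newton_step mu alpha c1 c2 (w k) (w k.+1).
Proof.
move=> /(_ k) /= [t + ->] w1; have [lam lam0 hlam] := nondegenerate w1.
have [e [r [hd ->]]] := newton_direction_dir mu_sphere alpha0 w1 lam0 hlam.
have [e1 r0 _] := hd.
rewrite merit_gmove// pexp_scale// => /(step_size_gmove mu_sphere w1 e1)[t0 h1 h2].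
by exists e, r, t.
Qed.

(** At the origin the shifted measure has the mean and second moment that [mu] has at [w k], so [e]
    and [r] satisfy the Newton equation at [w k]. *)
Lemma shifted_newton_iterates_step (w : nat -> H) k :
  shifted_newton_iterates alpha c1 c2 mu w -> `|w k| < 1 ->
  newton_step mu alpha c1 c2 (w k) (w k.+1).
Proof.
move=> /(_ k) /= [t + ->] w1; have [lam lam0 hlam] := nondegenerate w1.
have nu1 := pushforward_sphere mu_sphere w1.
have z1 : `|0 : H| < 1 by rewrite normr0.
have hlam' e : `|e| = 1 -> lam <= 1 - cov (pushforward_sigma (w k) mu) 0 e e.
  by move=> e1; rewrite cov_pushforward// hlam.
have [e [r [[e1 r0 h] ->]]] := newton_direction_dir nu1 alpha0 z1 lam0 hlam'.
have hd : newton_dir mu alpha (w k) e r.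
  split => // y; have := h y; rewrite mean_pushforward// => <-.
  by rewrite cov_pushforward.
rewrite merit_gmove// pexp_scale//.
have -> : gmove 0 e (t * r) = th (t * r) *: e by rewrite /gmove oppr0 sigma0.
rewrite (_ : (fun t => _) = fun t => potential (pushforward_sigma (w k) mu) 0 +
    avg mu (fun x => phi (inner (sigma (w k) x) e) (t * r))); last first.
  apply/funext => s; congr (_ + _); rewrite avg_pushforward//; last exact: bm_phi.
  by apply: eq_avg => x _; rewrite sigma0.
move=> /(step_size_gmove mu_sphere w1 e1)[t0 h1 h2].
by exists e, r, t.
Qed.

End Steps.

End Reduction.

(** * Global convergence and the quadratic rate *)

Section Convergence.
Set Implicit Arguments.
Unset Strict Implicit.
Context {R : realType} {H : hilbertType R}.
Variables (mu : probability (borel H) R) (alpha c1 c2 : R).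
Hypotheses (mu_sphere : mu sphere = 1%E) (mu_stable : stable mu).
Hypotheses (alpha0 : 0 <= alpha) (c10 : 0 < c1) (c12 : c1 < c2) (c21 : c2 < 1).
Variable ws : H.
Hypotheses (ws1 : `|ws| < 1) (mws : mean mu ws = 0).
Implicit Types (w : H).

Let step := newton_step mu alpha c1 c2.

Lemma newton_step_ball w w' : `|w| < 1 -> step w w' -> `|w'| < 1.
Proof. by move=> w1 [e [r [t [[e1 _ _] _ _ _ ->]]]]; exact: gmove_ball. Qed.

(** The initial sublevel set confines all iterates to one ball, so a single [c] governs every
    decrease. As the potential is bounded below, decreases and hence means tend to 0, and
    [dist_le_mean] concludes. *)
Lemma newton_step_converges (w : nat -> H) : `|w 0%N| < 1 ->
  (forall k, `|w k| < 1 -> step (w k) (w k.+1)) ->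
  (forall k, `|w k| < 1) /\
  forall eps : R, 0 < eps -> exists N, forall k, (N <= k)%N -> `|w k - ws| <= eps.
Proof.
move=> w01 hs; have w1 k : `|w k| < 1.
  by elim: k => // k wk; exact: newton_step_ball (hs k wk).
split => // eps eps0.
have [rho [rho0 rho1 hrho]] :=
  sublevel_bounded mu_sphere mu_stable (potential mu (w 0%N)).
have [lam lam0 hlam] := cov_bounded mu_sphere mu_stable rho1.
have [kap kap0 hkap] := dist_le_mean mu_sphere mu_stable ws1 mws rho1.
pose c := c1 * (1 - c2) * (lam / (2 + alpha)) ^+ 2.
have c0 : 0 < c.
  apply: mulr_gt0; first by rewrite mulr_gt0// subr_gt0.
  by apply: exprn_gt0; apply: divr_gt0 => //; move: alpha0; lra.
have dec k : `|w k| <= rho ->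
    potential mu (w k.+1) <= potential mu (w k) - c * `|mean mu (w k)| ^+ 2.
  move=> wr; have [e [r [t [hd t0 [ha hw] _ ->]]]] := hs k (w1 k).
  have [e1 _ _] := hd.
  exact: (armijo_decrease mu_sphere alpha0 c10 c21 (w1 k) hd lam0
    (hlam (w k) e wr e1) t0 ha hw).
have wr k : `|w k| <= rho /\ potential mu (w k) <= potential mu (w 0%N).
  elim: k => [|k [wk pk]]; first by split => //; exact: hrho.
  have pk1 : potential mu (w k.+1) <= potential mu (w 0%N).
    apply: le_trans (dec k wk) _; apply: le_trans pk.
    by rewrite gerBl mulr_ge0 ?sqr_ge0// ltW.
  by split => //; exact: hrho.
have mono k l : potential mu (w (k + l)%N) <= potential mu (w k).
  elim: l => [|l]; first by rewrite addn0.
  apply: le_trans; rewrite addnS; apply: le_trans (dec _ (wr _).1) _.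
  by rewrite gerBl mulr_ge0 ?sqr_ge0// ltW.
have [a ha] := potential_bounded_below mu_sphere mu_stable.
(* Here [z n] is an index at which the potential is within [1 / (n + 1)] of its infimum along the
   orbit; by monotonicity all later indices are as good. *)
have [j [z [hj hz]]] : exists (j : R) (z : nat -> nat),
    (forall k, setT k -> j <= potential mu (w k)) /\
    forall n, setT (z n) /\ potential mu (w (z n)) <= j + n.+1%:R^-1.
  by apply: inf_sequence; [exists 0%N|exists a => k _; exact: ha].
have q0 : 0 < c * (kap * eps) ^+ 2.
  exact: mulr_gt0 c0 (exprn_gt0 2 (mulr_gt0 kap0 eps0)).
have [n hn] := eventually_invS_le q0.
exists (z n) => k zk.
have h1 := dec k (wr k).1; have h2 := hj k.+1 I; have [_ h3] := hz n.
have h4 := mono (z n) (k - z n)%N; rewrite subnKC// in h4.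
have h5 := hn n (leqnn n).
have : c * `|mean mu (w k)| ^+ 2 <= c * (kap * eps) ^+ 2.
  by move: h1 h2 h3 h4 h5; move: (n.+1%:R^-1) => u; lra.
have ke0 : 0 <= kap * eps by rewrite mulr_ge0 ?ltW.
rewrite ler_pM2l// ler_pXn2r ?nnegrE// => h6.
by rewrite -(ler_pM2l kap0); apply: le_trans h6; exact: hkap (wr k).1.
Qed.

Lemma newton_step_quadratic : c1 < 2^-1 -> exists rho eps C : R,
  [/\ rho < 1, 0 < eps, 0 < C & forall w w', `|w - ws| <= eps -> step w w' ->
    [/\ `|w| <= rho, `|w'| <= rho & `|w' - ws| <= C * `|w - ws| ^+ 2]].
Proof.
(* Two margins [g] fit between [|ws|] and [rho]: one for the distance of [w] from [ws], one for the
   step. *)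
move=> c1h; pose g := (1 - `|ws|) / 4; pose rho := (1 + `|ws|) / 2.
have g0 : 0 < g by rewrite divr_gt0// subr_gt0.
have rho1 : rho < 1 by rewrite /rho; move: ws1; lra.
have wsg : `|ws| + g + g = rho by rewrite /g /rho; field.
have [lam lam0 hlam] := cov_bounded mu_sphere mu_stable rho1.
have [kap kap0 hkap] := dist_le_mean mu_sphere mu_stable ws1 mws rho1.
have [Cm Cm0 hCm] := mean_le_dist mu_sphere ws1 mws rho1.
pose K := 13 + alpha * (2 + alpha).
have K0 : 0 < K by rewrite /K ltr_wpDr// mulr_ge0// addr_ge0.
have c20 : 0 < c2 by exact: lt_trans c12.
have al0 : 0 < alpha + lam^-1 by rewrite ltr_wpDl ?invr_gt0.
have c1p : 0 < 2^-1 - c1 by rewrite subr_gt0.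
(* A bound for the mean. Since [r <= |m w| / lam], its entries give in turn [|m w|^2 <= |m w|],
   [r <= 1], [r <= g], and the two smallness conditions of [unit_step_accepted]. *)
pose eta := Num.min 1 (Num.min (lam * (Num.min 1 (Num.min g (3 * (2^-1 - c1) * lam))))
  (c2 * lam / (alpha + lam^-1))).
have eta0 : 0 < eta.
  rewrite /eta !lt_min ltr01 mulr_gt0 ?divr_gt0 ?mulr_gt0//.
  by rewrite !lt_min ltr01 g0 !mulr_gt0.
have [et1 et2 et3] : [/\ eta <= 1,
    eta <= lam * (Num.min 1 (Num.min g (3 * (2^-1 - c1) * lam))) &
    eta <= c2 * lam / (alpha + lam^-1)].
  by rewrite /eta !ge_min !lexx !orbT.
have eps0 : 0 < Num.min g (eta / Cm) by rewrite lt_min g0 divr_gt0.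
have C0 : 0 < K * (Cm / lam) ^+ 2 / kap.
  by rewrite divr_gt0// mulr_gt0// exprn_gt0// divr_gt0.
exists rho, (Num.min g (eta / Cm)), (K * (Cm / lam) ^+ 2 / kap); split => //.
move=> w w'; rewrite le_min => /andP[wg we] [e [r [t [hd t0 hat hone w'E]]]].
have wr : `|w| <= rho.
  rewrite -(subrK ws w); apply: le_trans (ler_normD _ _) _.
  by move: wg g0 wsg; lra.
have w1 := le_lt_trans wr rho1.
have mC := hCm w wr.
have m_eta : `|mean mu w| <= eta.
  apply: le_trans mC _; rewrite mulrC -ler_pdivlMr//.
have [e1 r0 _] := hd; have hl := hlam w e wr e1.
have rm := newton_dir_le alpha0 hd hl.
have rm' : r <= `|mean mu w| / lam by rewrite ler_pdivlMr.
have : r <= Num.min 1 (Num.min g (3 * (2^-1 - c1) * lam)).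
  by rewrite -(ler_pM2l lam0) mulrC; move: rm m_eta et2; lra.
rewrite !le_min => /and3P[r1 rg rc].
have ok1 : alpha * `|mean mu w| ^+ 2 + r <= c2 * lam.
  have h1 : `|mean mu w| ^+ 2 <= `|mean mu w|.
    by rewrite expr2 ler_piMl// (le_trans m_eta).
  have h2 := ler_wpM2l alpha0 h1.
  have h3 : `|mean mu w| * (alpha + lam^-1) <= c2 * lam.
    by rewrite -ler_pdivlMr//; exact: le_trans m_eta et3.
  by move: h2 h3 rm'; lra.
have t1 := hone (unit_step_accepted mu_sphere alpha0 c10 c12 w1 hd hl ok1 rc c1h).
rewrite t1 mul1r in w'E.
have w'r : `|w'| <= rho.
  have [h1 _] := gmove_dist w1 e1 r0; rewrite -w'E in h1.
  have := ler_normD (w' - w) w; have := ler_normD (w - ws) ws.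
  by rewrite !subrK; move: h1 rg wg wsg; lra.
split => //.
(* The constant follows the chain [kap * |w' - ws| <= |m w'| <= K * r^2] with [r <= |m w| / lam <=
   (Cm / lam) * |w - ws|]. *)
have := unit_step_mean mu_sphere alpha0 w1 hd r1; rewrite -w'E -/K => hm.
have hk := hkap w' w'r.
rewrite mulrAC ler_pdivlMr// mulrC; apply: le_trans hk (le_trans hm _).
rewrite -mulrA ler_wpM2l ?(ltW K0)// -exprMn lerXn2r ?nnegrE//.
  by rewrite mulr_ge0// divr_ge0// ltW.
apply: le_trans rm' _; rewrite mulrAC ler_wpM2r ?invr_ge0 ?(ltW lam0)//.
Qed.

End Convergence.

Lemma limn_esup_le {R : realType} (u : nat -> R) (C : R) N :
  (forall k, (N <= k)%N -> u k <= C) ->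
  (limn_esup (fun k => (u k)%:E) <= C%:E)%E.
Proof.
move=> h; rewrite limn_esup_lim; apply: lime_le; first exact: is_cvg_esups.
exists N => // n /= Nn; rewrite /esups; apply: ge_ereal_sup => _ [k /= nk <-].
by rewrite lee_fin h// (leq_trans Nn).
Qed.

(* The rate is claimed for c1 < 1/2 only: for c1 = 1/2 the Armijo condition can
   reject the unit step along the whole sequence, and the iterates then need not
   converge faster than linearly. Everything else covers c1 <= 1/2. *)
Theorem theorem5p9 (R : realType) (H : hilbertType R)
    (alpha c1 c2 : R) (alpha_ge0 : 0 <= alpha)
    (c1_gt0 : 0 < c1) (c1_le : c1 <= 2^-1) (c1_lt_c2 : c1 < c2) (c2_lt1 : c2 < 1)
    (mu : probability (borel H) R) (mu_sphere : mu sphere = 1%E)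
    (mu_stable : stable mu) :
  (exists! wstar : H, conformal_barycenter mu wstar) /\
  (forall wstar : H, conformal_barycenter mu wstar ->
     exists2 C : R, 0 < C &
       forall w : nat -> H, `|w 0%N| < 1 ->
         newton_iterates alpha c1 c2 mu w \/
         shifted_newton_iterates alpha c1 c2 mu w ->
         ((fun k => pdist (w k) wstar) @ \oo --> (0 : R)) /\
         (c1 < 2^-1 ->
          (limn_esup (fun k =>
             (pdist (w k.+1) wstar / pdist (w k) wstar ^+ 2)%:E) <= C%:E)%E)).
Proof.
have [ws0 ws01 mws0] := mean_zero_exists mu_sphere mu_stable.
split.
  exists ws0; split; first by apply/(barycenter_mean mu_sphere); split.
  move=> w /(barycenter_mean mu_sphere)[w1 mw].
  exact: (mean_zero_unique mu_sphere mu_stable).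
move=> ws /(barycenter_mean mu_sphere)[ws1 mws].
have steps (w : nat -> H) : newton_iterates alpha c1 c2 mu w \/
    shifted_newton_iterates alpha c1 c2 mu w ->
    forall k, `|w k| < 1 -> newton_step mu alpha c1 c2 (w k) (w k.+1).
  move=> [hw|hw] k wk; first exact: newton_iterates_step.
  exact: shifted_newton_iterates_step.
have conv (w : nat -> H) : `|w 0%N| < 1 ->
    newton_iterates alpha c1 c2 mu w \/ shifted_newton_iterates alpha c1 c2 mu w ->
    (fun k => pdist (w k) ws) @ \oo --> (0 : R).
  move=> w01 /steps hs.
  have [w1 cv] := newton_step_converges mu_sphere mu_stable alpha_ge0 c1_gt0
    c2_lt1 ws1 mws w01 hs.
  pose rho := (1 + `|ws|) / 2.
  have rho1 : rho < 1 by rewrite /rho; move: ws1; lra.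
  have rho0 : 0 <= rho by rewrite /rho divr_ge0// addr_ge0.
  have wsr : `|ws| <= rho by rewrite /rho; move: ws1; lra.
  have n0 : 0 < 1 - rho ^+ 2 by rewrite subr_gt0 expr_lt1.
  apply/cvgrPdist_le => eps eps0.
  have d0 : 0 < Num.min ((1 - `|ws|) / 2) (eps / (2 / (1 - rho ^+ 2))).
    by rewrite lt_min !divr_gt0// subr_gt0.
  have [N hN] := cv _ d0; exists N => // k /= /hN; rewrite le_min => /andP[h1 h2].
  have wr : `|w k| <= rho.
    rewrite -(subrK ws (w k)); apply: le_trans (ler_normD _ _) _.
    by move: h1; rewrite /rho; lra.
  rewrite sub0r normrN ger0_norm; last first.
    by apply: le_trans (pdist_ge (w1 k) ws1); rewrite mulr_ge0.
  apply: le_trans (pdist_le wr wsr rho1) _.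
  by rewrite mulrC -ler_pdivlMr// divr_gt0.
(* At [c1 = 1/2] the rate clause is void and any constant will do. *)
have [c1h|c1h] := ltP c1 2^-1; last first.
  exists 1 => // w w01 hw; split => //; exact: conv.
(* These are chosen before the sequence, so one constant serves every starting point and both
   algorithms. *)
have [rho [eps [C [rho1 eps0 C0 hq]]]] := newton_step_quadratic mu_sphere mu_stable
  alpha_ge0 c1_gt0 c1_lt_c2 ws1 mws c1h.
pose r' := Num.max 0 (Num.max rho `|ws|).
have r'0 : 0 <= r' by rewrite le_max lexx.
have r'1 : r' < 1 by rewrite !gt_max ltr01 rho1.
have n0 : 0 < 1 - r' ^+ 2 by rewrite subr_gt0 expr_lt1.
have A0 : 0 < 2 / (1 - r' ^+ 2) by rewrite divr_gt0.
(* The numerator costs the upper conformal factor, while the squared denominator gains the square of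
   the lower bound 2. *)
exists (2 / (1 - r' ^+ 2) * C / 4); first by rewrite divr_gt0// mulr_gt0.
move=> w w01 hw; split; first exact: conv.
move=> _; have hs := steps w hw.
have [w1 cv] := newton_step_converges mu_sphere mu_stable alpha_ge0 c1_gt0
  c2_lt1 ws1 mws w01 hs.
have [N hN] := cv _ eps0.
apply: (@limn_esup_le _ _ _ N) => k /hN we.
have [wr w'r h] := hq _ _ we (hs k (w1 k)).
have d1 := pdist_ge (w1 k) ws1.
have d2 : pdist (w k.+1) ws <= 2 / (1 - r' ^+ 2) * `|w k.+1 - ws|.
  by apply: pdist_le => //; rewrite !le_max ?w'r ?lexx !orbT.
have p0 : 0 <= pdist (w k) ws by apply: le_trans d1; rewrite mulr_ge0.
(* If [ws] has been reached, division by zero gives 0, the intended reading of the quotient. *)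
have [->|pn0] := eqVneq (pdist (w k) ws) 0.
  by rewrite expr0n/= invr0 mulr0 divr_ge0// mulr_ge0 ?ltW.
rewrite ler_pdivrMr; last by rewrite exprn_gt0// lt_neqAle eq_sym pn0.
have h3 : (2 * `|w k - ws|) ^+ 2 <= pdist (w k) ws ^+ 2.
  by rewrite lerXn2r ?nnegrE ?mulr_ge0.
have := ler_wpM2l (mulr_ge0 (ltW A0) (ltW C0)) h3; have := ler_wpM2l (ltW A0) h.
by move: d2; move: (2 / (1 - r' ^+ 2)) => A; lra.
Qed.
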